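(* Fix $\alpha>0$ and $V>0$. For a lattice $\Lambda\subset\mathbb{R}^2$ define $$E_\Lambda(z;\alpha)=\sum_{\lambda\in\Lambda} e^{-\pi\alpha|\lambda+z|^2},\qquad z\in\mathbb{R}^2 .$$ Among all lattices $\Lambda\subset\mathbb{R}^2$ of covolume $V$, the quantity $\min_{z\in\mathbb{R}^2}E_\Lambda(z;\alpha)$ is maximized if and only if $\Lambda$ is a hexagonal lattice.
   Context: A lattice is $\Lambda=M\mathbb{Z}^2$ with $M\in GL(2,\mathbb{R})$; its covolume (density$^{-1}$) is $|\det M|$. A hexagonal lattice of covolume $V$ is any rotation of $c\,\{k(1,0)+l(\tfrac12,\tfrac{\sqrt3}{2}) : k,l\in\mathbb{Z}\}$ with $c>0$ chosen so that the covolume equals $V$. *)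

(* Defs.v *)
From HB Require Import structures.
From mathcomp Require Import all_boot all_order all_algebra.
From mathcomp Require Import all_classical all_reals all_analysis.
Set Implicit Arguments. Unset Strict Implicit. Unset Printing Implicit Defensive.
Import Order.TTheory GRing.Theory Num.Theory.
Local Open Scope classical_set_scope.
Local Open Scope ring_scope.

Section Defs.
Variable R : realType.

Definition lat_pt (M : 'M[R]_2) (k l : int) : R * R :=
  (M 0 0 * k%:~R + M 0 1 * l%:~R, M 1 0 * k%:~R + M 1 1 * l%:~R).

Definition lattice (M : 'M[R]_2) : set (R * R) :=
  [set p | exists k l : int, p = lat_pt M k l].

Definition sqnorm (p : R * R) : R := p.1 ^+ 2 + p.2 ^+ 2.

Definition padd (p q : R * R) : R * R := (p.1 + q.1, p.2 + q.2).

Definition theta_E (L : set (R * R)) (z : R * R) (alpha : R) : \bar R :=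
  (\esum_(p in L) (expR (- (pi * alpha * sqnorm (padd p z))))%:E)%E.

Definition minE (L : set (R * R)) (alpha : R) : \bar R :=
  ereal_inf [set theta_E L z alpha | z in [set: R * R]].

(* c * R_theta * [[1, 1/2], [0, sqrt 3 / 2]] : basis of a rotated, scaled
   hexagonal lattice with basis vectors c R_theta (1,0), c R_theta (1/2, sqrt3/2). *)
Definition hexmx (c theta : R) : 'M[R]_2 :=
  \matrix_(i < 2, j < 2)
    if i == 0 then
      (if j == 0 then c * cos theta
       else c * (cos theta / 2 - sin theta * (Num.sqrt 3 / 2)))
    else
      (if j == 0 then c * sin theta
       else c * (sin theta / 2 + cos theta * (Num.sqrt 3 / 2))).

Definition is_hexagonal (L : set (R * R)) : Prop :=
  exists c theta : R, 0 < c /\ L = lattice (hexmx c theta).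

End Defs.

(* Main.v *)
(** Reduce the lattice to an obtuse superbase [e1, e2, - e1 - e2] and record it by its normalised
    Selling parameters [s1 >= s2 >= s3 >= 0], with [s1 s2 + s2 s3 + s3 s1 = 4]; the hexagonal
    lattice is [s1 = s2 = s3 = sg], where [3 sg ^ 2 = 4].  Put [c = pi alpha V].  It suffices to
    exhibit, for a non-hexagonal lattice, one point where its energy is strictly below a lower
    bound [B] for all energies of the hexagonal lattice.

    If [c >= 4], [B] is the hexagonal energy at the circumcentre of a triangle of the superbase:
    it is the minimum, by AM-GM over the three rotations of the lattice about that point.  The
    other lattice is also evaluated at a circumcentre.  When [s3 >= 0.82], a second order Taylor
    estimate, whose first order term vanishes after averaging over the cyclic permutations of the
    [s_i], shows that the gain in the circumradius beats the change of the theta series; when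
    [s3 < 0.82] the two series are compared through explicit product bounds.

    If [c < 4], Poisson summation turns the energy into a dual series dominated by its shortest
    vectors, with parameter [t sg >= 14 / 5], [t = pi ^ 2 / c].  The hexagonal dual series is
    minimal at the third point [(1/3, - 1/3)].  The other lattice is tested at: some point of a
    coset of a finite torsion group, found by averaging, if the shortest dual vector is much
    shorter than in the hexagonal case; the half point [(1/2, 1/2)] if the longest of the three short
    dual vectors is much longer than in the hexagonal case; the third point otherwise.

    Poisson summation itself is proved by Polya's method: filtering the binomial expansion of
    [(1 + z) ^ (2 n)] by roots of unity gives a finite identity, and the Gaussian limit of the
    binomial coefficients, under a dominating series, yields the theta identity up to a constant
    factor, the same for all lattices; the plane case is the one-dimensional one applied twice. *)

Require Import Defs.
From HB Require Import structures.
From mathcomp Require Import all_boot all_order all_algebra.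
From mathcomp Require Import all_classical all_reals all_analysis.
From mathcomp Require Import finmap ring lra zify.
Set Implicit Arguments. Unset Strict Implicit. Unset Printing Implicit Defensive.
Import Order.TTheory GRing.Theory Num.Theory.
Import numFieldNormedType.Exports.
Local Open Scope classical_set_scope.
Local Open Scope ring_scope.

(** * Sums over the integer plane *)

(** No single test point serves all lattices; this is what splits the proof. In the dual series the
    weights of the three pairs of short vectors are multiplied by cosines, and the sum has to fall
    below that of the hexagonal lattice, about 1 - 3h with h = exp (- t sg). The third point gives
    each pair the cosine -1/2, which suits comparable weights; the half point gives -1, -1, +1,
    which suits a small third weight; a vector that dominates alone must get -1 while the others are
    averaged away. In the direct series the natural point is a deep hole, and the covering radius
    does the work.

    Selling parameters are chosen because rotations of order three permute them cyclically:
    averaging a comparison over such a rotation leaves only their sum at first order, and the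
    constraint on their pairwise products makes the deviation of that sum of second order. The
    constants stem from the border c = 4, where c sg exceeds 4.6 and t sg exceeds 2.82, so that h <
    0.06. Numerical claims are brought to polynomial inequalities by Taylor bounds for exp. *)

Section Hasum.
Variable R : realType.

(** Unconditional summation along finite sets. The dual series are signed, whereas [theta_E] is an
    [esum] of nonnegative terms; [esum_hasum] is the bridge. *)
Definition hasum (I : choiceType) (f : I -> R) (l : R) : Prop :=
  forall e, 0 < e -> exists A : {fset I}, forall B : {fset I},
    (A `<=` B)%fset -> `|\sum_(i <- B) f i - l| < e.

Lemma ler_sum_fsubset (I : choiceType) (f : I -> R) (A B : {fset I}) :
  (A `<=` B)%fset -> (forall i, 0 <= f i) ->
  \sum_(i <- A) f i <= \sum_(i <- B) f i.
Proof.
move=> AB f0; rewrite (big_fsetID _ (mem A) B) /=.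
have -> : [fset x in B | x \in A]%fset = A.
  by apply/fsetP => x; rewrite !inE; case: (boolP (x \in A)) => xA; rewrite ?andbF ?andbT// (fsubsetP AB).
by rewrite lerDl; apply: sumr_ge0.
Qed.

Lemma hasum_unique (I : choiceType) (f : I -> R) (l m : R) :
  hasum f l -> hasum f m -> l = m.
Proof.
move=> fl fm; apply/eqP; rewrite -subr_eq0 -normr_le0 leNgt; apply/negP => d0.
have [A hA] := fl (`|l - m| / 2) ltac:(lra).
have [B hB] := fm (`|l - m| / 2) ltac:(lra).
have := hA (A `|` B)%fset (fsubsetUl _ _); have := hB (A `|` B)%fset (fsubsetUr _ _).
set S := \sum_(_ <- _) _ => h1 h2.
have := ler_normD (S - m) (l - S); rewrite (_ : S - m + (l - S) = l - m); last by ring.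
by rewrite -(normrN (l - S)) opprB; lra.
Qed.

Lemma hasumD (I : choiceType) (f g : I -> R) (l m : R) :
  hasum f l -> hasum g m -> hasum (fun i => f i + g i) (l + m).
Proof.
move=> fl gm e e0.
have [A hA] := fl (e / 2) ltac:(lra); have [B hB] := gm (e / 2) ltac:(lra).
exists (A `|` B)%fset => C; rewrite fsubUset => /andP[/hA h1 /hB h2].
rewrite big_split /= (_ : _ + _ - _ = (\sum_(i <- C) f i - l) + (\sum_(i <- C) g i - m)); last by ring.
by apply: le_lt_trans (ler_normD _ _) _; lra.
Qed.

Lemma hasumZ (I : choiceType) (f : I -> R) (c l : R) :
  hasum f l -> hasum (fun i => c * f i) (c * l).
Proof.
move=> fl e e0; have c0 : 0 < `|c| + 1 by rewrite ltr_wpDl.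
have [A hA] := fl (e / (`|c| + 1)) ltac:(exact: divr_gt0).
exists A => B /hA; rewrite -mulr_sumr -mulrBr normrM ltr_pdivlMr// => h.
apply: le_lt_trans h; rewrite mulrC ler_wpM2l//; lra.
Qed.

Lemma hasumB (I : choiceType) (f g : I -> R) (l m : R) :
  hasum f l -> hasum g m -> hasum (fun i => f i - g i) (l - m).
Proof.
move=> fl /(hasumZ (-1)) gm; have := hasumD fl gm; rewrite mulN1r.
by under eq_fun do rewrite mulN1r.
Qed.

Lemma eq_hasum (I : choiceType) (f g : I -> R) (l : R) :
  (forall i, f i = g i) -> hasum f l -> hasum g l.
Proof. by move=> /funext ->. Qed.

Lemma hasum_sum (I J : choiceType) (B : seq J) (f : J -> I -> R) (l : J -> R) :
  (forall j, hasum (f j) (l j)) ->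
  hasum (fun i => \sum_(j <- B) f j i) (\sum_(j <- B) l j).
Proof.
move=> fl; elim: B => [|j B IH].
  under eq_fun do rewrite big_nil; rewrite big_nil => e e0.
  by exists fset0 => B _; rewrite big1// subr0 normr0.
by under eq_fun do rewrite big_cons; rewrite big_cons; exact: hasumD.
Qed.

Lemma ler_hasum (I : choiceType) (f g : I -> R) (l m : R) :
  (forall i, f i <= g i) -> hasum f l -> hasum g m -> l <= m.
Proof.
move=> fg fl gm; rewrite leNgt; apply/negP => ml.
have [A hA] := fl ((l - m) / 2) ltac:(lra).
have [B hB] := gm ((l - m) / 2) ltac:(lra).
have := hA (A `|` B)%fset (fsubsetUl _ _); have := hB (A `|` B)%fset (fsubsetUr _ _).
have := @ler_sum _ _ (A `|` B)%fset xpredT f g (fun i _ => fg i).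
by rewrite !ltr_norml; lra.
Qed.

Lemma hasum_ge_partial (I : choiceType) (f : I -> R) (l : R) (A : {fset I}) :
  (forall i, 0 <= f i) -> hasum f l -> \sum_(i <- A) f i <= l.
Proof.
move=> f0 fl; rewrite leNgt; apply/negP => lt.
have [B hB] := fl (\sum_(i <- A) f i - l) ltac:(lra).
have := hB (A `|` B)%fset (fsubsetUr _ _).
have := ler_sum_fsubset (fsubsetUl A B) f0.
by rewrite ltr_norml; lra.
Qed.

Lemma hasum_bounded (I : choiceType) (f : I -> R) (M : R) :
  (forall i, 0 <= f i) -> (forall A : {fset I}, \sum_(i <- A) f i <= M) ->
  exists2 l, hasum f l & l <= M.
Proof.
move=> f0 fM; pose S := [set x | exists A : {fset I}, x = \sum_(i <- A) f i].
have S0 : S !=set0 by exists (\sum_(i <- fset0) f i), fset0.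
have SM : ubound S M by move=> _ [A ->].
have Ssup : has_sup S by split=> //; exists M.
exists (sup S); last exact: ge_sup.
move=> e e0; have [_ [A ->] hA] := sup_adherent e0 Ssup.
exists A => B AB; have := ler_sum_fsubset AB f0.
have : \sum_(i <- B) f i <= sup S by apply: ub_le_sup; [exists M|exists B].
by rewrite ltr_norml; lra.
Qed.

Lemma hasum_dominated (I : choiceType) (f g : I -> R) (G : R) :
  (forall i, `|f i| <= g i) -> hasum g G -> exists l, hasum f l.
Proof.
move=> fg gG.
have fg' i : - g i <= f i <= g i by rewrite -ler_norml.
have [|A|l hl _] := @hasum_bounded _ (fun i => f i + g i) (2 * G).
- by move=> i; have := fg' i; lra.
- apply: le_trans (_ : \sum_(i <- A) (2 * g i) <= _).
    by apply: ler_sum => i _; have := fg' i; lra.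
  rewrite -mulr_sumr ler_pM2l ?ltr0n//; apply: hasum_ge_partial gG.
  by move=> i; exact: le_trans (fg i).
exists (l - G); apply: eq_hasum (hasumB hl gG) => i; ring.
Qed.

(** Both g + f and g - f are nonnegative, so their partial sums stay below their totals. *)
Lemma hasum_tail (I : choiceType) (f g : I -> R) (l G : R) (A : {fset I}) :
  (forall i, `|f i| <= g i) -> hasum f l -> hasum g G ->
  `|l - \sum_(i <- A) f i| <= G - \sum_(i <- A) g i.
Proof.
move=> fg fl gG; have fg' i : - g i <= f i <= g i by rewrite -ler_norml.
have : \sum_(i <- A) (f i + g i) <= l + G.
  by apply: hasum_ge_partial (hasumD fl gG) => i; have := fg' i; lra.
have : \sum_(i <- A) (g i - f i) <= G - l.
  by apply: hasum_ge_partial (hasumB gG fl) => i; have := fg' i; lra.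
by rewrite sumrB big_split /= ler_norml; lra.
Qed.

Lemma hasum_fin (I : choiceType) (f : I -> R) (A : {fset I}) :
  hasum (fun i => if i \in A then f i else 0) (\sum_(i <- A) f i).
Proof.
move=> e e0; exists A => B AB.
rewrite (_ : \sum_(i <- B) _ = \sum_(i <- A) f i) ?subrr ?normr0//.
rewrite -(big_fset_incl _ AB) /=; last by move=> i _ /negPf ->.
by apply: eq_big_seq => i ->.
Qed.

Lemma hasum_le_fin (I : choiceType) (f g : I -> R) (l G : R) (A : {fset I}) :
  (forall i, i \notin A -> f i <= g i) -> (forall i, 0 <= g i) ->
  hasum f l -> hasum g G -> l <= \sum_(i <- A) f i + G.
Proof.
move=> fg g0 fl gG; apply: ler_hasum fl (hasumD (hasum_fin f A) gG) => i.
by case: ifPn => [_|/fg]; rewrite ?lerDl// add0r.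
Qed.

Lemma hasum_ge_fin (I : choiceType) (f g : I -> R) (l G : R) (A : {fset I}) :
  (forall i, i \notin A -> - g i <= f i) -> (forall i, 0 <= g i) ->
  hasum f l -> hasum g G -> \sum_(i <- A) f i - G <= l.
Proof.
move=> fg g0 fl gG; apply: ler_hasum (hasumB (hasum_fin f A) gG) fl => i.
by case: ifPn => [_|/fg]; rewrite ?sub0r// gerBl.
Qed.

Lemma hasum_inj (I J : choiceType) (e : I -> J) (f : J -> R) (l : R) :
  injective e -> (forall j, (forall i, e i <> j) -> f j = 0) ->
  hasum (f \o e) l -> hasum f l.
Proof.
move=> einj f0 fel eps eps0; have [A hA] := fel _ eps0.
exists [fset e i | i in A]%fset => B AB.
pose inv j : option I :=
  if pselect (exists i, e i = j) is left h then Some (projT1 (cid h)) else None.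
have invK : ocancel inv e.
  by move=> j; rewrite /inv; case: pselect => // h /=; exact: projT2 (cid h).
have eK : pcancel e inv.
  move=> i; rewrite /inv; case: pselect => [h|[]]; last by exists i.
  by congr Some; apply: einj; exact: projT2 (cid h).
have pu : uniq (pmap inv B) := pmap_uniq invK (fset_uniq B).
have sub : (A `<=` [fset i in pmap inv B])%fset.
  apply/fsubsetP => i iA; rewrite !inE (can2_mem_pmap invK eK).
  by apply: (fsubsetP AB); apply/imfsetP; exists i.
suff <- : \sum_(i <- [fset i in pmap inv B]%fset) (f \o e) i = \sum_(j <- B) f j.
  exact: hA.
rewrite (perm_big (pmap inv B)); last first.
  by apply: uniq_perm; [exact: fset_uniq|exact: pu|move=> i; rewrite !inE].
rewrite big_pmap; apply: eq_bigr => j _.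
have := invK j; case E : (inv j) => [i|] /=; first by move=> ->.
move=> _; rewrite f0// => i ij; move: E; rewrite -ij eK//.
Qed.

Lemma hasum_comp_inj (I J : choiceType) (e : I -> J) (f : J -> R) (l : R) :
  injective e -> (forall j, (forall i, e i <> j) -> f j = 0) ->
  hasum f l -> hasum (f \o e) l.
Proof.
move=> einj f0 fl eps eps0; have [A hA] := fl _ eps0.
have [A0 hA0] : exists A0 : {fset I}, forall i, e i \in A -> i \in A0.
  exists [fset i | i in pmap (fun j =>
    if pselect (exists i, e i = j) is left h then Some (projT1 (cid h)) else None) A]%fset.
  move=> i iA; rewrite !inE mem_pmap; apply/mapP; exists (e i) => //.
  case: pselect => [h|[]]; last by exists i.
  by congr Some; apply: einj; rewrite (projT2 (cid h)).
exists A0 => B A0B.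
suff -> : \sum_(i <- B) (f \o e) i = \sum_(j <- (A `|` e @` B)%fset) f j.
  by apply: hA; exact: fsubsetUl.
rewrite -(big_fset_incl _ (fsubsetUr A (e @` B)%fset)) /=.
  by rewrite big_imfset//= => x y _ _; exact: einj.
move=> j; rewrite inE => /orP[jA|->//] jB; apply: f0 => i ij.
by move: jB; rewrite -ij => /imfsetP; apply; exists i => //=; apply/(fsubsetP A0B)/hA0; rewrite ij.
Qed.

Lemma hasum_bij (I J : choiceType) (e : I -> J) (e' : J -> I) (f : J -> R) (l : R) :
  cancel e e' -> cancel e' e -> hasum f l -> hasum (f \o e) l.
Proof.
move=> ee' e'e fl; apply: (@hasum_inj _ _ e'); first exact: can_inj e'e.
  by move=> i /(_ (e i)); rewrite ee'.
by apply: eq_hasum fl => j /=; rewrite e'e.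
Qed.

Lemma sum_fsetM (I J : choiceType) (A : {fset I}) (B : {fset J}) (f : I * J -> R) :
  \sum_(p <- (A `*` B)%fset) f p = \sum_(i <- A) \sum_(j <- B) f (i, j).
Proof.
rewrite (perm_big [seq (i, j) | i <- A, j <- B]) ?big_allpairs//.
apply: uniq_perm; first exact: fset_uniq.
  by apply: allpairs_uniq; [exact: fset_uniq|exact: fset_uniq|move=> [? ?] [? ?] _ _ []/= -> ->].
move=> [i j]; rewrite in_fsetM /=; apply/idP/allpairsP => [/andP[iA jB]|].
  by exists (i, j).
by move=> [[a b] /= [aA bB [-> ->]]]; rewrite aA.
Qed.

(** For signed families summability on the product is assumed. A finite set B of rows is compared
    with a rectangle B x D, where D is large enough both for these rows and for the product. *)
Lemma hasum_fubini (I J : choiceType) (f : I * J -> R) (g : I -> R) (l : R) :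
  hasum f l -> (forall i, hasum (fun j => f (i, j)) (g i)) -> hasum g l.
Proof.
move=> fl fg e e0; have [A hA] := fl (e / 2) ltac:(lra).
exists [fset p.1 | p in A]%fset => B AB.
have [C hC] := @hasum_sum _ _ B (fun i j => f (i, j)) g fg (e / 2) ltac:(lra).
pose D := (C `|` [fset p.2 | p in A])%fset.
have := hC D (fsubsetUl _ _).
have : (A `<=` B `*` D)%fset.
  apply/fsubsetP => p pA; rewrite in_fsetM inE; apply/andP; split.
    by apply: (fsubsetP AB); apply/imfsetP; exists p.
  by apply/orP; right; apply/imfsetP; exists p.
move=> /hA; rewrite sum_fsetM exchange_big /= !ltr_norml.
by move=> /andP[? ?] /andP[? ?]; apply/andP; split; lra.
Qed.

(** Every finite set of pairs lies in a rectangle, which gives summability; the value is then forced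
    by [hasum_fubini]. *)
Lemma hasum_tonelli (I J : choiceType) (f : I * J -> R) (g : I -> R) (l : R) :
  (forall p, 0 <= f p) -> (forall i, hasum (fun j => f (i, j)) (g i)) ->
  hasum g l -> hasum f l.
Proof.
move=> f0 fg gl; have g0 i : 0 <= g i.
  by have := @hasum_ge_partial _ _ _ fset0 (fun j => f0 (i, j)) (fg i); rewrite big_seq_fset0.
have [//|A|m fm _] := @hasum_bounded _ f l.
  pose B := [fset p.1 | p in A]%fset; pose C := [fset p.2 | p in A]%fset.
  apply: le_trans (_ : \sum_(i <- B) g i <= l); last exact: hasum_ge_partial.
  apply: le_trans (_ : \sum_(p <- (B `*` C)%fset) f p <= _).
    apply: ler_sum_fsubset => //; apply/fsubsetP => p pA; rewrite in_fsetM.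
    by apply/andP; split; apply/imfsetP; exists p.
  rewrite sum_fsetM; apply: ler_sum => i _.
  by apply: hasum_ge_partial (fg i).
by rewrite (hasum_unique gl (hasum_fubini fm fg)).
Qed.

Lemma hasumM (I J : choiceType) (f : I -> R) (g : J -> R) (l m : R) :
  (forall i, 0 <= f i) -> (forall j, 0 <= g j) -> hasum f l -> hasum g m ->
  hasum (fun p : I * J => f p.1 * g p.2) (l * m).
Proof.
move=> f0 g0 fl gm; apply: (@hasum_tonelli _ _ _ (fun i => f i * m)).
- by move=> p; apply: mulr_ge0.
- by move=> i; apply: eq_hasum (hasumZ (f i) gm).
- by rewrite mulrC; apply: eq_hasum (hasumZ m fl) => i; rewrite mulrC.
Qed.

Lemma esum_hasum (I : choiceType) (f : I -> R) (l : R) :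
  (forall i, 0 <= f i) -> hasum f l -> (\esum_(i in [set: I]) (f i)%:E = l%:E)%E.
Proof.
move=> f0 fl; apply/eqP; rewrite eq_le; apply/andP; split.
  apply: ge_ereal_sup => _ [A [finA _] <-].
  rewrite fsbig_finite//= sumEFin lee_fin; exact: hasum_ge_partial.
apply/lee_addgt0Pr => e e0; have [A hA] := fl _ e0.
apply: le_trans (_ : (\sum_(i <- A) f i)%:E + e%:E <= _)%E.
  rewrite -EFinD lee_fin; have := hA A (fsubset_refl _); rewrite ltr_norml; lra.
rewrite leeD2r//; apply: ereal_sup_ubound; exists [set` A].
  by split => //; exact: finite_fset.
by rewrite fsbig_finite ?finite_fset//= set_fsetK sumEFin.
Qed.

(** Tannery's theorem: outside one finite set all the series have tails below e / 3, inside it there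
    are finitely many limits. It serves both sides of Polya's identity. *)
Lemma hasum_tannery (I : choiceType) (F : nat -> I -> R) (f g : I -> R)
    (L : nat -> R) (G : R) :
  (forall n i, `|F n i| <= g i) -> hasum g G ->
  (forall i, F n i @[n --> \oo] --> f i) -> (forall n, hasum (F n) (L n)) ->
  exists2 l, hasum f l & L n @[n --> \oo] --> l.
Proof.
move=> Fg gG Ff FL.
have fg i : `|f i| <= g i.
  rewrite ler_norml; apply/andP; split.
    apply: (cvgr_to_ge (Ff i)); apply: nearW => n.
    by have := Fg n i; rewrite ler_norml => /andP[].
  apply: (cvgr_to_le (Ff i)); apply: nearW => n.
  by have := Fg n i; rewrite ler_norml => /andP[].
have [l fl] := hasum_dominated fg gG; exists l => //.
apply/cvgrPdist_lt => e e0.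
have [A hA] := gG (e / 3) ltac:(lra).
have := hA A (fsubset_refl _); rewrite ltr_norml => /andP[h1 h2].
have sF : \sum_(i <- A) F n i @[n --> \oo] --> \sum_(i <- A) f i.
  rewrite -[enum_fset A]/(A : seq I); elim: (A : seq I) => [|i s IH].
    under eq_cvg do rewrite big_nil; rewrite big_nil; exact: cvg_cst.
  under eq_cvg do rewrite big_cons; rewrite big_cons; exact: cvgD (Ff i) IH.
near=> n.
have : `|\sum_(i <- A) f i - \sum_(i <- A) F n i| < e / 3.
  near: n; apply: (cvgrPdist_lt _ _).1 sF _ _; lra.
have := hasum_tail A fg fl gG; have := hasum_tail A (Fg n) (FL n) gG.
rewrite !ltr_norml !ler_norml => /andP[? ?] /andP[? ?] /andP[? ?].
by apply/andP; split; lra.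
Unshelve. all: by end_near. Qed.

Lemma hasum_geo_nat (q : R) : 0 <= q -> q < 1 -> hasum (fun n : nat => q ^+ n) (1 - q)^-1.
Proof.
move=> q0 q1; have [||l ql _] := @hasum_bounded _ (fun n : nat => q ^+ n) (1 - q)^-1.
- by move=> n; exact: exprn_ge0.
- move=> A; pose m := (\max_(i <- A) i).+1.
  apply: le_trans (_ : \sum_(i <- [fset i in iota 0 m]%fset) q ^+ i <= _).
    apply: ler_sum_fsubset => [|n]; last exact: exprn_ge0.
    apply/fsubsetP => i iA; rewrite !inE mem_iota /=.
    by have := @leq_bigmax_seq _ (enum_fset A) xpredT id i iA isT; rewrite add1n ltnS; case: (i : nat).
  rewrite (perm_big (iota 0 m)); last first.
    by apply: uniq_perm; [exact: fset_uniq|exact: iota_uniq|move=> i; rewrite !inE].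
  rewrite -[X in iota _ X]subn0 -/(index_iota 0 m) big_mkord.
  have q1' : 0 < 1 - q by lra.
  rewrite -div1r ler_pdivlMr// mulrC.
  have := subrX1 q m; have := exprn_ge0 m q0; lra.
(* The value is identified through the shift identity l = 1 + q l. *)
suff -> : (1 - q)^-1 = l by [].
have h1 : hasum (fun n : nat => if n is k.+1 then q ^+ n else 0) (q * l).
  apply: (@hasum_inj _ _ S) => [a b [] //|[//|j] /(_ j) //|].
  by apply: eq_hasum (hasumZ q ql) => n /=; rewrite exprS.
have h0 : hasum (fun n : nat => if n \in [fset 0%N]%fset then 1 else 0 : R) 1.
  by have := hasum_fin (fun=> 1 : R) [fset 0%N]%fset; rewrite big_seq_fset1.
have := hasumD h0 h1 => h2.
have : l = 1 + q * l.
  apply: hasum_unique ql _; apply: eq_hasum h2 => -[|n]; rewrite inE /= ?addr0//.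
  by rewrite add0r.
move=> hl; apply: (mulIf (_ : 1 - q != 0)); first by apply: lt0r_neq0; lra.
by rewrite mulVf; [lra|apply: lt0r_neq0; lra].
Qed.

Lemma hasum_int (f : int -> R) (a b : R) :
  hasum (fun n : nat => f n) a -> hasum (fun n : nat => f (Negz n)) b ->
  hasum f (a + b).
Proof.
move=> fa fb.
have h1 : hasum (fun k : int => if k is Posz n then f k else 0) a.
  by apply: (@hasum_inj _ _ Posz) => // [x y [] //|[n /(_ n)//|//]].
have h2 : hasum (fun k : int => if k is Negz n then f k else 0) b.
  by apply: (@hasum_inj _ _ Negz) => // [x y [] //|[//|n /(_ n)//]].
by apply: eq_hasum (hasumD h1 h2) => -[n|n]; rewrite ?addr0 ?add0r.
Qed.

Lemma hasum_geo_int (q : R) : 0 <= q -> q < 1 ->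
  hasum (fun k : int => q ^+ `|k|%N) ((1 + q) / (1 - q)).
Proof.
move=> q0 q1; have h := hasum_geo_nat q0 q1.
(* [Negz n] stands for - (n + 1), hence the additional factor q of the negative half. *)
rewrite (_ : _ / _ = (1 - q)^-1 + q * (1 - q)^-1); last by rewrite -{2}[_^-1]mul1r -mulrDl.
apply: hasum_int => //.
by apply: eq_hasum (hasumZ q h) => n /=; rewrite exprS.
Qed.

Lemma hasum_geo_int2 (q : R) : 0 <= q -> q < 1 ->
  hasum (fun p : int * int => q ^+ (`|p.1| + `|p.2|)%N) (((1 + q) / (1 - q)) ^+ 2).
Proof.
move=> q0 q1; have h := hasum_geo_int q0 q1.
apply: eq_hasum (hasumM _ _ h h) => [p|i|i]; first by rewrite exprD.
all: exact: exprn_ge0.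
Qed.

End Hasum.

(** * Taylor bounds and finite trigonometric sums *)

Section Calculus.
Variable R : realType.
Implicit Types x y t : R.

(** Mean value theorem. Each Taylor bound below follows from the preceding one, which bounds its
    derivative. *)
Lemma ge0_derive_itv (f f' : R -> R) (a : R) :
  (forall x, is_derive x 1 f (f' x)) -> 0 <= f 0 ->
  (forall x, 0 <= x -> x <= a -> 0 <= f' x) ->
  forall x, 0 <= x -> x <= a -> 0 <= f x.
Proof.
move=> fd f0 f'0 x; rewrite le_eqVlt => /orP[/eqP <- //|x0] xa.
have [|c] := @MVT _ f f' 0 x x0 (fun y _ => fd y).
  apply: derivable_within_continuous => y _; apply: ex_derive.
rewrite in_itv /= => /andP[c0 cx]; rewrite subr0 => e.
have : 0 <= f' c * x by apply: mulr_ge0; [apply: f'0; lra|lra].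
lra.
Qed.

Lemma ge0_derive (f f' : R -> R) :
  (forall x, is_derive x 1 f (f' x)) -> 0 <= f 0 ->
  (forall x, 0 <= x -> 0 <= f' x) -> forall x, 0 <= x -> 0 <= f x.
Proof.
by move=> fd f0 f'0 x x0; apply: (@ge0_derive_itv f f' x) => // y y0 _; apply: f'0.
Qed.

Lemma expRN_le2 x : 0 <= x -> expR (- x) <= 1 - x + x ^+ 2 / 2.
Proof.
move=> x0; rewrite -subr_ge0; move: x x0.
have hd (x : R) : is_derive x 1 (fun x => 1 - x + x ^+ 2 / 2 - (expR (- x))) ((fun x => - 1 + x + expR (- x)) x).
  by apply: is_derive_eq; rewrite /GRing.scale /=; lra.
apply: (ge0_derive hd) => [|x x0].
- rewrite oppr0 expR0; lra.
- have := expR_ge1Dx (- x); lra.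
Qed.

Lemma sin_le x : 0 <= x -> sin x <= x.
Proof.
move=> x0; rewrite -subr_ge0; move: x x0.
have hd (x : R) : is_derive x 1 (fun x => x - (sin x)) ((fun x => 1 - cos x) x).
  by apply: is_derive_eq; rewrite /GRing.scale /=; lra.
apply: (ge0_derive hd) => [|x x0].
- rewrite sin0; lra.
- have := cos_le1 x; lra.
Qed.

Lemma cos_ge2 x : 0 <= x -> 1 - x ^+ 2 / 2 <= cos x.
Proof.
move=> x0; rewrite -subr_ge0; move: x x0.
have hd (x : R) : is_derive x 1 (fun x => cos x - (1 - x ^+ 2 / 2)) ((fun x => x - sin x) x).
  by apply: is_derive_eq; rewrite /GRing.scale /=; lra.
apply: (ge0_derive hd) => [|x x0].
- rewrite cos0; lra.
- have := sin_le x0; lra.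
Qed.

Lemma sin_ge3 x : 0 <= x -> x - x ^+ 3 / 6 <= sin x.
Proof.
move=> x0; rewrite -subr_ge0; move: x x0.
have hd (x : R) : is_derive x 1 (fun x => sin x - (x - x ^+ 3 / 6)) ((fun x => cos x - (1 - x ^+ 2 / 2)) x).
  by apply: is_derive_eq; rewrite /GRing.scale /=; lra.
apply: (ge0_derive hd) => [|x x0].
- rewrite sin0; lra.
- have := cos_ge2 x0; lra.
Qed.

Lemma cos_le4 x : 0 <= x -> cos x <= 1 - x ^+ 2 / 2 + x ^+ 4 / 24.
Proof.
move=> x0; rewrite -subr_ge0; move: x x0.
have hd (x : R) : is_derive x 1 (fun x => 1 - x ^+ 2 / 2 + x ^+ 4 / 24 - (cos x)) ((fun x => sin x - (x - x ^+ 3 / 6)) x).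
  by apply: is_derive_eq; rewrite /GRing.scale /=; lra.
apply: (ge0_derive hd) => [|x x0].
- rewrite cos0; lra.
- have := sin_ge3 x0; lra.
Qed.

Lemma sin_le5 x : 0 <= x -> sin x <= x - x ^+ 3 / 6 + x ^+ 5 / 30 / 4.
Proof.
move=> x0; rewrite -subr_ge0; move: x x0.
have hd (x : R) : is_derive x 1 (fun x => x - x ^+ 3 / 6 + x ^+ 5 / 30 / 4 - (sin x)) ((fun x => 1 - x ^+ 2 / 2 + x ^+ 4 / 24 - cos x) x).
  by apply: is_derive_eq; rewrite /GRing.scale /=; lra.
apply: (ge0_derive hd) => [|x x0].
- rewrite sin0; lra.
- have := cos_le4 x0; lra.
Qed.

Lemma cos_ge6 x : 0 <= x -> 1 - x ^+ 2 / 2 + x ^+ 4 / 24 - x ^+ 6 / 6 / 30 / 4 <= cos x.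
Proof.
move=> x0; rewrite -subr_ge0; move: x x0.
have hd (x : R) : is_derive x 1 (fun x => cos x - (1 - x ^+ 2 / 2 + x ^+ 4 / 24 - x ^+ 6 / 6 / 30 / 4)) ((fun x => x - x ^+ 3 / 6 + x ^+ 5 / 30 / 4 - sin x) x).
  by apply: is_derive_eq; rewrite /GRing.scale /=; lra.
apply: (ge0_derive hd) => [|x x0].
- rewrite cos0; lra.
- have := sin_le5 x0; lra.
Qed.

(* Literals of an abstract ring are unary, so large ones are written here as products and quotients
   of smaller ones: 313 / 10 / 10 is 3.13. *)
Lemma pi_ge313 : 313 / 10 / 10 <= pi :> R.
Proof.
rewrite leNgt; apply/negP => pi3.
have p0 := pi_gt0 R; have c0 := @cos_pihalf R.
(* Were pi smaller, the Taylor lower bound of cos at pi / 2 would be positive, although the cosine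
   vanishes there. *)
have := @cos_ge6 (pi / 2) ltac:(lra); rewrite c0 leNgt => /negP; apply.
set u := (pi / 2) ^+ 2.
have u0 : 0 <= u by apply: sqr_ge0.
have u1 : u <= 7 * 7 * 5 / 10 / 10.
  rewrite /u; apply: le_trans (_ : (313 / 25 / 8) ^+ 2 <= _); last lra.
  by rewrite ler_sqr ?nnegrE; lra.
rewrite (_ : (pi / 2) ^+ 4 = u ^+ 2); last by rewrite -exprM.
rewrite (_ : (pi / 2) ^+ 6 = u ^+ 3); last by rewrite -exprM.
nra.
Qed.

Lemma expRN_ge3 x : 0 <= x -> 1 - x + x ^+ 2 / 2 - x ^+ 3 / 6 <= expR (- x).
Proof.
move=> x0; rewrite -subr_ge0; move: x x0.
have hd (x : R) : is_derive x 1 (fun x => expR (- x) - (1 - x + x ^+ 2 / 2 - x ^+ 3 / 6)) ((fun x => 1 - x + x ^+ 2 / 2 - expR (- x)) x).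
  by apply: is_derive_eq; rewrite /GRing.scale /=; lra.
apply: (ge0_derive hd) => [|x x0].
- rewrite oppr0 expR0; lra.
- have := expRN_le2 x0; lra.
Qed.

Lemma expR_ge2 x : 0 <= x -> 1 + x + x ^+ 2 / 2 <= expR x.
Proof.
move=> x0; rewrite -subr_ge0; move: x x0.
have hd (x : R) : is_derive x 1 (fun x => expR x - (1 + x + x ^+ 2 / 2)) ((fun x => expR x - (1 + x)) x).
  by apply: is_derive_eq; rewrite /GRing.scale /=; lra.
apply: (ge0_derive hd) => [|x x0].
- rewrite expR0; lra.
- have := expR_ge1Dx x; lra.
Qed.

Lemma expR_ge3' x : 0 <= x -> 1 + x + x ^+ 2 / 2 + x ^+ 3 / 6 <= expR x.
Proof.
move=> x0; rewrite -subr_ge0; move: x x0.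
have hd (x : R) : is_derive x 1 (fun x => expR x - (1 + x + x ^+ 2 / 2 + x ^+ 3 / 6)) ((fun x => expR x - (1 + x + x ^+ 2 / 2)) x).
  by apply: is_derive_eq; rewrite /GRing.scale /=; lra.
apply: (ge0_derive hd) => [|x x0].
- rewrite expR0; lra.
- have := expR_ge2 x0; lra.
Qed.

Lemma expR_ge3 x : 1 + x + x ^+ 2 / 2 + x ^+ 3 / 6 <= expR x.
Proof.
have [x0|x0] := leP 0 x; first exact: expR_ge3'.
have := @expRN_ge3 (- x) ltac:(lra); rewrite opprK; apply: le_trans.
by rewrite le_eqVlt; apply/orP; left; apply/eqP; field.
Qed.

(** x - x^3 / 6 >= x / 3 amounts to x^2 <= 4. The range contains [0, pi / 2], where all the sampled
    angles of Polya's identity lie. *)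
Lemma sin_ge_third x : 0 <= x -> x <= 2 -> x / 3 <= sin x.
Proof.
move=> x0 x2; have := sin_ge3 x0.
have : 0 <= x * (4 - x ^+ 2) by apply: mulr_ge0 => //; nra.
rewrite exprS; nra.
Qed.

Lemma sum_pascal (g : nat -> R) n :
  \sum_(i < n.+2) ('C(n.+1, i))%:R * g i =
  \sum_(i < n.+1) ('C(n, i))%:R * (g i + g i.+1).
Proof.
rewrite big_ord_recl /= bin0.
under eq_bigr => i _ do rewrite binS natrD mulrDl.
rewrite big_split /= addrA.
have -> : 1%:R * g 0%N + \sum_(i < n.+1) ('C(n, i.+1))%:R * g i.+1 =
          \sum_(i < n.+2) ('C(n, i))%:R * g i.
  by rewrite [RHS]big_ord_recl /= bin0; congr (_ + _); apply: eq_bigr.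
rewrite big_ord_recr /= bin_small// mul0r addr0 -big_split /=.
by apply: eq_bigr => i _; rewrite mulrDr.
Qed.

(** Real form of the binomial expansion of (exp (ix) + exp (-ix))^n; the extra factor cos y lets the
    induction close by the product formula. *)
Lemma cosX_expand n x y :
  cos x ^+ n * cos y =
  (2 ^+ n)^-1 * \sum_(i < n.+1) ('C(n, i))%:R * cos (y + (n%:R - 2 * i%:R) * x).
Proof.
elim: n y => [|n IH] y.
  by rewrite big_ord1 bin0 !expr0 invr1 !mul1r mulr0 subr0 mul0r addr0.
have dbl : cos x * cos y = 2^-1 * (cos (y + x) + cos (y - x)).
  by rewrite cosD cosB; lra.
rewrite exprSr -mulrA dbl mulrCA mulrDr !IH -mulrDr mulrA -invfM -exprS.
congr (_ * _); rewrite (sum_pascal (fun i => cos (y + (n.+1%:R - 2 * i%:R) * x))).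
rewrite -big_split /=; apply: eq_bigr => i _; rewrite mulrDr -!natr1.
by congr (_ * cos _ + _ * cos _); ring.
Qed.

Lemma sin_pi_int_neq0 (d : int) (N : nat) : (0 < N)%N -> ~~ (N %| `|d|)%N ->
  sin (pi * d%:~R / N%:R) != 0 :> R.
Proof.
move=> N0 Nd; have N0' : 0 < N%:R :> R by rewrite ltr0n.
have h (m : nat) : ~~ (N %| m)%N -> sin (pi * m%:R / N%:R) != 0 :> R.
  move=> Nm; rewrite {1}(divn_eq m N) natrD natrM.
  rewrite (_ : pi * _ / _ = pi * (m %% N)%:R / N%:R + (m %/ N)%:R * pi); last first.
    by field; rewrite lt0r_neq0.
  have : sin (pi * (m %% N)%:R / N%:R) != 0 :> R.
    apply/lt0r_neq0/sin_gt0_pi; have p0 := pi_gt0 R.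
    apply/andP; split.
      by rewrite divr_gt0// mulr_gt0// ltr0n lt0n.
    rewrite ltr_pdivrMr// ltr_pM2l// ltr_nat ltn_mod N0//.
  elim: (m %/ N)%N => [|k IH]; first by rewrite mul0r addr0.
  move=> /IH; rewrite -(@oppr_eq0 R) -sinDpi; congr (sin _ != 0); rewrite -natr1; ring.
case: d Nd => [m|m] /= Nd; first exact: h.
rewrite NegzE rmorphN /= mulrN mulNr sinN oppr_eq0; exact: h.
Qed.

Lemma cosD2piZ (y : R) (k : int) : cos (y + 2 * pi * k%:~R) = cos y.
Proof.
case: k => m.
  elim: m => [|m IH]; first by rewrite mulr0 addr0.
  rewrite -[RHS]IH -[RHS]cosD2pi; congr cos.
  rewrite -!pmulrn -natr1 mulr2n; ring.
rewrite NegzE; elim: m => [|m IH].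
  rewrite -[LHS]cosD2pi; congr cos; rewrite mulr2n mulrN1z; ring.
rewrite -[RHS]IH -[LHS]cosD2pi; congr cos.
rewrite !rmorphN /= -!pmulrn -(natr1 m.+1) mulr2n; ring.
Qed.

(** The filter by roots of unity in real form. If N does not divide d, multiplication by sin (pi d /
    N), which is not 0, makes the sum telescope. *)
Lemma sum_cos_arith (d : int) (N : nat) (x : R) : (0 < N)%N ->
  \sum_(i < N) cos (x + 2 * pi * d%:~R * i%:R / N%:R) =
  if (N %| `|d|)%N then N%:R * cos x else 0.
Proof.
move=> N0; have N0' : N%:R != 0 :> R by rewrite pnatr_eq0 -lt0n.
case: ifPn => [/dvdnP[k hk]|Nd].
  have [k' ->] : exists k' : int, d = k' * N%:Z.
    case: d hk => m /= hk; first by exists k%:Z; rewrite hk PoszM.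
    by exists (- k%:Z); rewrite NegzE hk PoszM mulNr.
  rewrite (eq_bigr (fun=> cos x)) => [|i _].
    by rewrite sumr_const card_ord mulr_natl.
  rewrite -[RHS](cosD2piZ x (k' * i%:Z)); congr cos; rewrite !intrM.
  by congr (_ + _); field.
have s0 := sin_pi_int_neq0 N0 Nd.
set b := pi * d%:~R / N%:R in s0 *.
apply: (mulfI s0); rewrite mulr0 mulr_sumr.
pose g i : R := 2^-1 * sin (x + (2 * i%:R - 1) * b).
rewrite (eq_bigr (fun i : 'I_N => g i.+1 - g i)) => [|i _].
  rewrite -(big_mkord xpredT (fun i => g i.+1 - g i)) telescope_sumr// /g.
  rewrite (_ : x + (2 * N%:R - 1) * b = (x + (2 * 0%:R - 1) * b) + 2 * pi * d%:~R); last first.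
    by rewrite /b; field.
  have sper (y : R) : sin (y + 2 * pi * d%:~R) = sin y.
    rewrite -!cosBpihalf -(cosD2piZ (y - pi / 2) d); congr cos; ring.
  by rewrite sper subrr.
rewrite /g (_ : x + 2 * pi * d%:~R * i%:R / N%:R = x + 2 * i%:R * b); last first.
  by rewrite /b; congr (_ + _); field.
rewrite (_ : x + (2 * i.+1%:R - 1) * b = (x + 2 * i%:R * b) + b); last by rewrite -natr1; ring.
rewrite (_ : x + (2 * i%:R - 1) * b = (x + 2 * i%:R * b) - b); last by ring.
rewrite sinD sinB; lra.
Qed.

End Calculus.

(** * Poisson summation *)

Section Polya.
Variable R : realType.
Implicit Types (x y w : R).

Lemma hasum_ord (n : nat) (f : 'I_n -> R) : hasum f (\sum_i f i).
Proof.
have := hasum_fin f [fset i in enum 'I_n]%fset.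
rewrite (perm_big (enum 'I_n)); last first.
  by apply: uniq_perm; [exact: fset_uniq|exact: enum_uniq|move=> i; rewrite !inE].
by rewrite big_enum /=; apply: eq_hasum => i; rewrite !inE mem_enum.
Qed.

Definition binz (n : nat) (a : int) : R := if a is Posz i then ('C(n, i))%:R else 0.

(** The filter keeps the binomial coefficients whose index is congruent to m + j modulo N. The shift
    w of the sampling points becomes a frequency on the other side; phi is carried along for the
    second summation in the plane. *)
Lemma polya_sum (m n : nat) (j : int) w phi : let N := n.*2.+1 in
  \sum_(i < N) cos (pi * (i%:R - n%:R + w) / N%:R) ^+ m.*2 *
     cos (2 * j%:~R * (pi * (i%:R - n%:R + w) / N%:R) - phi) =
  N%:R / 4 ^+ m * \sum_(a < m.*2.+1) ('C(m.*2, a))%:R *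
    (if (N %| `|(a%:Z - m%:Z - j)%R|)%N then
       cos (2 * pi * w * ((a%:Z - m%:Z - j)%:~R / N%:R) + phi) else 0).
Proof.
move=> N; have N0 : N%:R != 0 :> R by rewrite pnatr_eq0.
under eq_bigr => i _ do rewrite cosX_expand.
have e4 : (2 ^+ m.*2)^-1 = (4 ^+ m)^-1 :> R.
  by rewrite -muln2 mulnC exprM -natrX.
rewrite -mulr_sumr exchange_big /= e4 [N%:R / _]mulrC -[RHS]mulrA; congr (_ * _).
rewrite mulr_sumr; apply: eq_bigr => a _; rewrite -mulr_sumr mulrCA; congr (_ * _).
pose d : int := j + m%:Z - a%:Z.
have dN : a%:Z - m%:Z - j = - d by rewrite /d; ring.
rewrite dN abszN; transitivity (if (N %| `|d|)%N then N%:R * cos (2 * pi * d%:~R * (w - n%:R) / N%:R - phi) else 0).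
  rewrite -sum_cos_arith//; apply: eq_bigr => i _; congr cos.
  rewrite /d !(intrD, rmorphN) /= -!pmulrn (_ : m.*2%:R = 2 * m%:R :> R); last first.
    by rewrite -muln2 natrM mulrC.
  by field.
case: ifPn => [/dvdnP[k hk]|_]; last by rewrite mulr0.
congr (_ * _).
have [k' hk'] : exists k' : int, d = k' * N%:Z.
  case: d hk {dN} => p /= hk; first by exists k%:Z; rewrite hk PoszM.
  by exists (- k%:Z); rewrite NegzE hk PoszM mulNr.
rewrite -[RHS]cosN -[RHS](cosD2piZ _ (- (n%:Z * k'))); congr cos.
rewrite rmorphN /= hk' !intrM rmorphN /= intrM -!pmulrn; field.
exact: N0.
Qed.

(** The surviving indices m + j + k N are numbered by all integers k, [binz] being 0 outside the
    binomial range. *)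
Lemma hasum_polya (m n : nat) (j : int) w phi : let N := n.*2.+1 in
  hasum (fun k : int => binz m.*2 (m%:Z + j + k * N%:Z) * cos (2 * pi * w * k%:~R + phi))
   (4 ^+ m / N%:R * \sum_(i < N) cos (pi * (i%:R - n%:R + w) / N%:R) ^+ m.*2 *
     cos (2 * j%:~R * (pi * (i%:R - n%:R + w) / N%:R) - phi)).
Proof.
move=> N; have N0 : N%:R != 0 :> R by rewrite pnatr_eq0.
rewrite polya_sum -/N; set S := \sum_(a < _) _.
have -> : 4 ^+ m / N%:R * (N%:R / 4 ^+ m * S) = S.
  by field; rewrite N0 expf_neq0.
rewrite {}/S.
pose F (a : int) : R := binz m.*2 a * (if (N %| `|(a - m%:Z - j)%R|)%N then
       cos (2 * pi * w * ((a - m%:Z - j)%:~R / N%:R) + phi) else 0).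
have hF : hasum F (\sum_(a < m.*2.+1) F a).
  apply: (@hasum_inj _ _ _ (fun a : 'I_(m.*2.+1) => Posz a)).
  - by move=> a b [] /ord_inj.
  - move=> [a|a] ha; last by rewrite /F mul0r.
    rewrite /F /binz; case: (ltnP a m.*2.+1) => am; last by rewrite bin_small// mul0r.
    by have := ha (Ordinal am).
  - exact: (hasum_ord (fun a : 'I_(m.*2.+1) => F a)).
have inj : injective (fun k : int => m%:Z + j + k * N%:Z) by move=> k l /= /addrI; apply: mulIf.
have F0 a : (forall k : int, m%:Z + j + k * N%:Z <> a) -> F a = 0.
  move=> ha; rewrite /F; case: ifPn; last by rewrite mulr0.
  move=> /dvdnP[k hk]; exfalso.
  have [k' hk'] : exists k' : int, a - m%:Z - j = k' * N%:Z.
    case: (a - m%:Z - j) hk => p /= hk; first by exists k%:Z; rewrite hk PoszM.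
    by exists (- k%:Z); rewrite NegzE hk PoszM mulNr.
  by apply: (ha k'); rewrite -hk'; ring.
apply: eq_hasum (hasum_comp_inj inj F0 hF) => k /=.
rewrite /F (_ : m%:Z + j + k * N%:Z - m%:Z - j = k * N%:Z); last by ring.
by rewrite abszM dvdn_mull//= intrM -!pmulrn mulfK.
Qed.

End Polya.

(** * Gaussian bounds for binomial coefficients *)

Section Binomial.
Variable R : realType.

Definition cbin (m : nat) (r : int) : R := binz R m.*2 (m%:Z + r) / ('C(m.*2, m))%:R.

Lemma central_bin_gt0 (m : nat) : 0 < ('C(m.*2, m))%:R :> R.
Proof. by rewrite ltr0n bin_gt0 -addnn leq_addr. Qed.

Lemma binz_abs (m : nat) (r : int) : binz R m.*2 (m%:Z + r) = ('C(m.*2, m + `|r|))%:R.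
Proof.
case: r => p; first by [].
rewrite NegzE abszN absz_nat; case: (leqP p.+1 m) => pm.
  rewrite (_ : m%:Z - p.+1%:Z = (m - p.+1)%N%:Z); last by lia.
  rewrite /= -bin_sub; last by lia.
  by congr (('C(_, _))%:R); lia.
rewrite bin_small; last by lia.
by case E : (m%:Z - p.+1%:Z) => [q|q] //; lia.
Qed.

Lemma cbin_ge0 (m : nat) (r : int) : 0 <= cbin m r.
Proof. by rewrite /cbin binz_abs divr_ge0. Qed.

Lemma bin_step (m j : nat) :
  (m + j.+1)%:R * ('C(m.*2, m + j.+1))%:R = (m%:R - j%:R) * ('C(m.*2, m + j))%:R :> R.
Proof.
case: (leqP j m) => jm.
  have := mul_bin_left m.*2 (m + j) => /(congr1 (fun n : nat => n%:R : R)).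
  by rewrite !natrM -addnS (_ : (m.*2 - (m + j) = m - j)%N) ?natrB//; lia.
by rewrite !bin_small ?mulr0//; lia.
Qed.

(** The quotient of consecutive coefficients is 1 - (2j + 1)/(m + j + 1), at most exp (- (2j + 1)/(m
    + J)), and the first j odd numbers add up to j^2. The lower bound is analogous, with the
    quotient 1/(1 + (2j + 1)/(m - j)). *)
Lemma bin_upper (m J j : nat) : (j <= J)%N -> (J <= m)%N ->
  ('C(m.*2, m + j))%:R <= ('C(m.*2, m))%:R * expR (- (j%:R ^+ 2 / (m + J)%:R)) :> R.
Proof.
move=> + Jm; elim: j => [|j IH] jJ.
  by rewrite addn0 expr0n /= mul0r oppr0 expR0 mulr1.
have mJ0 : 0 < (m + J)%:R :> R by rewrite ltr0n; lia.
have mj0 : 0 < (m + j.+1)%:R :> R by rewrite ltr0n; lia.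
have step := bin_step m j.
have {step} -> : ('C(m.*2, m + j.+1))%:R =
    (1 - (2 * j%:R + 1) / (m + j.+1)%:R) * ('C(m.*2, m + j))%:R :> R.
  apply: (mulfI (lt0r_neq0 mj0)); rewrite step mulrA; congr (_ * _).
  by rewrite natrD -natr1 in mj0 *; field; rewrite lt0r_neq0.
have -> : - (j.+1%:R ^+ 2 / (m + J)%:R) =
    - ((2 * j%:R + 1) / (m + J)%:R) - (j%:R ^+ 2 / (m + J)%:R) :> R.
  by rewrite -natr1; field; rewrite -natrD lt0r_neq0.
rewrite expRD mulrCA; apply: ler_pM => //; last by apply: IH; lia.
  rewrite subr_ge0 ler_pdivrMr// mul1r -natrM natr1 ler_nat; lia.
apply: le_trans (expR_ge1Dx _); rewrite lerD2l lerN2.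
apply: ler_wpM2l; first by rewrite -natrM natr1.
by rewrite lef_pV2 ?posrE// ler_nat; lia.
Qed.

Lemma bin_lower (m J j : nat) : (j <= J)%N -> (J < m)%N ->
  ('C(m.*2, m))%:R * expR (- (j%:R ^+ 2 / (m - J)%:R)) <= ('C(m.*2, m + j))%:R :> R.
Proof.
move=> + Jm; elim: j => [|j IH] jJ.
  by rewrite addn0 expr0n /= mul0r oppr0 expR0 mulr1.
have mJ0 : 0 < (m - J)%:R :> R by rewrite ltr0n; lia.
have mj0 : 0 < (m + j.+1)%:R :> R by rewrite ltr0n; lia.
have mj1 : 0 < (m - j)%:R :> R by rewrite ltr0n; lia.
have step := bin_step m j.
have {step} -> : ('C(m.*2, m + j.+1))%:R =
    (1 + (2 * j%:R + 1) / (m - j)%:R)^-1 * ('C(m.*2, m + j))%:R :> R.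
  apply: (mulfI (lt0r_neq0 mj0)); rewrite step mulrA; congr (_ * _).
  rewrite natrB in mj1 *; last by lia.
  rewrite natrD -natr1 in mj0 *; field.
  have j0 : 0 <= j%:R :> R by [].
  by do ?(apply/andP; split); apply/lt0r_neq0; lra.
have -> : - (j.+1%:R ^+ 2 / (m - J)%:R) =
    - ((2 * j%:R + 1) / (m - J)%:R) - (j%:R ^+ 2 / (m - J)%:R) :> R.
  rewrite -natr1; move: mJ0; rewrite natrB; last by lia.
  by move=> mJ0; field; rewrite lt0r_neq0.
have d0 : 0 <= (2 * j%:R + 1) / (m - j)%:R :> R by rewrite -natrM natr1 divr_ge0.
rewrite expRD mulrCA; apply: ler_pM; [exact: expR_ge0| | |by apply: IH; lia].
  by rewrite mulr_ge0 ?expR_ge0.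
have p0 : 0 < 1 + (2 * j%:R + 1) / (m - j)%:R :> R by apply: lt_le_trans (_ : 1 <= _); rewrite ?lerDl.
rewrite expRN lef_pV2 ?posrE ?expR_gt0//.
apply: le_trans (expR_ge1Dx _) _; rewrite ler_expR.
apply: ler_wpM2l; first by rewrite -natrM natr1.
by rewrite lef_pV2 ?posrE// ler_nat; lia.
Qed.

Lemma cbin_le (m : nat) (r : int) :
  cbin m r <= expR (- (`|r%:~R| ^+ 2 / (m%:R + `|r%:~R|))).
Proof.
rewrite /cbin binz_abs; have C0 := central_bin_gt0 m.
case: (leqP `|r| m) => rm; last by rewrite bin_small ?mul0r ?expR_ge0//; lia.
rewrite ler_pdivrMr// mulrC -intr_norm -abszE -pmulrn -natrD.
exact: bin_upper.
Qed.

Lemma cbin_ge (m : nat) (r : int) : `|r%:~R| < m%:R :> R ->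
  expR (- (`|r%:~R| ^+ 2 / (m%:R - `|r%:~R|))) <= cbin m r.
Proof.
rewrite /cbin binz_abs; have C0 := central_bin_gt0 m.
rewrite ler_pdivlMr// mulrC -intr_norm -abszE -pmulrn ltr_nat => rm.
by rewrite -natrB ?(ltnW rm)//; exact: bin_lower.
Qed.

(** Wallis's sequence, with classical limit pi; below the limit is carried as an abstract positive
    constant [U]. *)
Definition central_ratio (m : nat) : R := (4 ^+ m / ('C(m.*2, m))%:R) ^+ 2 / m%:R.

Lemma central_binS (m : nat) :
  m.+1%:R * ('C(m.+1.*2, m.+1))%:R = 2 * (2 * m%:R + 1) * ('C(m.*2, m))%:R :> R.
Proof.
have e1 : (m.+1 * 'C(m.+1.*2, m.+1) = m.+1.*2 * 'C(m.*2.+1, m))%N.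
  by rewrite doubleS -mul_bin_diag.
have e2 : (m.+1 * 'C(m.*2.+1, m) = m.*2.+1 * 'C(m.*2, m))%N.
  have -> : 'C(m.*2.+1, m) = 'C(m.*2.+1, m.+1).
    by rewrite -bin_sub; [congr 'C(_, _); lia|lia].
  by rewrite -mul_bin_diag.
have : (m.+1 * 'C(m.+1.*2, m.+1) = 2 * (2 * m + 1) * 'C(m.*2, m))%N.
  by rewrite e1; move: e2; rewrite -!muln2; nia.
by move=> /(congr1 (fun n : nat => n%:R : R)); rewrite !natrM natrD natrM.
Qed.

(** From index 1 on the sequence decreases, and it is bounded below because [u m] times (m + 1)/(m +
    2) increases from its initial value 2. *)
Lemma central_ratio_cvg : exists2 U : R, 0 < U & central_ratio m @[m --> \oo] --> U.
Proof.
pose u m := central_ratio m.+1.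
have uS m : u m.+1 * ((2 * m%:R + 3) ^+ 2 * (m%:R + 2)) = u m * (4 * (m%:R + 2) ^+ 2 * (m%:R + 1)).
  have C1 := lt0r_neq0 (central_bin_gt0 m.+1).
  have := central_binS m.+1; rewrite /u /central_ratio -(natr1 m.+1) -(natr1 m).
  have C2 := lt0r_neq0 (central_bin_gt0 m.+2).
  set A := ('C(m.+1.*2, m.+1))%:R in C1 *; set B := ('C(m.+2.*2, m.+2))%:R in C2 *.
  move=> h; have m0 : 0 <= m%:R :> R by [].
  have -> : A = (m%:R + 1 + 1) * B / (2 * (2 * (m%:R + 1) + 1)).
    by rewrite h; field; rewrite lt0r_neq0//; lra.
  rewrite [4 ^+ m.+2]exprS; set P := 4 ^+ m.+1; field.
  by rewrite C2 /=; do ?(apply/andP; split); apply/lt0r_neq0; lra.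
have u0 m : 0 < u m.
  by rewrite /u /central_ratio divr_gt0// exprn_gt0// divr_gt0 ?exprn_gt0// central_bin_gt0.
have um m : u m.+1 <= u m.
  have m0 : 0 <= m%:R :> R by [].
  have d0 : 0 < (2 * m%:R + 3) ^+ 2 * (m%:R + 2) :> R by nra.
  rewrite -(ler_pM2r d0) uS ler_pM2l//; nra.
have uU m : 2 <= u m * (1 - (m%:R + 2)^-1).
  have -> : 1 - (m%:R + 2)^-1 = (m%:R + 1) / (m%:R + 2) :> R.
    by field; rewrite lt0r_neq0//; have : 0 <= m%:R :> R by []; lra.
  elim: m => [|m IH].
    rewrite /u /central_ratio (_ : 'C(1.*2, 1) = 2)%N// expr1 mulr0n !add0r divr1. lra.
  have m0 : 0 <= m%:R :> R by [].
  apply: le_trans IH _; rewrite -(natr1 m).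
  have d0 : 0 < (2 * m%:R + 3) ^+ 2 * (m%:R + 2) * (m%:R + 3) :> R by nra.
  rewrite -(ler_pM2r d0).
  have -> : u m * ((m%:R + 1) / (m%:R + 2)) * ((2 * m%:R + 3) ^+ 2 * (m%:R + 2) * (m%:R + 3)) =
     u m * ((m%:R + 1) * (2 * m%:R + 3) ^+ 2 * (m%:R + 3)).
    by field; rewrite lt0r_neq0//; lra.
  have -> : u m.+1 * ((m%:R + 1 + 1) / (m%:R + 1 + 2)) * ((2 * m%:R + 3) ^+ 2 * (m%:R + 2) * (m%:R + 3)) =
     (u m.+1 * ((2 * m%:R + 3) ^+ 2 * (m%:R + 2))) * (m%:R + 2).
    by field; rewrite lt0r_neq0//; lra.
  by rewrite uS -[leRHS]mulrA ler_pM2l//; nra.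
have u2 m : 2 <= u m.
  have m0 : 0 <= m%:R :> R by [].
  have v0 : 0 <= (m%:R + 2)^-1 :> R by rewrite invr_ge0; lra.
  by have := uU m; have := mulr_ge0 (ltW (u0 m)) v0; lra.
have cu : cvgn u.
  apply: nonincreasing_is_cvgn; first exact/nonincreasing_seqP.
  by exists 2 => _ [m _ <-].
exists (limn u); first by apply: (@lt_le_trans _ _ 2) => //; apply: limr_ge => //; exact: nearW.
by rewrite -(@cvg_shiftS).
Qed.

End Binomial.

(** * Passage to the limit in Polya's identity *)

Section PoissonLimit.
Variable R : realType.
Implicit Types (x y w b : R).

(** From t^2 >= t - 1/4 with t = |k + y| >= |k| - X: a geometric majorant, uniform in y. *)
Lemma gauss_majorant b y X (k : int) : 0 < b -> `|y| <= X ->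
  expR (- (b * (k%:~R + y) ^+ 2)) <= expR (b * (X + 1 / 4)) * expR (- b) ^+ `|k|.
Proof.
move=> b0 yX; rewrite -expRM_natl -expRD ler_expR.
have -> : `|k|%:R = `|k%:~R| :> R by rewrite -intr_norm -abszE -pmulrn.
have h : `|k%:~R| - X <= `|k%:~R + y| :> R.
  have := ler_normB (k%:~R + y) y; rewrite addrK; lra.
have : `|k%:~R + y| ^+ 2 = (k%:~R + y) ^+ 2 by rewrite real_normK ?num_real.
set t := `|k%:~R + y| in h * => <-.
have : 0 <= (t - 1 / 2) ^+ 2 by apply: sqr_ge0.
move=> sq; have h2 : `|k%:~R| - X - 1 / 4 <= t ^+ 2 by nra.
by have := ler_wpM2l (ltW b0) h2; lra.
Qed.

Lemma hasum_gauss_majorant b X : 0 < b ->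
  hasum (fun k : int => expR (b * (X + 1 / 4)) * expR (- b) ^+ `|k|)
    (expR (b * (X + 1 / 4)) * ((1 + expR (- b)) / (1 - expR (- b)))).
Proof.
move=> b0; apply: hasumZ; apply: hasum_geo_int; first exact: expR_ge0.
by rewrite expR_lt1; lra.
Qed.

Lemma cos2_le_exp (t : R) : 0 <= t -> t <= 2 -> cos t ^+ 2 <= expR (- (t * (1 - t ^+ 2 / 6)) ^+ 2).
Proof.
move=> t0 t2; rewrite cos2sin2; apply: le_trans (expR_ge1Dx _); rewrite lerD2l lerN2.
have h := sin_ge3 t0; have h2 := sin_ge_third t0 t2.
rewrite ler_sqr ?nnegrE; last 2 first.
- by apply: mulr_ge0 => //; nra.
- by apply: le_trans h2; rewrite divr_ge0.
by apply: le_trans h; rewrite exprS; lra.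
Qed.

Lemma cos_ge_exp (t : R) : 0 <= t -> t <= 1 -> expR (- (t ^+ 2 / 2 / (1 - t ^+ 2 / 2))) <= cos t.
Proof.
move=> t0 t1; apply: le_trans (cos_ge2 t0).
have d0 : 0 < 1 - t ^+ 2 / 2 by nra.
rewrite expRN -[leRHS]invrK lef_pV2 ?posrE ?invr_gt0 ?expR_gt0//.
apply: le_trans (expR_ge1Dx _); rewrite le_eqVlt; apply/orP; left; apply/eqP.
by field; do ?(apply/andP; split); apply/lt0r_neq0; lra.
Qed.

Section Limits.
Variables (b x w phi : R) (b0 : 0 < b).

(** With m about N^2 / b and j about x N, the index r = j + k N has r^2 / m -> b (k + x)^2, which
    produces the direct Gaussian, while m (pi (nu + w) / N)^2 -> pi^2 / b (nu + w)^2 produces the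
    dual one. *)
Let N (n : nat) : nat := n.*2.+1.
Let m (n : nat) : nat := Num.trunc ((N n)%:R ^+ 2 / b).
Let j (n : nat) : int := Num.floor (x * (N n)%:R).

Let N0 n : 0 < (N n)%:R :> R. Proof. by []. Qed.
Let Nn0 n : (N n)%:R != 0 :> R. Proof. exact/lt0r_neq0/N0. Qed.
Let NV0 n : 0 < (N n)%:R^-1 :> R. Proof. by rewrite invr_gt0. Qed.
Let NV1 n : (N n)%:R^-1 <= 1 :> R. Proof. by rewrite invf_le1 ?ler1n. Qed.

Let m_itv n : (m n)%:R <= (N n)%:R ^+ 2 / b :> R /\ (N n)%:R ^+ 2 / b < (m n)%:R + 1.
Proof.
have : 0 <= (N n)%:R ^+ 2 / b by rewrite divr_ge0 ?exprn_ge0// ltW.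
by move=> /truncn_itv/andP[h1 h2]; rewrite natr1.
Qed.

Let j_itv n : (j n)%:~R <= x * (N n)%:R /\ x * (N n)%:R < (j n)%:~R + 1.
Proof.
by have /andP[h1 h2] := floor_itv (x * (N n)%:R); split => //; move: h2; rewrite intrD.
Qed.

Let cvgNV : (N n)%:R^-1 @[n --> \oo] --> (0 : R).
Proof.
apply: (@squeeze_cvgr _ _ _ _ (fun=> 0) (fun n => harmonic n)).
- apply: nearW => n; rewrite ltW//= lef_pV2 ?posrE// ler_nat /N; lia.
- exact: cvg_cst.
- exact: cvg_harmonic.
Qed.

Let cvgm : (m n)%:R / (N n)%:R ^+ 2 @[n --> \oo] --> b^-1.
Proof.
apply: (@squeeze_cvgr _ _ _ _ (fun n => b^-1 - (N n)%:R^-1) (fun=> b^-1)).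
- apply: nearW => n; have [h1 h2] := m_itv n.
  have p0 : 0 < (N n)%:R ^+ 2 :> R by rewrite exprn_gt0.
  rewrite ler_pdivlMr// ler_pdivrMr// mulrBl; apply/andP; split; last by rewrite mulrC.
  have : (N n)%:R^-1 * (N n)%:R ^+ 2 = (N n)%:R :> R by rewrite expr2 mulKf.
  have : 1 <= (N n)%:R :> R by rewrite ler1n.
  by move=> ? ->; rewrite mulrC; lra.
- rewrite -[X in _ --> X]subr0; apply: cvgB => //; exact: cvg_cst.
- exact: cvg_cst.
Qed.

Let j_bound n : `|(j n)%:~R / (N n)%:R - x| <= (N n)%:R^-1.
Proof.
have [h1 h2] := j_itv n.
rewrite ler_norml; apply/andP; split.
  rewrite lerBrDr addrC -(ler_pM2r (N0 n)) mulrBl mulVf// divfK//; lra.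
rewrite lerBlDr -(ler_pM2r (N0 n)) divfK// mulrDl mulVf//; lra.
Qed.

Let cvgj : (j n)%:~R / (N n)%:R @[n --> \oo] --> x.
Proof.
apply: (@squeeze_cvgr _ _ _ _ (fun n => x - (N n)%:R^-1) (fun n => x + (N n)%:R^-1)).
- by apply: nearW => n; have := j_bound n; rewrite ler_norml => /andP[h1 h2]; apply/andP; split; lra.
- rewrite -[X in _ --> X]subr0; apply: cvgB => //; exact: cvg_cst.
- rewrite -[X in _ --> X]addr0; apply: cvgD => //; exact: cvg_cst.
Qed.

Let r n (k : int) : int := j n + k * (N n)%:Z.
Let v n (k : int) : R := `|(j n)%:~R / (N n)%:R + k%:~R|.

Let rE n k : `|(r n k)%:~R| = v n k * (N n)%:R :> R.
Proof.
have -> : (r n k)%:~R = ((j n)%:~R / (N n)%:R + k%:~R) * (N n)%:R :> R.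
  by rewrite /r mulrDl divfK// intrD intrM -!pmulrn.
by rewrite normrM (ger0_norm (ltW (N0 n))).
Qed.

Let cvgv k : v n k @[n --> \oo] --> `|x + k%:~R|.
Proof. apply: cvg_norm; apply: cvgD => //; exact: cvg_cst. Qed.

Let frac (p q : R) n : (p * (N n)%:R) ^+ 2 / (q * (N n)%:R ^+ 2) = p ^+ 2 / q.
Proof. by rewrite exprMn -mulf_div divff ?mulr1// expf_neq0. Qed.

Let cvg_up k : expR (- (`|(r n k)%:~R| ^+ 2 / ((m n)%:R + `|(r n k)%:~R|)))
   @[n --> \oo] --> expR (- (b * (k%:~R + x) ^+ 2)).
Proof.
have E n : `|(r n k)%:~R| ^+ 2 / ((m n)%:R + `|(r n k)%:~R|) =
   v n k ^+ 2 / ((m n)%:R / (N n)%:R ^+ 2 + v n k * (N n)%:R^-1).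
  rewrite rE -(frac _ _ n) mulrDl divfK ?expf_neq0// -mulrA (_ : (N n)%:R^-1 * _ = (N n)%:R)//.
  by rewrite expr2 mulKf.
under eq_cvg do rewrite E.
apply: (@cvg_comp _ _ _ _ expR _ (nbhs (- (b * (k%:~R + x) ^+ 2)))); last exact: continuous_expR.
apply: cvgN; rewrite (_ : b * _ = `|x + k%:~R| ^+ 2 / (b^-1 + `|x + k%:~R| * 0)); last first.
  by rewrite mulr0 addr0 invrK mulrC real_normK ?num_real// addrC.
apply: cvgM; first by rewrite !expr2; apply: cvgM.
apply: cvgV; first by rewrite mulr0 addr0 invr_neq0// lt0r_neq0.
by apply: cvgD => //; apply: cvgM.
Qed.

Let cvg_low k : expR (- (`|(r n k)%:~R| ^+ 2 / ((m n)%:R - `|(r n k)%:~R|)))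
   @[n --> \oo] --> expR (- (b * (k%:~R + x) ^+ 2)).
Proof.
have E n : `|(r n k)%:~R| ^+ 2 / ((m n)%:R - `|(r n k)%:~R|) =
   v n k ^+ 2 / ((m n)%:R / (N n)%:R ^+ 2 - v n k * (N n)%:R^-1).
  rewrite rE -(frac _ _ n) mulrBl divfK ?expf_neq0// -[_ * _^-1 * _]mulrA (_ : (N n)%:R^-1 * _ = (N n)%:R)//.
  by rewrite expr2 mulKf.
under eq_cvg do rewrite E.
apply: (@cvg_comp _ _ _ _ expR _ (nbhs (- (b * (k%:~R + x) ^+ 2)))); last exact: continuous_expR.
apply: cvgN; rewrite (_ : b * _ = `|x + k%:~R| ^+ 2 / (b^-1 - `|x + k%:~R| * 0)); last first.
  by rewrite mulr0 subr0 invrK mulrC real_normK ?num_real// addrC.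
apply: cvgM; first by rewrite !expr2; apply: cvgM.
apply: cvgV; first by rewrite mulr0 subr0 invr_neq0// lt0r_neq0.
by apply: cvgB => //; apply: cvgM.
Qed.

Let cvg_r0 k : \forall n \near \oo, `|(r n k)%:~R| < (m n)%:R :> R.
Proof.
have h : (m n)%:R / (N n)%:R ^+ 2 - v n k * (N n)%:R^-1 @[n --> \oo] --> b^-1 - `|x + k%:~R| * 0.
  by apply: cvgB => //; apply: cvgM.
have h0 : 0 < b^-1 - `|x + k%:~R| * 0 by rewrite mulr0 subr0 invr_gt0.
apply: filterS (cvgr_gt _ h _ h0) => n; rewrite rE subr_gt0.
have p0 : 0 < (N n)%:R ^+ 2 :> R by rewrite exprn_gt0.
by rewrite ltr_pdivlMr// -mulrA expr2 mulKf.
Qed.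

Let cvg_cbin k : cbin R (m n) (r n k) @[n --> \oo] --> expR (- (b * (k%:~R + x) ^+ 2)).
Proof.
apply: (@squeeze_cvgr _ _ _ _
  (fun n => expR (- (`|(r n k)%:~R| ^+ 2 / ((m n)%:R - `|(r n k)%:~R|))))
  (fun n => expR (- (`|(r n k)%:~R| ^+ 2 / ((m n)%:R + `|(r n k)%:~R|))))) => //.
by apply: filterS (cvg_r0 k) => n h; rewrite cbin_ge//= cbin_le.
Qed.

(** Half of the limiting exponent is given away: |r| <= m yields r^2 / (m + |r|) >= r^2 / (2m) >= (b
    / 2) v^2. *)
Let cbin_dom n k : cbin R (m n) (r n k) <=
  expR (b / 2 * (`|x| + 1 + 1 / 4)) * expR (- (b / 2)) ^+ `|k|.
Proof.
have b20 : 0 < b / 2 by rewrite divr_gt0.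
have jx : `|(j n)%:~R / (N n)%:R| <= `|x| + 1.
  have := ler_normD ((j n)%:~R / (N n)%:R - x) x; rewrite subrK => h1.
  by apply: le_trans h1 _; rewrite addrC lerD2l (le_trans (j_bound n)).
apply: le_trans (gauss_majorant k b20 jx).
case: (leqP `|r n k| (m n)) => rm; last first.
  rewrite /cbin binz_abs bin_small ?mul0r ?expR_ge0//; lia.
apply: le_trans (cbin_le _ _ _) _; rewrite ler_expR lerN2.
have rmR : `|(r n k)%:~R| <= (m n)%:R :> R.
  by rewrite -intr_norm -abszE -pmulrn ler_nat.
have e : (k%:~R + (j n)%:~R / (N n)%:R) ^+ 2 = v n k ^+ 2.
  by rewrite /v real_normK ?num_real// addrC.
(* For small n and large b, m may be 0; then r = 0 as well. *)
have [m0|m0] := posnP (m n).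
  have r0 : `|(r n k)%:~R| = 0 :> R.
    by apply/eqP; rewrite -normr_le0 normr_id; move: rmR; rewrite m0.
  have /eqP : v n k = 0.
    by apply: (mulIf (Nn0 n)); rewrite -rE r0 mul0r.
  by rewrite e => /eqP ->; rewrite r0 expr0n /= mulr0 mul0r.
have m0' : 0 < (m n)%:R :> R by rewrite ltr0n.
rewrite e ler_pdivlMr; last by rewrite ltr_pwDl.
have [m1 _] := m_itv n.
apply: le_trans (_ : b / 2 * v n k ^+ 2 * (2 * ((N n)%:R ^+ 2 / b)) <= _).
  have bv0 : 0 <= b / 2 * v n k ^+ 2 := mulr_ge0 (ltW b20) (sqr_ge0 _).
  by apply: ler_wpM2l => //; rewrite mulrDl mul1r; apply: lerD => //; apply: le_trans m1.
rewrite rE exprMn le_eqVlt; apply/orP; left; apply/eqP; field.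
exact: lt0r_neq0.
Qed.

Let F n (k : int) : R := cbin R (m n) (r n k) * cos (2 * pi * w * k%:~R + phi).

(** The N sampling points are renumbered by nu = i - n and extended by 0, so that the index set
    [int] does not depend on n, as [hasum_tannery] requires. *)
Let G n (nu : int) : R := if (`|nu| <= n)%N then
  cos (pi * (nu%:~R + w) / (N n)%:R) ^+ (m n).*2 *
  cos (2 * (j n)%:~R * (pi * (nu%:~R + w) / (N n)%:R) - phi) else 0.

Let kappa n : R := 4 ^+ m n / ((N n)%:R * ('C((m n).*2, m n))%:R).

Let sG n := \sum_(i < N n) cos (pi * (i%:R - n%:R + w) / (N n)%:R) ^+ (m n).*2 *
     cos (2 * (j n)%:~R * (pi * (i%:R - n%:R + w) / (N n)%:R) - phi).

Let hasum_F n : hasum (F n) (kappa n * sG n).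
Proof.
have := hasumZ (('C((m n).*2, m n))%:R^-1) (@hasum_polya R (m n) n (j n) w phi).
have C0 := lt0r_neq0 (central_bin_gt0 R (m n)).
rewrite mulrA -/(N n) -/(sG n) (_ : _ * (_ / _) = kappa n); last first.
  by rewrite /kappa; field; rewrite C0 /=.
by apply: eq_hasum => k; rewrite /F /cbin /r !addrA; ring.
Qed.

Let hasum_G n : hasum (G n) (sG n).
Proof.
have supp (nu : int) : (forall i : 'I_(N n), i%:Z - n%:Z <> nu) -> G n nu = 0.
  move=> h; rewrite /G; case: ifP => // nun; exfalso.
  have lt : (absz (nu + n%:Z)%R < N n)%N by rewrite /N; lia.
  by apply: (h (Ordinal lt)) => /=; lia.
apply: (@hasum_inj _ _ _ (fun i : 'I_(N n) => i%:Z - n%:Z)) => //.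
- by move=> a c /addIr [] /ord_inj.
- have -> : (G n \o (fun i : 'I_(N n) => i%:Z - n%:Z)) = (fun i : 'I_(N n) =>
    cos (pi * (i%:R - n%:R + w) / (N n)%:R) ^+ (m n).*2 *
     cos (2 * (j n)%:~R * (pi * (i%:R - n%:R + w) / (N n)%:R) - phi)).
    apply/funext => i; rewrite /G /=.
    have -> : (`|(i%:Z - n%:Z)%R| <= n)%N by have := ltn_ord i; rewrite {2}/N; lia.
    by rewrite intrD rmorphN /= -!pmulrn.
  exact: hasum_ord.
Qed.

Let theta n nu : R := `|pi * (nu%:~R + w)| * (N n)%:R^-1.

Let cos_theta n nu : cos (pi * (nu%:~R + w) / (N n)%:R) = cos (theta n nu).
Proof.
rewrite /theta; case: (ger0P (pi * (nu%:~R + w))) => // _.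
by rewrite mulNr cosN.
Qed.

Let cvg_theta nu : theta n nu @[n --> \oo] --> (0 : R).
Proof. by rewrite -(mulr0 `|pi * (nu%:~R + w)|); apply: cvgM => //; exact: cvg_cst. Qed.

Let cvg_mtheta nu : (m n)%:R * theta n nu ^+ 2 @[n --> \oo] -->
  pi ^+ 2 / b * (nu%:~R + w) ^+ 2.
Proof.
have E n : (m n)%:R * theta n nu ^+ 2 = (m n)%:R / (N n)%:R ^+ 2 * (pi * (nu%:~R + w)) ^+ 2.
  rewrite /theta exprMn real_normK ?num_real//; field; exact: Nn0.
under eq_cvg do rewrite E.
rewrite (_ : pi ^+ 2 / b * _ = b^-1 * (pi * (nu%:~R + w)) ^+ 2); last by rewrite exprMn; ring.
by apply: cvgM => //; exact: cvg_cst.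
Qed.

Let cvg_cosX nu : cos (theta n nu) ^+ (m n).*2 @[n --> \oo] -->
  expR (- (pi ^+ 2 / b * (nu%:~R + w) ^+ 2)).
Proof.
set L := pi ^+ 2 / b * _.
have cexp (f : nat -> R) : f n @[n --> \oo] --> L -> expR (- f n) @[n --> \oo] --> expR (- L).
  move=> fL; apply: (@cvg_comp _ _ _ _ expR _ (nbhs (- L))); last exact: continuous_expR.
  exact: cvgN.
have t2 : theta n nu ^+ 2 @[n --> \oo] --> (0 : R).
  by rewrite -(mulr0 0) ; under eq_cvg do rewrite expr2; apply: cvgM.
apply: (@squeeze_cvgr _ _ _ _
  (fun n => expR (- ((m n)%:R * theta n nu ^+ 2 * (1 - theta n nu ^+ 2 * 2^-1)^-1)))
  (fun n => expR (- ((m n)%:R * theta n nu ^+ 2 * (1 - theta n nu ^+ 2 * 6^-1) ^+ 2)))).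
- near=> n.
  have t0 : 0 <= theta n nu by rewrite /theta mulr_ge0.
  have t1 : theta n nu <= 1.
    by near: n; apply: cvgr_le (cvg_theta nu) _ _; lra.
  apply/andP; split.
    rewrite -mul2n.
    have -> : - ((m n)%:R * theta n nu ^+ 2 / (1 - theta n nu ^+ 2 / 2)) =
       (2 * m n)%:R * - (theta n nu ^+ 2 / 2 / (1 - theta n nu ^+ 2 / 2)).
      by rewrite natrM; field; apply/lt0r_neq0; nra.
    have h := cos_ge_exp t0 t1.
    rewrite expRM_natl; apply: lerXn2r => //; rewrite nnegrE; first exact: expR_ge0.
    exact: le_trans (expR_ge0 _) h.
  rewrite -mul2n exprM.
  have -> : - ((m n)%:R * theta n nu ^+ 2 * (1 - theta n nu ^+ 2 / 6) ^+ 2) =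
       (m n)%:R * - (theta n nu * (1 - theta n nu ^+ 2 / 6)) ^+ 2.
    by set T := theta n nu; set M := (m n)%:R; ring.
  rewrite expRM_natl; apply: lerXn2r; rewrite ?nnegrE ?expR_ge0 ?sqr_ge0//.
  by apply: cos2_le_exp => //; lra.
- apply: cexp; rewrite (_ : L = L * (1 - 0 * 2^-1)^-1); last by rewrite mul0r subr0 invr1 mulr1.
  apply: cvgM; first exact: cvg_mtheta.
  apply: cvgV; first by rewrite mul0r subr0 oner_neq0.
  apply: cvgB; first exact: cvg_cst.
  by apply: cvgM => //; exact: cvg_cst.
- apply: cexp; rewrite (_ : L = L * (1 - 0 * 6^-1) ^+ 2); last by rewrite mul0r subr0 expr1n mulr1.
  apply: cvgM; first exact: cvg_mtheta.
  under eq_cvg do rewrite expr2; rewrite expr2.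
  have h : 1 - theta n nu ^+ 2 * 6^-1 @[n --> \oo] --> (1 - 0 * 6^-1 : R).
    apply: cvgB; first exact: cvg_cst.
    by apply: cvgM => //; exact: cvg_cst.
  exact: cvgM.
Unshelve. all: by end_near. Qed.

Let cvg_G nu : G n nu @[n --> \oo] -->
  expR (- (pi ^+ 2 / b * (nu%:~R + w) ^+ 2)) * cos (2 * pi * (nu%:~R + w) * x - phi).
Proof.
have h : cos (theta n nu) ^+ (m n).*2 *
   cos (2 * pi * (nu%:~R + w) * ((j n)%:~R / (N n)%:R) - phi) @[n --> \oo] -->
  expR (- (pi ^+ 2 / b * (nu%:~R + w) ^+ 2)) * cos (2 * pi * (nu%:~R + w) * x - phi).
  apply: cvgM; first exact: cvg_cosX.
  apply: (@cvg_comp _ _ _ _ cos _ (nbhs (2 * pi * (nu%:~R + w) * x - phi))); last exact: continuous_cos.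
  apply: cvgB; last exact: cvg_cst.
  by apply: cvgM => //; exact: cvg_cst.
apply: cvg_trans h; apply: near_eq_cvg; near=> n.
rewrite /G ifT ?cos_theta; last by near: n; exists `|nu|%N.
by congr (_ * cos (_ - _)); field; exact: Nn0.
Unshelve. all: by end_near. Qed.

(** As |w| <= 1/2, all angles are at most pi / 2 < 2, where sin x >= x / 3. The exponent m exceeds
    N^2 / b - 1; the missing 1 costs a factor at most exp (4/9) <= exp (1/2). *)
Let G_dom (w12 : `|w| <= 1 / 2) n nu : `|G n nu| <=
  expR (1 / 2) * (expR (pi ^+ 2 / (9 * b) * (1 / 2 + 1 / 4)) * expR (- (pi ^+ 2 / (9 * b))) ^+ `|nu|).
Proof.
rewrite /G; case: ifP => nun; last by rewrite normr0 !mulr_ge0 ?expR_ge0 ?exprn_ge0 ?expR_ge0.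
rewrite normrM -[leRHS]mulr1; apply: ler_pM => //; last first.
  by rewrite ler_norml cos_geN1 cos_le1.
have p0 := pi_gt0 R.
have pb0 : 0 < pi ^+ 2 / (9 * b) by rewrite divr_gt0 ?exprn_gt0// mulr_gt0.
apply: le_trans (ler_wpM2l (expR_ge0 _) (gauss_majorant nu pb0 w12)).
rewrite cos_theta -mul2n exprM ger0_norm; last by apply: exprn_ge0; exact: sqr_ge0.
rewrite -expRD.
have t0 : 0 <= theta n nu by rewrite /theta mulr_ge0.
have t2 : theta n nu <= 2.
  rewrite /theta normrM (ger0_norm (ltW p0)) ler_pdivrMr//.
  have : `|nu%:~R + w| <= (N n)%:R / 2.
    apply: le_trans (ler_normD _ _) _; rewrite -intr_norm -abszE -pmulrn.
    have : (`|nu|)%:R <= n%:R :> R by rewrite ler_nat.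
    have NE : (N n)%:R = 2 * n%:R + 1 :> R by rewrite /N -addn1 natrD -muln2 natrM mulrC.
    rewrite NE; move: w12 => ?; lra.
  have := pihalf_lt2 R; have := N0 n; have := normr_ge0 (nu%:~R + w); nra.
have h2 := sin_ge_third t0 t2.
have hs : cos (theta n nu) ^+ 2 <= expR (- (theta n nu / 3) ^+ 2).
  rewrite cos2sin2; apply: le_trans (expR_ge1Dx _); rewrite lerD2l lerN2.
  by rewrite ler_sqr ?nnegrE ?divr_ge0//; apply: le_trans h2; rewrite divr_ge0.
apply: le_trans (_ : expR (- (theta n nu / 3) ^+ 2) ^+ m n <= _).
  by apply: lerXn2r; rewrite ?nnegrE ?expR_ge0 ?sqr_ge0.
rewrite -expRM_natl ler_expR.
have [_ m2] := m_itv n.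
have t4 : (theta n nu / 3) ^+ 2 <= 4 / 9 by rewrite expr_div_n; nra.
have -> : pi ^+ 2 / (9 * b) * (nu%:~R + w) ^+ 2 = (N n)%:R ^+ 2 / b * (theta n nu / 3) ^+ 2.
  rewrite /theta !exprMn real_normK ?num_real//; field.
  by rewrite Nn0 lt0r_neq0.
have := sqr_ge0 (theta n nu / 3); nra.
Qed.

Let cvg_kappa (U : R) : central_ratio R i @[i --> \oo] --> U -> kappa n @[n --> \oo] --> Num.sqrt (U / b).
Proof.
move=> hU.
have minf : m n @[n --> \oo] --> \oo.
  apply/cvgnyPge => A; near=> n.
  have [_ m2] := m_itv n.
  have : A%:R * b <= (N n)%:R.
    near: n; exists (Num.trunc (A%:R * b)) => // n /= nA.
    have ab0 : 0 <= A%:R * b by apply: mulr_ge0 => //; exact: ltW.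
    have /andP[_ h] := truncn_itv ab0.
    apply: ltW; apply: lt_le_trans h _; rewrite ler_nat /N; lia.
  rewrite -ler_pdivlMr// => h.
  have : A%:R < (m n)%:R + 1 :> R.
    apply: le_lt_trans m2; apply: le_trans h _; rewrite ler_pM2r ?invr_gt0//.
    by rewrite expr2 ler_peMr// ler1n.
  by rewrite natr1 ltr_nat ltnS.
have h : central_ratio R (m n) * ((m n)%:R / (N n)%:R ^+ 2) @[n --> \oo] --> U / b.
  by apply: cvgM => //; exact: (@cvg_comp _ _ _ m (central_ratio R) _ _ _ minf hU).
have h2 : Num.sqrt (central_ratio R (m n) * ((m n)%:R / (N n)%:R ^+ 2)) @[n --> \oo] --> Num.sqrt (U / b).
  by apply: (@cvg_comp _ _ _ _ Num.sqrt _ (nbhs (U / b)) _ h); exact: sqrt_continuous.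
apply: cvg_trans h2; apply: near_eq_cvg; near=> n.
have m0 : (0 < m n)%N by near: n; apply/(cvgnyPgt _).1.
have m0' : (m n)%:R != 0 :> R by rewrite pnatr_eq0 -lt0n.
have C0 := lt0r_neq0 (central_bin_gt0 R (m n)).
have -> : central_ratio R (m n) * ((m n)%:R / (N n)%:R ^+ 2) = kappa n ^+ 2.
  by rewrite /central_ratio /kappa; have := Nn0 n; set NN := (N n)%:R => nn; field; rewrite m0' C0 nn.
by rewrite sqrtr_sqr ger0_norm// /kappa divr_ge0 ?exprn_ge0 ?mulr_ge0.
Unshelve. all: by end_near. Qed.

Lemma poisson_half (U : R) : central_ratio R i @[i --> \oo] --> U -> `|w| <= 1 / 2 ->
  exists2 l, hasum (fun k : int => expR (- (b * (k%:~R + x) ^+ 2)) * cos (2 * pi * w * k%:~R + phi))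
    (Num.sqrt (U / b) * l) &
   hasum (fun nu : int => expR (- (pi ^+ 2 / b * (nu%:~R + w) ^+ 2)) *
      cos (2 * pi * (nu%:~R + w) * x - phi)) l.
Proof.
move=> hU w12; have p0 := pi_gt0 R.
have pb0 : 0 < pi ^+ 2 / (9 * b) by rewrite divr_gt0 ?exprn_gt0// mulr_gt0.
have b20 : 0 < b / 2 by rewrite divr_gt0.
have Fdom n k : `|F n k| <= expR (b / 2 * (`|x| + 1 + 1 / 4)) * expR (- (b / 2)) ^+ `|k|.
  rewrite /F normrM -[leRHS]mulr1; apply: ler_pM => //; last first.
    by rewrite ler_norml cos_geN1 cos_le1.
  by rewrite ger0_norm ?cbin_ge0.
have Fcvg k : F n k @[n --> \oo] --> expR (- (b * (k%:~R + x) ^+ 2)) * cos (2 * pi * w * k%:~R + phi).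
  by apply: cvgM => //; exact: cvg_cst.
have [l hl Fl] := hasum_tannery Fdom (hasum_gauss_majorant _ b20) Fcvg hasum_F.
have [l' hl' Gl'] := hasum_tannery (G_dom w12) (hasumZ _ (hasum_gauss_majorant _ pb0)) cvg_G hasum_G.
exists l' => //; suff -> : Num.sqrt (U / b) * l' = l by [].
apply: (@cvg_unique _ (@Rhausdorff R)) _ Fl.
by apply: cvgM => //; exact: cvg_kappa.
Qed.

End Limits.
End PoissonLimit.

(** * Poisson summation on the line and in the plane *)

Section Poisson.
Variable R : realType.
Implicit Types (x y w b c : R).

(** Shifting nu by an integer p with |w - p| <= 1/2 reduces to the domain of [poisson_half]. *)
Lemma poisson_line (U : R) : central_ratio R i @[i --> \oo] --> U ->
  forall b x w phi, 0 < b ->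
  exists2 l, hasum (fun k : int => expR (- (b * (k%:~R + x) ^+ 2)) * cos (2 * pi * w * k%:~R + phi))
    (Num.sqrt (U / b) * l) &
   hasum (fun nu : int => expR (- (pi ^+ 2 / b * (nu%:~R + w) ^+ 2)) *
      cos (2 * pi * (nu%:~R + w) * x - phi)) l.
Proof.
move=> hU b x w phi b0; pose p := Num.floor (w + 1 / 2); pose w0 := w - p%:~R.
have w12 : `|w0| <= 1 / 2.
  have /andP[] := floor_itv (w + 1 / 2); rewrite -/p intrD => h1 h2.
  by rewrite ler_norml /w0; apply/andP; split; lra.
have [l h1 h2] := @poisson_half R b x w0 phi b0 U hU w12; exists l.
  apply: eq_hasum h1 => k; congr (_ * _); rewrite -[RHS](cosD2piZ _ (- (p * k))).
  by congr cos; rewrite /w0 rmorphN /= intrM; ring.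
have := @hasum_bij R _ _ (fun nu : int => nu + p) (fun nu => nu - p) _ l (addrK p) (subrK p) h2.
by apply: eq_hasum => nu /=; rewrite /w0 intrD (_ : nu%:~R + p%:~R + (w - p%:~R) = nu%:~R + w)//; ring.
Qed.

(** Quadratic form of the superbase: its Gram matrix has diagonal (s1 + s3)/2, (s2 + s3)/2 and
    off-diagonal entry - s3 / 2, hence determinant 1 under [selling]. [quad_dual] belongs to the
    adjugate, which is then the inverse. *)
Definition quad (s : R * R * R) x y : R :=
  (s.1.1 * x ^+ 2 + s.1.2 * y ^+ 2 + s.2 * (x - y) ^+ 2) / 2.

Definition quad_dual (s : R * R * R) x y : R :=
  (s.1.2 * x ^+ 2 + s.1.1 * y ^+ 2 + s.2 * (x + y) ^+ 2) / 2.

Definition selling (s : R * R * R) : Prop :=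
  [/\ 0 <= s.1.1, 0 <= s.1.2, 0 <= s.2 & s.1.1 * s.1.2 + s.1.2 * s.2 + s.2 * s.1.1 = 4].

Section Plane.
Variables (U : R) (U0 : 0 < U) (hU : central_ratio R i @[i --> \oo] --> U).

(** The bound must be uniform in y, because in the plane the shift varies with the row. In the dual
    series every cosine is at most 1, its value at y = 0. *)
Lemma gauss_row b : 0 < b -> exists K, forall y, exists2 g,
  hasum (fun k : int => expR (- (b * (k%:~R + y) ^+ 2))) g & 0 <= g <= K.
Proof.
move=> b0; have pb0 : 0 < pi ^+ 2 / b by rewrite divr_gt0 ?exprn_gt0 ?pi_gt0.
have [l hl _] := poisson_line hU 0 0 0 pb0.
exists (Num.sqrt (U / b) * (Num.sqrt (U / (pi ^+ 2 / b)) * l)) => y.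
have [l2 h1 h2] := poisson_line hU y 0 0 b0.
exists (Num.sqrt (U / b) * l2).
  by apply: eq_hasum h1 => k; rewrite mulr0 mul0r addr0 cos0 mulr1.
have g0 : 0 <= Num.sqrt (U / b) * l2.
  have := @hasum_ge_partial _ _ _ _ fset0 _ h1; rewrite big_seq_fset0; apply.
  by move=> k; rewrite mulr0 mul0r addr0 cos0 mulr1 expR_ge0.
rewrite g0 /=; apply: ler_wpM2l; first exact: sqrtr_ge0.
apply: ler_hasum h2 hl => k; rewrite mulr0 mul0r !addr0 cos0 mulr1.
by rewrite ger_pMr ?expR_gt0// cos_le1.
Qed.

(** Completing the square gives the form A (k + xi l)^2 + (l + y)^2 / A. Transforming the sum over k
    leads to the mixed series [H] in (l, mu); its absolute summability allows the exchange of the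
    order, and the sum over l is transformed in turn. The factors sqrt (U / (c A)) and sqrt (U A /
    c) multiply to U / c. *)
Lemma poisson_plane (c : R) (s : R * R * R) x y : 0 < c -> selling s ->
  exists2 D, hasum (fun p : int * int => expR (- (c * quad s (p.1%:~R + x) (p.2%:~R + y)))) (U / c * D) &
    hasum (fun p : int * int => expR (- (pi ^+ 2 / c * quad_dual s p.1%:~R p.2%:~R)) *
      cos (2 * pi * (p.1%:~R * x + p.2%:~R * y))) D.
Proof.
case: s => [[s1 s2] s3] c0 [/= s10 s20 s30 e2]; rewrite /quad /quad_dual /=.
pose A := (s1 + s3) / 2; pose B := - s3 / 2; pose C := (s2 + s3) / 2.
have A0 : 0 < A by rewrite /A; nra.
have An := lt0r_neq0 A0; have cn := lt0r_neq0 c0.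
have det : A * C - B ^+ 2 = 1 by rewrite /A /B /C; lra.
have p20 : 0 < pi ^+ 2 :> R by rewrite exprn_gt0 ?pi_gt0.
have pn := lt0r_neq0 p20.
have b10 : 0 < c * A by rewrite mulr_gt0.
have b20 : 0 < c / A by rewrite divr_gt0.
pose xi (l : int) := x + B / A * (l%:~R + y).
pose H (q : int * int) : R := expR (- (c / A * (q.1%:~R + y) ^+ 2)) *
   (expR (- (pi ^+ 2 / (c * A) * q.2%:~R ^+ 2)) * cos (2 * pi * q.2%:~R * xi q.1)).
have [T hT] : exists T, hasum H T.
  have [K1 /(_ y) [g1 hg1 _]] := gauss_row b20.
  have pb : 0 < pi ^+ 2 / (c * A) by rewrite divr_gt0.
  have [K2 /(_ 0) [g2 hg2 _]] := gauss_row pb.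
  apply: hasum_dominated (hasumM _ _ hg1 hg2); try by move=> ?; rewrite expR_ge0.
  move=> [l mu] /=; rewrite /H /= !normrM !(ger0_norm (expR_ge0 _)) addr0.
  rewrite ler_pM2l ?expR_gt0// ger_pMr ?expR_gt0//.
  by rewrite ler_norml cos_geN1 cos_le1.
pose r (l : int) := sval (cid2 (poisson_line hU (xi l) 0 0 b10)).
have rP l : hasum (fun k : int => expR (- (c * A * (k%:~R + xi l) ^+ 2))) (Num.sqrt (U / (c * A)) * r l) /\
   hasum (fun nu : int => expR (- (pi ^+ 2 / (c * A) * nu%:~R ^+ 2)) * cos (2 * pi * nu%:~R * xi l)) (r l).
  rewrite /r; case: cid2 => v /= h1 h2; split.
    by apply: eq_hasum h1 => k; rewrite mulr0 mul0r addr0 cos0 mulr1.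
  by apply: eq_hasum h2 => k; rewrite addr0 subr0.
have rT : hasum (fun l : int => expR (- (c / A * (l%:~R + y) ^+ 2)) * r l) T.
  by apply: (hasum_fubini hT) => l; apply: eq_hasum (hasumZ _ (rP l).2).
have hE : hasum (fun q : int * int => expR (- (c / A * (q.1%:~R + y) ^+ 2)) *
    expR (- (c * A * (q.2%:~R + xi q.1) ^+ 2))) (Num.sqrt (U / (c * A)) * T).
  apply: (@hasum_tonelli _ _ _ _ (fun l : int => Num.sqrt (U / (c * A)) *
     (expR (- (c / A * (l%:~R + y) ^+ 2)) * r l))).
  - by move=> q; rewrite mulr_ge0 ?expR_ge0.
  - by move=> l; rewrite [X in hasum _ X]mulrCA; apply: eq_hasum (hasumZ (expR (- (c / A * (l%:~R + y) ^+ 2))) (rP l).1).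
  - exact: hasumZ.
(* The part of the phase that is independent of l; the part linear in l is the frequency mu B /
   A. *)
pose phi (mu : int) := 2 * pi * mu%:~R * (x + B / A * y).
pose d (mu : int) := sval (cid2 (poisson_line hU y (mu%:~R * B / A) (phi mu) b20)).
have dP mu : hasum (fun l : int => expR (- (c / A * (l%:~R + y) ^+ 2)) * cos (2 * pi * mu%:~R * xi l))
     (Num.sqrt (U / (c / A)) * d mu) /\
   hasum (fun n : int => expR (- (pi ^+ 2 / (c / A) * (n%:~R + mu%:~R * B / A) ^+ 2)) *
     cos (2 * pi * (n%:~R * y - mu%:~R * x))) (d mu).
  rewrite /d; case: cid2 => v /= h1 h2; split.
    apply: eq_hasum h1 => k; congr (_ * cos _); rewrite /phi /xi; field; exact: An.
  apply: eq_hasum h2 => k; congr (_ * cos _); rewrite /phi; field; exact: An.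
have dT : hasum (fun mu : int => expR (- (pi ^+ 2 / (c * A) * mu%:~R ^+ 2)) * (Num.sqrt (U / (c / A)) * d mu)) T.
  have hT' := @hasum_bij _ _ _ (fun q : int * int => (q.2, q.1)) (fun q => (q.2, q.1)) H T
     (fun q => let: (a, b) := q in erefl) (fun q => let: (a, b) := q in erefl) hT.
  apply: (hasum_fubini hT') => mu; apply: eq_hasum (hasumZ _ (dP mu).1) => l.
  by rewrite /H /=; ring.
pose Df (q : int * int) : R := expR (- (pi ^+ 2 / (c * A) * q.1%:~R ^+ 2)) *
  (expR (- (pi ^+ 2 / (c / A) * (q.2%:~R + q.1%:~R * B / A) ^+ 2)) *
     cos (2 * pi * (q.2%:~R * y - q.1%:~R * x))).
have [D hD] : exists D, hasum Df D.
  have pb1 : 0 < pi ^+ 2 / (c * A) by rewrite divr_gt0.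
  have pb2 : 0 < pi ^+ 2 / (c / A) by rewrite divr_gt0.
  have [K hK] := gauss_row pb2; have [K2 /(_ 0) [g2 hg2 _]] := gauss_row pb1.
  pose g (mu : int) := sval (cid2 (hK (mu%:~R * B / A))).
  have gP mu : hasum (fun n : int => expR (- (pi ^+ 2 / (c / A) * (n%:~R + mu%:~R * B / A) ^+ 2))) (g mu)
     /\ 0 <= g mu <= K by rewrite /g; case: cid2 => v /=.
  have [S hS] : exists S, hasum (fun mu : int => expR (- (pi ^+ 2 / (c * A) * mu%:~R ^+ 2)) * g mu) S.
    apply: hasum_dominated (hasumZ K hg2) => mu; have [_ /andP[g0 gK]] := gP mu.
    by rewrite ger0_norm ?mulr_ge0 ?expR_ge0// addr0 mulrC ler_wpM2r ?expR_ge0.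
  have hS2 : hasum (fun q : int * int => expR (- (pi ^+ 2 / (c * A) * q.1%:~R ^+ 2)) *
    expR (- (pi ^+ 2 / (c / A) * (q.2%:~R + q.1%:~R * B / A) ^+ 2))) S.
    apply: (@hasum_tonelli _ _ _ _ (fun mu : int => expR (- (pi ^+ 2 / (c * A) * mu%:~R ^+ 2)) * g mu)) => //.
    by move=> mu; apply: eq_hasum (hasumZ (expR (- (pi ^+ 2 / (c * A) * mu%:~R ^+ 2))) (gP mu).1).
  apply: hasum_dominated hS2 => q; rewrite /Df !normrM !(ger0_norm (expR_ge0 _)).
  rewrite ler_pM2l ?expR_gt0// ger_pMr ?expR_gt0//.
  by rewrite ler_norml cos_geN1 cos_le1.
have hd : hasum (fun mu : int => expR (- (pi ^+ 2 / (c * A) * mu%:~R ^+ 2)) * d mu) D.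
  by apply: (hasum_fubini hD) => mu; apply: eq_hasum (hasumZ (expR (- (pi ^+ 2 / (c * A) * mu%:~R ^+ 2))) (dP mu).2).
have TD : T = Num.sqrt (U / (c / A)) * D.
  apply: hasum_unique dT _; apply: eq_hasum (hasumZ (Num.sqrt (U / (c / A))) hd) => mu; ring.
exists D.
  have -> : U / c * D = Num.sqrt (U / (c * A)) * T.
    rewrite TD mulrA -sqrtrM; last by rewrite divr_ge0 ?ltW.
    have -> : U / (c * A) * (U / (c / A)) = (U / c) ^+ 2 by field; rewrite An cn.
    by rewrite sqrtr_sqr ger0_norm// divr_ge0 ?ltW.
  have := @hasum_bij _ _ _ (fun q : int * int => (q.2, q.1)) (fun q => (q.2, q.1)) _ _
     (fun q => let: (a, b) := q in erefl) (fun q => let: (a, b) := q in erefl) hE.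
  apply: eq_hasum => -[k l] /=; rewrite -expRD; congr expR; rewrite /xi.
  have -> : s2 = 2 * (1 + B ^+ 2) / A - s3.
    by apply: (mulIf An); rewrite mulrBl divfK//; rewrite /A /B; lra.
  have -> : s3 = - 2 * B by rewrite /B; lra.
  have -> : s1 = 2 * A + 2 * B by rewrite /A /B; lra.
  by field.
(* Reversing the sign of mu gives the phase and the cross term the signs in the statement. *)
have := @hasum_bij _ _ _ (fun q : int * int => (- q.1, q.2)) (fun q => (- q.1, q.2)) _ _
   (fun q => _) (fun q => _) hD.
rewrite /Df => h; apply: eq_hasum (h _ _) => [[m n]||] /=.
- rewrite mulrA -expRD; congr (expR _ * cos _); last by rewrite rmorphN /=; ring.
  rewrite rmorphN /=.
  have -> : s2 = 2 * (1 + B ^+ 2) / A - s3.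
    by apply: (mulIf An); rewrite mulrBl divfK//; rewrite /A /B; lra.
  have -> : s3 = - 2 * B by rewrite /B; lra.
  have -> : s1 = 2 * A + 2 * B by rewrite /A /B; lra.
  by field; rewrite An.
- by move=> [m n] /=; rewrite opprK.
- by move=> [m n] /=; rewrite opprK.
Qed.

End Plane.
End Poisson.

(** * The dual series ([c < 4]) *)

Section Tools.
Variable R : realType.
Implicit Types (x y : R).

(** The pattern of all estimates below: a short explicit list of indices is evaluated, the others
    are dominated, mostly by a multiple of [decay]. *)
Lemma hasum_le_seq (I : choiceType) (f g : I -> R) (l G : R) (s : seq I) :
  uniq s -> (forall i, i \notin s -> f i <= g i) -> (forall i, 0 <= g i) ->
  hasum f l -> hasum g G -> l <= \sum_(i <- s) f i + G.
Proof.
move=> us fg g0 fl gG; have := @hasum_le_fin R I f g l G [fset i in s]%fset.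
rewrite (perm_big s); last first.
  by apply: uniq_perm; [exact: fset_uniq|exact: us|move=> i; rewrite !inE].
by apply=> // i; rewrite !inE; exact: fg.
Qed.

Lemma hasum_ge_seq (I : choiceType) (f g : I -> R) (l G : R) (s : seq I) :
  uniq s -> (forall i, i \notin s -> - g i <= f i) -> (forall i, 0 <= g i) ->
  hasum f l -> hasum g G -> \sum_(i <- s) f i - G <= l.
Proof.
move=> us fg g0 fl gG; have := @hasum_ge_fin R I f g l G [fset i in s]%fset.
rewrite (perm_big s); last first.
  by apply: uniq_perm; [exact: fset_uniq|exact: us|move=> i; rewrite !inE].
by apply=> // i; rewrite !inE; exact: fg.
Qed.

Lemma expR_ge4 x : 0 <= x -> 1 + x + x ^+ 2 / 2 + x ^+ 3 / 6 + x ^+ 4 / 24 <= expR x.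
Proof.
move=> x0; rewrite -subr_ge0; move: x x0.
have hd (x : R) : is_derive x 1 (fun x => expR x - (1 + x + x ^+ 2 / 2 + x ^+ 3 / 6 + x ^+ 4 / 24))
   (expR x - (1 + x + x ^+ 2 / 2 + x ^+ 3 / 6)).
  by apply: is_derive_eq; rewrite /GRing.scale /=; lra.
apply: (ge0_derive hd) => [|x x0]; first by rewrite expR0; lra.
have := expR_ge3' x0; lra.
Qed.

Lemma expR_ge5 x : 0 <= x ->
  1 + x + x ^+ 2 / 2 + x ^+ 3 / 6 + x ^+ 4 / 24 + x ^+ 5 / 30 / 4 <= expR x.
Proof.
move=> x0; rewrite -subr_ge0; move: x x0.
have hd (x : R) : is_derive x 1 (fun x => expR x - (1 + x + x ^+ 2 / 2 + x ^+ 3 / 6 + x ^+ 4 / 24 + x ^+ 5 / 30 / 4))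
   (expR x - (1 + x + x ^+ 2 / 2 + x ^+ 3 / 6 + x ^+ 4 / 24)).
  by apply: is_derive_eq; rewrite /GRing.scale /=; lra.
apply: (ge0_derive hd) => [|x x0]; first by rewrite expR0; lra.
have := expR_ge4 x0; lra.
Qed.

Lemma expR_le_inv x y : 0 < y -> y <= expR x -> expR (- x) <= y^-1.
Proof. by move=> y0 yx; rewrite expRN lef_pV2 ?posrE ?expR_gt0. Qed.

(* exp(-7/10) is slightly below 1/2, so that the double geometric series is below 9 *)
Definition decay (p : int * int) : R := expR (- (7 / 10 * (`|p.1|%:~R + `|p.2|%:~R))).

Lemma hasum_decay : exists2 G, hasum decay G & G <= 9.
Proof.
have q1 : expR (- (7 / 10)) <= 1 / 2 :> R.
  rewrite div1r; apply: expR_le_inv => //.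
  by apply: le_trans (expR_ge4 _); lra.
have q0 := expR_gt0 (- (7 / 10) : R).
exists (((1 + expR (- (7 / 10))) / (1 - expR (- (7 / 10)))) ^+ 2).
  have h := @hasum_geo_int2 R (expR (- (7 / 10))) (ltW q0) ltac:(lra).
  apply: eq_hasum h => -[m n] /=; rewrite /decay -expRM_natl /= natrD.
  by congr expR; rewrite !pmulrn !abszE; ring.
set q := expR _ in q0 q1 *.
have h : (1 + q) / (1 - q) <= 3 by rewrite ler_pdivrMr; lra.
have h0 : 0 <= (1 + q) / (1 - q) by rewrite divr_ge0; lra.
rewrite expr2; apply: le_trans (ler_pM h0 h0 h h) _; lra.
Qed.

Lemma decay_ge0 p : 0 <= decay p. Proof. exact: expR_ge0. Qed.

Lemma cos_third (k : int) : cos (2 * pi * (k%:~R / 3)) = (if (3 %| `|k|)%N then 1 else - 1 / 2) :> R.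
Proof.
have c1 : cos (2 * pi / 3) = - 1 / 2 :> R.
  have := @sum_cos_arith R 1 3 0 isT; rewrite !big_ord_recr big_ord0 /=.
  rewrite !mulr1 !mulr0 mul0r !add0r cos0 /= => h.
  have e : cos (2 * pi * 2 / 3) = cos (2 * pi / 3) :> R.
    rewrite -[RHS]cosN -[RHS](cosD2piZ _ 1); congr cos; lra.
  by move: h; rewrite e; lra.
have e3 (q : int) (y : R) : cos (2 * pi * ((q * 3)%:~R / 3) + y) = cos y.
  by rewrite -[RHS](cosD2piZ _ q); congr cos; rewrite intrM; lra.
case: ifPn => [/dvdnP[q hq]|k3].
  have [q' ->] : exists q' : int, k = q' * 3.
    by case: k hq => p /= hp; [exists q%:Z; lia|exists (- q%:Z); lia].
  by rewrite -[X in cos X]addr0 e3 cos0.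
have [q [->|->]] : exists q : int, k = q * 3 + 1 \/ k = q * 3 + 2.
  have : (`|k| = `|k| %/ 3 * 3 + 1 \/ `|k| = `|k| %/ 3 * 3 + 2)%N by lia.
  case: k k3 => p /= p3 [h|h].
  - by exists (p %/ 3)%N%:Z; left; lia.
  - by exists (p %/ 3)%N%:Z; right; lia.
  - by exists (- (p.+1 %/ 3)%N%:Z - 1); right; lia.
  - by exists (- (p.+1 %/ 3)%N%:Z - 1); left; lia.
- by rewrite (_ : _ * _ = 2 * pi * ((q * 3)%:~R / 3) + 2 * pi / 3) ?e3// intrD; lra.
- rewrite (_ : _ * _ = 2 * pi * ((q * 3)%:~R / 3) + 2 * pi * (2 / 3)); last by rewrite intrD; lra.
  rewrite e3 -c1 -[RHS]cosN -[RHS](cosD2piZ _ 1); congr cos; lra.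
Qed.

Lemma sin_natM (n : nat) x : `|sin (n%:R * x)| <= n%:R * `|sin x|.
Proof.
elim: n => [|n IH]; first by rewrite !mul0r sin0 normr0.
rewrite -natr1 !mulrDl !mul1r sinD; apply: le_trans (ler_normD _ _) _; apply: lerD.
  rewrite normrM -[leRHS]mulr1; apply: ler_pM => //.
  by rewrite ler_norml cos_geN1 cos_le1.
rewrite normrM -[leRHS]mul1r; apply: ler_pM => //.
by rewrite ler_norml cos_geN1 cos_le1.
Qed.

Lemma sin_intM (k : int) x : `|sin (k%:~R * x)| <= `|k|%:~R * `|sin x|.
Proof.
case: k => n; first exact: sin_natM.
by rewrite NegzE rmorphN /= mulNr sinN normrN -pmulrn; apply: le_trans (sin_natM _ _) _.
Qed.

End Tools.

(** * The hexagonal norm form and its sublattice of index three *)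

Definition hexN (p : int * int) : int := p.1 ^+ 2 + p.1 * p.2 + p.2 ^+ 2.

(** [quad_dual (sg, sg, sg)] is [sg] times [hexN]; this is the rotation of order three of the
    hexagonal dual lattice. *)
Definition rot3 (p : int * int) : int * int := (p.2, - p.1 - p.2).

(** All vectors with [hexN] at most 3: the origin, six of norm 1, six of norm 3. *)
Definition shell3 : seq (int * int) :=
  [:: (0, 0); (1, 0); (-1, 0); (0, 1); (0, -1); (1, -1); (-1, 1);
      (1, 1); (-1, -1); (1, -2); (-1, 2); (2, -1); (-2, 1)].

Lemma hexN_rot3 p : hexN (rot3 p) = hexN p.
Proof. by case: p => m n; rewrite /hexN /=; ring. Qed.

Lemma hexN_ge0 p : 0 <= hexN p.
Proof. by case: p => m n; rewrite /hexN /=; nia. Qed.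

Lemma dvd3_intP (k : int) : (3 %| `|k|)%N -> exists b : int, k = 3 * b.
Proof. by case: k => q /dvdnP[k hk]; [exists k%:Z|exists (- k%:Z)]; lia. Qed.

Lemma norm_sum_hexN (p : int * int) : (`|p.1| + `|p.2|) ^+ 2 <= 4 * hexN p.
Proof.
case: p => m n; rewrite /hexN /=.
have hm : `|m| ^+ 2 = m ^+ 2 by rewrite real_normK ?num_real.
have hn : `|n| ^+ 2 = n ^+ 2 by rewrite real_normK ?num_real.
have hmn : - (`|m| * `|n|) <= m * n by rewrite -normrM lerNl ler_normr lexx orbT.
have := sqr_ge0 (`|m| - `|n|); rewrite -hm -hn; move: `|m| `|n| hmn => a b.
rewrite (_ : (a - b) ^+ 2 = a ^+ 2 - 2 * (a * b) + b ^+ 2); last by ring.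
rewrite (_ : (a + b) ^+ 2 = a ^+ 2 + 2 * (a * b) + b ^+ 2); last by ring.
move: (a ^+ 2) (a * b) (b ^+ 2) (m * n) => ? ? ? ?; lia.
Qed.

(** By [norm_sum_hexN] the sum is at most 2 sqrt N, which is at most N from N = 4 on and, for the
    next lemma, at most N - 3 from N = 9 on. *)
Lemma hexN_norm4 p : 4 <= hexN p -> `|p.1| + `|p.2| <= hexN p.
Proof.
have := norm_sum_hexN p; have := hexN_ge0 p.
set k := `|p.1| + `|p.2|; set N := hexN p.
have : 0 <= k by rewrite addr_ge0.
nia.
Qed.

Lemma hexN_norm9 p : 9 <= hexN p -> `|p.1| + `|p.2| <= hexN p - 3.
Proof.
have := norm_sum_hexN p; have := hexN_ge0 p.
set k := `|p.1| + `|p.2|; set N := hexN p.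
have : 0 <= k by rewrite addr_ge0.
nia.
Qed.

Lemma hexN_shell3 p : p \notin shell3 -> 4 <= hexN p.
Proof.
case: p => m n; apply: contraR => h.
have {}h : m ^+ 2 + m * n + n ^+ 2 <= 3 by move: h; rewrite /hexN /=; lia.
have hm : -2 <= m <= 2 by nia.
have hn : -2 <= n <= 2 by nia.
have : m = -2 \/ m = -1 \/ m = 0 \/ m = 1 \/ m = 2 by lia.
have : n = -2 \/ n = -1 \/ n = 0 \/ n = 1 \/ n = 2 by lia.
by move=> [|[|[|[|]]]] En [|[|[|[|]]]] Em; move: h; rewrite En Em.
Qed.

(** On the sublattice p.1 = p.2 modulo 3 the form is 3 times a hexagonal norm, and a^2 + a b + b^2
    never equals 2; so after norm 3 comes norm 9. *)
Lemma hexN_mul3 p : (3 %| `|(p.1 - p.2)%R|)%N -> p \notin shell3 -> 9 <= hexN p.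
Proof.
move=> d3 /hexN_shell3; case: p d3 => m n /=; rewrite /hexN /= => d3 h4.
have [b hb] := dvd3_intP d3.
have e : m ^+ 2 + m * n + n ^+ 2 = 3 * (n ^+ 2 + 3 * n * b + 3 * b ^+ 2).
  by rewrite (_ : m = n + 3 * b); [ring|lia].
move: h4; rewrite e; set a := n + b => h4.
have e2 : n ^+ 2 + 3 * n * b + 3 * b ^+ 2 = a ^+ 2 + a * b + b ^+ 2 by rewrite /a; ring.
move: h4; rewrite e2 => h4.
suff : a ^+ 2 + a * b + b ^+ 2 <> 2 by move: h4; set q := a ^+ 2 + _ + _; lia.
move=> h2.
have small (u v : int) : u ^+ 2 + u * v + v ^+ 2 = 2 -> -1 <= v <= 1.
  move=> huv; have : 3 * v ^+ 2 <= 8.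
    have := sqr_ge0 (2 * u + v).
    rewrite (_ : (2 * u + v) ^+ 2 = 4 * (u ^+ 2 + u * v + v ^+ 2) - 3 * v ^+ 2); last by ring.
    by rewrite huv; lia.
  by clear; move=> h; apply/andP; split; nia.
have hb' := small a b h2.
have ha' : -1 <= a <= 1 by apply: (small b); rewrite -h2; ring.
have : a = -1 \/ a = 0 \/ a = 1 by lia.
have : b = -1 \/ b = 0 \/ b = 1 by lia.
by move=> [|[|]] Eb [|[|]] Ea; move: h2; rewrite Eb Ea.
Qed.

(** * The minimum of the hexagonal dual series *)

Section HexDual.
Variable R : realType.
Implicit Types (x y t : R).

Lemma hasum_rot3 (f : int * int -> R) l : hasum f l ->
  hasum (fun p => f p + f (rot3 p) + f (rot3 (rot3 p))) (3 * l).
Proof.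
have K1 : cancel rot3 (fun p => (- p.1 - p.2, p.1)).
  by move=> [m n] /=; congr (_, _); ring.
have K2 : cancel (fun p => (- p.1 - p.2, p.1)) rot3.
  by move=> [m n] /=; rewrite /rot3 /=; congr (_, _); ring.
move=> fl; have f1 := hasum_bij K1 K2 fl; have f2 := hasum_bij K1 K2 f1.
have := hasumD (hasumD fl f1) f2; rewrite (_ : l + l + l = 3 * l) //; ring.
Qed.

Definition chi3 (p : int * int) : R := if (3 %| `|(p.1 - p.2)%R|)%N then 1 else - 1 / 2.

Lemma chi3_rot3 p : chi3 (rot3 p) = chi3 p.
Proof.
rewrite /chi3; case: p => m n /=; congr (if _ then _ else _).
have -> : n - (- m - n) = (m - n) + 3 * n by ring.
by lia.
Qed.

Lemma cos_chi3 (p : int * int) : cos (2 * pi * (p.1%:~R * (1 / 3) + p.2%:~R * (- 1 / 3))) = chi3 p.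
Proof. by rewrite /chi3 -cos_third; congr cos; rewrite intrD rmorphN /=; lra. Qed.

(** The right side is |1 + exp (iA) + exp (-iB)|^2 = (cos g + 2 cos d)^2 + (sin g)^2, with d and g
    the half sum and the half difference. It measures by how much the first shell exceeds its
    minimum, and vanishes at the third points only. *)
Lemma sin2_le_shell (A B : R) :
  sin ((A - B) / 2) ^+ 2 <= 3 + 2 * cos A + 2 * cos B + 2 * cos (A + B).
Proof.
pose g := (A - B) / 2; pose d := (A + B) / 2.
have -> : A = d + g by rewrite /d /g; lra.
have -> : B = d - g by rewrite /d /g; lra.
have -> : (d + g - (d - g)) / 2 = g by lra.
have -> : d + g + (d - g) = d + d by lra.
rewrite [cos (d + g)]cosD [cos (d - g)]cosB [cos (d + d)]cosD.
have := cos2Dsin2 g; have := cos2Dsin2 d; have := sqr_ge0 (cos g + 2 * cos d).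
rewrite !expr2; nra.
Qed.

Lemma cos_sublattice (A B : R) (p : int * int) : (3 %| `|(p.1 - p.2)%R|)%N ->
  1 - cos (p.1%:~R * A - p.2%:~R * B) <=
    8 / 3 * (hexN p)%:~R * (3 + 2 * cos A + 2 * cos B + 2 * cos (A + B)).
Proof.
case: p => m n /= d3; set S := 3 + _ + _ + _.
have [b hb] := dvd3_intP d3.
pose a := m - b.
have S1 : sin ((A - B) / 2) ^+ 2 <= S by exact: sin2_le_shell.
have S2 : sin ((A + 2 * B) / 2) ^+ 2 <= S.
  have := sin2_le_shell B (- A - B).
  rewrite (_ : B - (- A - B) = A + 2 * B); last by ring.
  rewrite (_ : B + (- A - B) = - A); last by ring.
  rewrite (_ : - A - B = - (A + B)); last by ring.
  by rewrite !cosN /S; lra.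
have S0 : 0 <= S by apply: le_trans S1; exact: sqr_ge0.
pose q := Num.sqrt S; have q0 : 0 <= q by exact: sqrtr_ge0.
have qS : q ^+ 2 = S by exact: sqr_sqrtr.
have s1 : `|sin ((A - B) / 2)| <= q by rewrite -sqrtr_sqr ler_wsqrtr.
have s2 : `|sin ((A + 2 * B) / 2)| <= q by rewrite -sqrtr_sqr ler_wsqrtr.
pose th := m%:~R * A - n%:~R * B.
have thE : th / 2 = a%:~R * ((A - B) / 2) + b%:~R * ((A + 2 * B) / 2).
  have mE : m = a + b by rewrite /a; ring.
  have nE : n = a - 2 * b by rewrite /a; move: hb; lia.
  by rewrite /th mE nE !(intrD, rmorphN, intrM) /=; lra.
have st : `|sin (th / 2)| <= (`|a| + `|b|)%:~R * q.
  rewrite (_ : (_ + _)%:~R * q = `|a|%:~R * q + `|b|%:~R * q); last by rewrite intrD mulrDl.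
  rewrite thE sinD; apply: le_trans (ler_normD _ _) _; apply: lerD.
    rewrite normrM -[leRHS]mulr1; apply: ler_pM => //; last by rewrite ler_norml cos_geN1 cos_le1.
    by apply: le_trans (sin_intM _ _) _; rewrite ler_wpM2l// ler0z.
  rewrite normrM -[leRHS]mul1r; apply: ler_pM => //; first by rewrite ler_norml cos_geN1 cos_le1.
  by apply: le_trans (sin_intM _ _) _; rewrite ler_wpM2l// ler0z.
have c2 : 1 - cos th = 2 * sin (th / 2) ^+ 2.
  have {1}-> : th = th / 2 + th / 2 by lra.
  have := cos2Dsin2 (th / 2); rewrite cosD !expr2; lra.
rewrite c2.
have st2 : sin (th / 2) ^+ 2 <= ((`|a| + `|b|)%:~R * q) ^+ 2.
  rewrite -[leLHS]real_normK ?num_real// ler_sqr ?nnegrE// mulr_ge0// ler0z; lia.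
have abN : (`|a| + `|b|) ^+ 2 * 3 <= 4 * hexN (m, n).
  have := norm_sum_hexN (a, - b); rewrite /= normrN.
  have -> : hexN (m, n) = 3 * hexN (a, - b).
    rewrite /hexN /= (_ : n = m - 3 * b); last by rewrite -hb; ring.
    by rewrite (_ : m = a + b); [ring|rewrite /a; ring].
  by clear; move: ((_ + _) ^+ 2) (hexN _) => u v; lia.
have abR : (`|a| + `|b|)%:~R ^+ 2 * 3 <= 4 * (hexN (m, n))%:~R :> R.
  by rewrite -(ler_int R) !(intrM, rmorphXn) /= in abN.
rewrite exprMn qS in st2; nra.
Qed.

Lemma expR28 : expR (28 / 10) <= 18 :> R.
Proof.
have e : expR (- (28 / 10)) >= 1 / 18 :> R.
  have -> : - (28 / 10) = 7%:R * - (4 / 10) :> R by lra.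
  rewrite expRM_natl; have e4 := @expRN_ge3 R (4 / 10) ltac:(lra).
  apply: le_trans (_ : (2 / 3) ^+ 7 <= _); first by lra.
  apply: lerXn2r; rewrite ?nnegrE ?expR_ge0//; lra.
have e0 := expR_gt0 (28 / 10 : R).
by move: e; rewrite expRN div1r lef_pV2 ?posrE.
Qed.

Lemma hex_dual_numeric (h S e : R) : 0 <= h -> h <= 6 / 10 / 10 -> 0 <= S -> 0 <= e -> e <= 18 ->
  9 * (32 * e * h ^+ 4 * S) + 24 * 6 * h ^+ 3 * S <= 3 * (h * S).
Proof.
move=> h0 h1 S0 e0 e1.
have h2 : h ^+ 2 <= (6 / 10 / 10) ^+ 2 by rewrite ler_sqr ?nnegrE; lra.
have h20 : 0 <= h ^+ 2 by apply: sqr_ge0.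
have h3 : e * h ^+ 3 <= 18 * (6 / 10 / 10) ^+ 3.
  have h3' : h ^+ 3 <= (6 / 10 / 10) ^+ 3 by apply: lerXn2r; rewrite ?nnegrE; lra.
  exact: ler_pM e0 (exprn_ge0 3 h0) e1 h3'.
have hS : 0 <= h * S by exact: mulr_ge0.
have := ler_wpM2l hS h3; have := ler_wpM2l hS h2.
rewrite [h ^+ 4]exprS [h ^+ 3]exprS; lra.
Qed.

(** The difference is averaged over [rot3]. Off the sublattice every averaged term is nonnegative,
    since the three cosines add up to at least -3/2; the first shell gains 3 h S in all. A
    sublattice term loses at most 8 N w S, and h <= 0.06 makes these losses smaller. *)
Lemma hex_dual_min (t sg x y D D0 : R) : 0 < sg -> expR (- (t * sg)) <= 6 / 10 / 10 ->
  hasum (fun p : int * int => expR (- (t * quad_dual (sg, sg, sg) p.1%:~R p.2%:~R)) *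
      cos (2 * pi * (p.1%:~R * x + p.2%:~R * y))) D ->
  hasum (fun p : int * int => expR (- (t * quad_dual (sg, sg, sg) p.1%:~R p.2%:~R)) * chi3 p) D0 ->
  D0 <= D.
Proof.
move=> sg0 h06 hD hD0; set h := expR _ in h06.
have h0 : 0 < h by exact: expR_gt0.
pose tau := t * sg.
(* 19/20 = 1/4 + 7/10: the rate that absorbs both N <= 4 exp ((N - 4)/4) and [decay]. *)
have tau1 : 19 / 20 <= tau.
  rewrite leNgt; apply/negP => lt.
  have := @expRN_ge3 R (19 / 20) ltac:(lra).
  have : expR (- (19 / 20)) <= h by rewrite ler_expR -/tau; lra.
  lra.
pose w (p : int * int) := expR (- (tau * (hexN p)%:~R)) : R.
have wE (p : int * int) : expR (- (t * quad_dual (sg, sg, sg) p.1%:~R p.2%:~R)) = w p.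
  congr expR; rewrite /quad_dual /tau /hexN /= !(intrD, intrM, rmorphXn) /=; lra.
pose A := 2 * pi * x; pose B := - (2 * pi * y).
pose S := 3 + 2 * cos A + 2 * cos B + 2 * cos (A + B).
have S0 : 0 <= S by apply: le_trans (sin2_le_shell A B); exact: sqr_ge0.
pose c (p : int * int) := cos (p.1%:~R * A - p.2%:~R * B).
pose f p := w p * (c p - chi3 p).
have hf : hasum f (D - D0).
  apply: eq_hasum (hasumB hD hD0) => p; rewrite wE /f /c mulrBr.
  by congr (_ * cos _ - _); rewrite /A /B; ring.
have := hasum_rot3 hf; set F := (fun p => _) => hF.
have FE p : F p = w p * (c p + c (rot3 p) + c (rot3 (rot3 p)) - 3 * chi3 p).
  by rewrite /F /f /w !hexN_rot3 !chi3_rot3; ring.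
have c3 p : - 3 / 2 <= c p + c (rot3 p) + c (rot3 (rot3 p)).
  have -> : c (rot3 (rot3 p)) = cos (- ((p.1%:~R * A - p.2%:~R * B) + ((rot3 p).1%:~R * A - (rot3 p).2%:~R * B))).
    by rewrite /c /rot3 /=; congr cos; rewrite !(intrD, rmorphN) /=; ring.
  rewrite /c cosN; set a := _ - _; set b := _ - _.
  by have := le_trans (sqr_ge0 _) (sin2_le_shell a b); lra.
have w0 p : 0 < w p by exact: expR_gt0.
have N0 p : 0 <= (hexN p)%:~R :> R by rewrite ler0z hexN_ge0.
have Flow p : - (8 * (hexN p)%:~R * w p * S) <= F p.
  rewrite FE /chi3; case: ifPn => d3; last first.
    apply: le_trans (_ : 0 <= _).
      by rewrite oppr_le0 !mulr_ge0// ltW.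
    by apply: mulr_ge0; [exact: ltW|have := c3 p; lra].
  have d3' : (3 %| `|((rot3 p).1 - (rot3 p).2)%R|)%N.
    by move: d3; rewrite /rot3 /=; lia.
  have d3'' : (3 %| `|((rot3 (rot3 p)).1 - (rot3 (rot3 p)).2)%R|)%N.
    by move: d3; rewrite /rot3 /=; lia.
  have := cos_sublattice A B d3; have := cos_sublattice A B d3'; have := cos_sublattice A B d3''.
  rewrite !hexN_rot3 -/S -/(c p) -/(c (rot3 p)) -/(c (rot3 (rot3 p))) => h1 h2 h3.
  have h4 : - (8 * (hexN p)%:~R * S) <= c p + c (rot3 p) + c (rot3 (rot3 p)) - 3 * 1 by lra.
  have := ler_wpM2l (ltW (w0 p)) h4; lra.
have F1 p : p \in [:: (1, 0); (-1, 0); (0, 1); (0, -1); (1, -1); (-1, 1)] -> F p = h * S / 2.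
  move=> hp; rewrite FE.
  have -> : w p = h.
    by move: hp; rewrite !inE => /or4P[/eqP->|/eqP->|/eqP->|/or3P[/eqP->|/eqP->|/eqP->]]; rewrite /w /h /hexN /= mulr1.
  have -> : chi3 p = - 1 / 2.
    by move: hp; rewrite !inE => /or4P[/eqP->|/eqP->|/eqP->|/or3P[/eqP->|/eqP->|/eqP->]].
  have -> : c p + c (rot3 p) + c (rot3 (rot3 p)) = cos A + cos B + cos (A + B).
    have e1 (r : int * int) : r = (1, 0) \/ r = (-1, 0) -> c r = cos A.
      by move=> [->|->]; rewrite /c /= ?mul1r ?mulN1r ?mul0r ?subr0 ?cosN.
    have e2 (r : int * int) : r = (0, 1) \/ r = (0, -1) -> c r = cos B.
      by move=> [->|->]; rewrite /c /= ?mul1r ?mulN1r ?mul0r ?sub0r ?opprK ?cosN.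
    have e3 (r : int * int) : r = (1, -1) \/ r = (-1, 1) -> c r = cos (A + B).
      move=> [->|->]; rewrite /c /=; last rewrite -[RHS]cosN; congr cos; lra.
    move: hp; rewrite !inE => /or4P[/eqP->|/eqP->|/eqP->|/or3P[/eqP->|/eqP->|/eqP->]].
    - by rewrite (e1 (1, 0)) ?(e2 (rot3 (1, 0))) ?(e3 (rot3 (rot3 (1, 0)))) ; [ring|right|right|left].
    - by rewrite (e1 (-1, 0)) ?(e2 (rot3 (-1, 0))) ?(e3 (rot3 (rot3 (-1, 0)))) ; [ring|left|left|right].
    - by rewrite (e2 (0, 1)) ?(e3 (rot3 (0, 1))) ?(e1 (rot3 (rot3 (0, 1)))) ; [ring|right|left|left].
    - by rewrite (e2 (0, -1)) ?(e3 (rot3 (0, -1))) ?(e1 (rot3 (rot3 (0, -1)))) ; [ring|left|right|right].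
    - by rewrite (e3 (1, -1)) ?(e1 (rot3 (1, -1))) ?(e2 (rot3 (rot3 (1, -1)))) ; [ring|left|right|left].
    - by rewrite (e3 (-1, 1)) ?(e1 (rot3 (-1, 1))) ?(e2 (rot3 (rot3 (-1, 1)))) ; [ring|right|left|right].
  by rewrite /S; lra.
have [G hG G9] := hasum_decay R.
(* 28/10 = 4 * 7/10 compensates [decay] at the smallest remaining norm, 4. *)
pose K := 32 * expR (28 / 10) * h ^+ 4 * S.
have K0 : 0 <= K by rewrite /K !mulr_ge0 ?expR_ge0// exprn_ge0// ltW.
have hp4 : h ^+ 4 = expR (- (4 * tau)).
  by rewrite -expRM_natl; congr expR; rewrite /tau; lra.
have off p : p \notin shell3 -> - (K * decay R p) <= F p.
  move=> ps; have N4 := hexN_shell3 ps; have n1 := hexN_norm4 N4.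
  apply: le_trans (Flow p); rewrite lerN2 /K.
  have N4R : 4 <= (hexN p)%:~R :> R by rewrite (ler_int R 4).
  have n1R : `|p.1|%:~R + `|p.2|%:~R <= (hexN p)%:~R :> R by rewrite -intrD ler_int.
  suff hh : (hexN p)%:~R * w p <= 4 * expR (28 / 10) * h ^+ 4 * decay R p.
    have := ler_wpM2r S0 hh; lra.
  rewrite hp4 /decay -mulrA -mulrA -!expRD.
  apply: le_trans (_ : 4 * expR (((hexN p)%:~R - 4) / 4) * w p <= _).
    by rewrite ler_pM2r//; have := expR_ge1Dx (((hexN p)%:~R - 4) / 4 : R); lra.
  rewrite /w -mulrA -expRD ler_pM2l// ler_expR; nra.
have := hasum_ge_seq (s := shell3) isT off (fun p => mulr_ge0 K0 (decay_ge0 R p)) hF (hasumZ K hG).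
have F3 p : p \in [:: (1, 1); (-1, -1); (1, -2); (-1, 2); (2, -1); (-2, 1)] -> - (24 * h ^+ 3 * S) <= F p.
  move=> hp; apply: le_trans (Flow p).
  have -> : w p = h ^+ 3.
    rewrite -expRM_natl; move: hp; rewrite !inE.
    by move=> /or4P[/eqP->|/eqP->|/eqP->|/or3P[/eqP->|/eqP->|/eqP->]]; rewrite /w /tau /hexN /=; congr expR; clear; lra.
  have -> : (hexN p)%:~R = 3 :> R.
    by move: hp; rewrite !inE => /or4P[/eqP->|/eqP->|/eqP->|/or3P[/eqP->|/eqP->|/eqP->]].
  lra.
have F0 : 0 <= F (0, 0).
  by apply: le_trans (Flow (0, 0)); rewrite /hexN /= !mulr0 !mul0r oppr0.
rewrite !big_cons big_nil (F1 (1, 0) isT) (F1 (-1, 0) isT) (F1 (0, 1) isT) (F1 (0, -1) isT)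
  (F1 (1, -1) isT) (F1 (-1, 1) isT).
have f1 := F3 (1, 1) isT; have f2 := F3 (-1, -1) isT; have f3 := F3 (1, -2) isT.
have f4 := F3 (-1, 2) isT; have f5 := F3 (2, -1) isT; have f6 := F3 (-2, 1) isT.
have KG : K * G <= 9 * K by rewrite mulrC ler_wpM2r.
have num := @hex_dual_numeric h S _ (ltW h0) h06 S0 (expR_ge0 _) expR28.
have KE : 9 * K = 9 * (32 * expR (28 / 10) * h ^+ 4 * S) by [].
move: f1 f2 f3 f4 f5 f6 F0 KG KE num.
move: (F (1, 1)) (F (-1, -1)) (F (1, -2)) (F (-1, 2)) (F (2, -1)) (F (-2, 1)) (F (0, 0)).
move=> *; lra.
Qed.

End HexDual.

(** * A much shorter dual vector: averaging over torsion points *)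

Section Averaging.
Variable R : realType.
Implicit Types (x y : R).

(** Averaging over the translates (x + i / n1, y + j / n2) kills every frequency outside n1 Z x n2
    Z, and a lower bound valid at all points survives it. *)
Lemma average_torsion (w : int * int -> R) (n1 n2 : nat) (B x y : R) : (0 < n1)%N -> (0 < n2)%N ->
  (forall x y, exists2 D,
     hasum (fun p => w p * cos (2 * pi * (p.1%:~R * x + p.2%:~R * y))) D & B <= D) ->
  exists2 D, hasum (fun p => w (n1%:Z * p.1, n2%:Z * p.2) *
     cos (2 * pi * (n1%:R * p.1%:~R * x + n2%:R * p.2%:~R * y))) D & B <= D.
Proof.
move=> n10 n20 h; pose D x y := sval (cid2 (h x y)).
have hD x' y' : hasum (fun p => w p * cos (2 * pi * (p.1%:~R * x' + p.2%:~R * y'))) (D x' y') /\ B <= D x' y'.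
  by rewrite /D; case: cid2.
have n1R : 0 < n1%:R :> R by rewrite ltr0n.
have n2R : 0 < n2%:R :> R by rewrite ltr0n.
pose xi (i : 'I_n1) := x + i%:R / n1%:R; pose yj (j : 'I_n2) := y + j%:R / n2%:R.
have := hasum_sum (index_enum 'I_n1) (fun i => hasum_sum (index_enum 'I_n2) (fun j => (hD (xi i) (yj j)).1)).
set f := (fun p => _); set L := \sum_(i <- _) _ => fL.
pose m1 (p : int * int) : R := if (n1 %| `|p.1|)%N then n1%:R else 0.
pose m2 (p : int * int) : R := if (n2 %| `|p.2|)%N then n2%:R else 0.
have fE p : f p = w p * (m1 p * (m2 p * cos (2 * pi * (p.1%:~R * x + p.2%:~R * y)))).
  rewrite /f; transitivity (w p * \sum_(i < n1) (m2 p * cos (2 * pi * (p.1%:~R * xi i + p.2%:~R * y)))).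
    rewrite mulr_sumr; apply: eq_bigr => i _.
    transitivity (w p * \sum_(j < n2) cos (2 * pi * (p.1%:~R * xi i + p.2%:~R * y) + 2 * pi * p.2%:~R * j%:R / n2%:R)).
      by rewrite mulr_sumr; apply: eq_bigr => j _; congr (_ * cos _); rewrite /yj; ring.
    by rewrite sum_cos_arith// /m2; case: ifP; rewrite ?mul0r.
  congr (_ * _); rewrite -mulr_sumr mulrCA; congr (_ * _).
  transitivity (\sum_(i < n1) cos (2 * pi * (p.1%:~R * x + p.2%:~R * y) + 2 * pi * p.1%:~R * i%:R / n1%:R)).
    by apply: eq_bigr => i _; congr cos; rewrite /xi; ring.
  by rewrite sum_cos_arith// /m1; case: ifP; rewrite ?mul0r.
pose e (p : int * int) := (n1%:Z * p.1, n2%:Z * p.2).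
have e_inj : injective e.
  by move=> [a b] [c d] [h1 h2]; congr (_, _); nia.
have := hasum_comp_inj e_inj _ fL => /(_ _)/(hasumZ (n1%:R * n2%:R)^-1) g.
exists ((n1%:R * n2%:R)^-1 * L); last first.
  rewrite mulrC ler_pdivlMr ?mulr_gt0//.
  apply: le_trans (_ : \sum_(i < n1) \sum_(j < n2) B <= _).
    by rewrite !sumr_const !card_ord -[B *+ _]mulr_natr -[(_ * _) *+ _]mulr_natr mulrAC mulrA [B * _]mulrC -mulrA.
  by apply: ler_sum => i _; apply: ler_sum => j _; exact: (hD _ _).2.
apply: eq_hasum (g _) => [p|q hq] /=.
  rewrite fE /m1 /m2 /e /= !abszM !absz_nat !dvdn_mulr// !intrM -!pmulrn.
  field; rewrite ?lt0r_neq0//.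
rewrite fE /m1 /m2; case: ifPn => [/dvdnP[a ha]|_]; last by rewrite mul0r mulr0.
case: ifPn => [/dvdnP[b hb]|_]; last by rewrite mul0r !mulr0.
exfalso; case: q hq ha hb => q1 q2 hq /= ha hb.
apply: (hq (if 0 <= q1 then a%:Z else - a%:Z, if 0 <= q2 then b%:Z else - b%:Z)).
by rewrite /e /=; congr (_, _); case: ifP; lia.
Qed.


(** For u <= 1/4 the margin of 2 * 1.59 over 3 pays for the higher powers; for larger u, 3 h <= 0.18
    is small against 2 u. *)
Lemma thin_numeric (h u : R) : 0 < h -> h <= 6 / 10 / 10 ->
  3 * 53 / 10 / 10 * h <= u -> u <= 57 / 10 / 10 ->
  1 - 2 * u + 2 * u ^+ 4 + 9 * (u ^+ 10 + h ^+ 7) < 1 - 3 * h.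
Proof.
move=> h0 h1 hu u1; have u0 : 0 < u by lra.
have h7 : h ^+ 7 <= h * (1 / 10 / 10 / 10).
  rewrite exprS ler_pM2l//; apply: le_trans (_ : (6 / 10 / 10) ^+ 6 <= _); last by lra.
  by apply: lerXn2r; rewrite ?nnegrE; lra.
have pw (n : nat) (b : R) : u <= b -> u ^+ n.+1 <= u * b ^+ n.
  move=> ub; rewrite exprS ler_pM2l//; apply: lerXn2r => //; rewrite nnegrE; lra.
case: (lerP u (1 / 4)) => u4.
  have := pw 3 _ u4; have := pw 9 _ u4; lra.
have := pw 3 _ u1; have := pw 9 _ u1; lra.
Qed.

Lemma ler_absz (k : nat) (m : int) : (k <= `|m|)%N -> k%:R <= `|m|%:~R :> R.
Proof. by rewrite -abszE -pmulrn ler_nat. Qed.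

Lemma sqr_absz (m : int) : `|m|%:~R ^+ 2 = m%:~R ^+ 2 :> R.
Proof. by rewrite intr_norm real_normK ?num_real. Qed.

Lemma absz_lt4 (m : int) : (m, 0 : int) \notin [:: (0, 0); (1, 0); (-1, 0); (2, 0); (-2, 0)] ->
  (`|m| < 4)%N -> m = 3 \/ m = -3.
Proof. by rewrite !inE !xpair_eqE !eqxx !andbT; lia. Qed.

(** Let n1 be the largest multiple of the short vector (1, 0) whose exponent v is still 0.47 below
    the hexagonal t sg. After averaging, at the point where (n1, 0) has cosine -1, the series is 1 -
    2u + 2u^4 up to small terms, with u = exp (- v) >= exp (0.47) h, and exp (0.47) > 1.59 > 3/2. *)
Lemma thin_case (t sg s1 s2 s3 B : R) : 0 < t -> 0 < sg -> 3 * sg ^+ 2 = 4 ->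
  selling (s1, s2, s3) -> s3 <= s2 -> s2 <= s1 ->
  14 / 5 <= t * sg -> expR (- (t * sg)) <= 6 / 10 / 10 ->
  t * ((s2 + s3) / 2) <= t * sg - 47 / 10 / 10 ->
  (forall x y, exists2 D, hasum (fun p : int * int =>
     expR (- (t * quad_dual (s1, s2, s3) p.1%:~R p.2%:~R)) *
     cos (2 * pi * (p.1%:~R * x + p.2%:~R * y))) D & B <= D) ->
  B < 1 - 3 * expR (- (t * sg)).
Proof.
move=> t0 sg0 sgE [/= s10 s20 s30 det] s32 s21 tau28 h06 thin hB.
set h := expR _ in h06 *; have h0 : 0 < h by exact: expR_gt0.
pose nu := t * ((s2 + s3) / 2).
have s1g : sg <= s1 by nra.
have w0 : 0 < s2 + s3 by nra.
have nu0 : 0 < nu by rewrite /nu mulr_gt0// divr_gt0.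
pose P (n : nat) := nu * n%:R ^+ 2 <= t * sg - 47 / 10 / 10.
have sqr_le k : (k <= k ^ 2)%N by case: k => // k; rewrite expnS expn1 leq_pmulr.
have exP : exists n, P n by exists 1%N; rewrite /P expr1n mulr1.
have bP n : P n -> (n <= Num.bound ((t * sg - 47 / 10 / 10) / nu))%N.
  rewrite /P mulrC -ler_pdivlMr// => hn.
  have b0 : 0 <= (t * sg - 47 / 10 / 10) / nu by rewrite divr_ge0; lra.
  rewrite -(ler_nat R); apply/ltW/(le_lt_trans _ (archi_boundP b0))/(le_trans _ hn).
  by rewrite -natrX ler_nat.
case: (ex_maxnP exP bP) => n1 Pn1 maxn1.
have n10 : (0 < n1)%N by apply: maxn1; rewrite /P expr1n mulr1.
have n1R : 0 < n1%:R :> R by rewrite ltr0n.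
pose v := nu * n1%:R ^+ 2; pose u := expR (- v).
have vle : v <= t * sg - 47 / 10 / 10 := Pn1.
(* Maximality of n1, applied to 2 n1: v is bounded below, hence u away from 1. *)
have vge : t * sg - 47 / 10 / 10 < 4 * v.
  rewrite ltNge; apply/negP => hv; have : P (n1 + n1)%N.
    by rewrite /P natrD; move: hv; rewrite /v; lra.
  by move/maxn1; rewrite -[X in (_ <= X)%N]addn0 leq_add2l leqNgt n10.
clear exP bP maxn1 sqr_le Pn1 P.
have v58 : 58 / 10 / 10 <= v by lra.
have hu : 3 * 53 / 10 / 10 * h <= u.
  apply: le_trans (_ : expR (47 / 10 / 10) * h <= _); last by rewrite -expRD ler_expR; clear -vle; lra.
  by rewrite ler_pM2r//; apply: le_trans (expR_ge3 _); clear; lra.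
have u57 : u <= 57 / 10 / 10.
  apply: le_trans (_ : expR (- (58 / 10 / 10)) <= _); first by rewrite ler_expR lerN2.
  apply: le_trans (expR_le_inv _ (expR_ge3 _)) _; first by clear; lra.
  by rewrite invf_ple ?posrE; clear; lra.
(* The abscissa 1 / (2 n1) turns the surviving cosines into cos (pi p.1); the factor 4 in the other
   direction pushes all rows but p.2 = 0 down to order h^7. *)
have [D hD BD] := @average_torsion _ n1 4 B (1 / (2 * n1%:R)) 0 n10 isT hB.
apply: le_lt_trans BD _; apply: le_lt_trans _ (thin_numeric h0 h06 hu u57).
pose f (p : int * int) := expR (- (t * quad_dual (s1, s2, s3) (n1%:R * p.1%:~R) (4 * p.2%:~R))) *
   cos (pi * p.1%:~R).
have {}hD : hasum f D.
  apply: eq_hasum hD => p; rewrite /f /= !intrM; congr (_ * cos _).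
  by field; rewrite lt0r_neq0.
have [G hG G9] := hasum_decay R.
pose K := u ^+ 10 + h ^+ 7.
have K0 : 0 <= K by rewrite addr_ge0// exprn_ge0// ltW// expR_gt0.
have row0 (m : int) : f (m, 0) = expR (- (v * m%:~R ^+ 2)) * cos (pi * m%:~R).
  by rewrite /f /v /nu /quad_dual /=; congr (expR _ * _); clear; lra.
have c1 : cos (pi * 1%:~R) = - 1 :> R by rewrite mulr1 cospi.
have c2 : cos (pi * 2%:~R) = 1 :> R.
  have -> : pi * 2%:~R = 0 + 2 * pi * 1%:~R :> R.
    by transitivity (pi * 2 : R) => //; rewrite mulr1; clear; lra.
  by rewrite cosD2piZ cos0.
have c3 : cos (pi * 3%:~R) = - 1 :> R.
  have -> : pi * 3%:~R = pi + 2 * pi * 1%:~R :> R.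
    by transitivity (pi * 3 : R) => //; rewrite mulr1; clear; lra.
  by rewrite cosD2piZ cospi.
have cN (m : int) : cos (pi * (- m)%:~R) = cos (pi * m%:~R) :> R.
  by rewrite rmorphN mulrN cosN.
pose s : seq (int * int) := [:: (0, 0); (1, 0); (-1, 0); (2, 0); (-2, 0)].
have off p : p \notin s -> f p <= K * decay R p.
  case: p => m n ps; case: (eqVneq n 0) ps => [->|n0] ps.
    case: (leqP 4 `|m|) => m4; last first.
      (* The entries with |m| = 3 have cosine -1 and are bounded above by 0. *)
      have [->|->] : m = 3 \/ m = -3 by exact: absz_lt4.
        rewrite row0; apply: le_trans (_ : 0 <= _); last by rewrite mulr_ge0// decay_ge0.
        rewrite mulr_ge0_le0 ?expR_ge0//.
        by rewrite c3 lerN10.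
      rewrite row0; apply: le_trans (_ : 0 <= _); last by rewrite mulr_ge0// decay_ge0.
      rewrite mulr_ge0_le0 ?expR_ge0// cN.
      by rewrite c3 lerN10.
    rewrite row0; apply: le_trans (_ : expR (- (v * m%:~R ^+ 2)) <= _).
      by rewrite ger_pMr ?expR_gt0// cos_le1.
    apply: le_trans (_ : u ^+ 10 * decay R (m, 0) <= _); last first.
      by rewrite ler_wpM2r ?decay_ge0// lerDl exprn_ge0// ltW.
    rewrite /u /decay -expRM_natl -expRD ler_expR /=.
    have m4R : 4 <= `|m|%:~R :> R by exact: ler_absz m4.
    rewrite -(sqr_absz m).
    move: m4R; move: (`|m|%:~R : R) => a a4; rewrite normr0 addr0.
    have a2 : 0 <= a ^+ 2 - 10 by clear -a4; nra.
    have := ler_wpM2r a2 v58; clear -a4; nra.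
  apply: le_trans (_ : expR (- (t * quad_dual (s1, s2, s3) (n1%:R * m%:~R) (4 * n%:~R))) <= _).
    by rewrite /f /= ger_pMr ?expR_gt0// cos_le1.
  apply: le_trans (_ : h ^+ 7 * decay R (m, n) <= _); last first.
    by rewrite ler_wpM2r ?decay_ge0// lerDr exprn_ge0// ltW ?expR_gt0.
  rewrite /h /decay -expRM_natl -expRD ler_expR /=.
  have n1' : 1 <= `|n|%:~R :> R by apply: (@ler_absz 1); rewrite absz_gt0.
  apply: le_trans (_ : - (v / 2 * m%:~R ^+ 2 + 8 * (t * sg) * n%:~R ^+ 2) <= _); last first.
    rewrite -(sqr_absz m).
    rewrite -(sqr_absz n).
    move: n1'; move: (`|n|%:~R : R) => b b1; move: (`|m|%:~R : R) => a.
    (* Completing the square, as v / 2 >= 0.29; the 0.43 granted here is recovered in the bound for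
       b. *)
    have ha : 7 / 10 * a - 43 / 10 / 10 <= v / 2 * a ^+ 2.
      have := ler_wpM2r (sqr_ge0 a) v58; have := sqr_ge0 (29 * a - 35); clear; lra.
    have hb : 7 * (t * sg) + 43 / 10 / 10 + 7 / 10 * b <= 8 * (t * sg) * b ^+ 2.
      have bb : b <= b ^+ 2 by rewrite expr2 ler_peMl//; clear -b1; lra.
      have b2 : 0 <= b ^+ 2 - 1 by clear -b1 bb; lra.
      have := ler_wpM2r b2 tau28; clear -bb b1 tau28; lra.
    clear -ha hb; lra.
  rewrite lerN2 /quad_dual /=.
  have -> : v / 2 * m%:~R ^+ 2 = t * ((s2 + s3) / 4 * (n1%:R * m%:~R) ^+ 2).
    by rewrite /v /nu exprMn; clear; lra.
  have -> : 8 * (t * sg) * n%:~R ^+ 2 = t * (sg / 2 * (4 * n%:~R) ^+ 2) by clear; lra.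
  rewrite -mulrDr ler_pM2l//; set M := n1%:R * _; set N := 4 * _.
  have := sqr_ge0 N; have := sqr_ge0 (M + N); have := sqr_ge0 M; clear -s1g s32 s30 s20; nra.
have := hasum_le_seq (s := s) isT off (fun p => mulr_ge0 K0 (decay_ge0 R p)) hD (hasumZ K hG).
rewrite !big_cons big_nil !row0 !cN c1 c2 mulr0 cos0 rmorphN /= sqrrN.
have -> : (-2)%:~R = - 2 :> R by [].
rewrite sqrrN expr1n !expr0n /= !mulr0 oppr0 expR0 !mulr1 -/u.
have -> : expR (- (v * 2 ^+ 2)) = u ^+ 4 by rewrite -expRM_natl; congr expR; clear; lra.
have KG : K * G <= 9 * K by rewrite mulrC ler_wpM2r.
rewrite -/K; lra.
Qed.

End Averaging.

(** * Comparable dual vectors: the third point *)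

Section Thirds.
Variable R : realType.
Implicit Types (x y : R).

(** 4/9 = 1/2 - 1/18 is the value of 1/2 + x / 6 at x = -1/3. It has to exceed 5/14, the bound for S
    / p2 in [thirds_numeric]. *)
Lemma expR_ge_sqr x : - 1 / 3 <= x -> 1 + x + 4 / 9 * x ^+ 2 <= expR x.
Proof. by move=> hx; apply: le_trans (expR_ge3 x); have := sqr_ge0 x; nra. Qed.

Lemma expR_le_sqr x : x <= 1 -> expR x <= 1 + x + x ^+ 2.
Proof.
move=> x1; case: (lerP x 0) => x0.
  have := @expRN_le2 R (- x) ltac:(lra); rewrite opprK; have := sqr_ge0 x; lra.
have h := @expRN_ge3 R x (ltW x0); have e0 := expR_gt0 x; have ee := expRN x.
have d0 : 0 < 1 - x + x ^+ 2 / 2 - x ^+ 3 / 6 by nra.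
apply: le_trans (_ : (1 - x + x ^+ 2 / 2 - x ^+ 3 / 6)^-1 <= _).
  rewrite -[expR x]invrK -expRN lef_pV2 ?posrE//; exact: expR_gt0.
rewrite -div1r ler_pdivrMr// -subr_ge0.
have -> : (1 + x + x ^+ 2) * (1 - x + x ^+ 2 / 2 - x ^+ 3 / 6) - 1 =
  x ^+ 2 * (1 - x) * (x ^+ 2 - x + 3) / 6 by field.
have : 0 <= x ^+ 2 * (1 - x) by apply: mulr_ge0; [exact: sqr_ge0|lra].
have : 0 <= x ^+ 2 - x + 3 by nra.
by move=> h1 h2; rewrite divr_ge0// mulr_ge0.
Qed.

Lemma expR_le_quad x y : `|x| <= y -> expR x <= 1 + x + x ^+ 2 * expR y.
Proof.
rewrite ler_norml => /andP[xl xu]; have y0 : 0 <= y by lra.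
have ex := expR_ge1Dx x; have eNx := expR_ge1Dx (- x).
have e1 : expR x - 1 <= x * expR x.
  have := ler_wpM2l (expR_ge0 x) eNx; rewrite -expRD subrr expR0; lra.
have ey : 1 <= expR y by have := expR_ge1Dx y; lra.
have exy : expR x <= expR y by rewrite ler_expR.
have x2 := sqr_ge0 x.
case: (lerP 0 x) => x0.
  have := ler_wpM2l x0 e1; have := ler_wpM2l x2 exy; rewrite expr2 in x2 *; nra.
have nx : 0 <= - x by lra.
have e2 : x <= expR x - 1 by lra.
have := ler_wpM2l nx e2; have := ler_wpM2l x2 ey; rewrite !expr2; lra.
Qed.

(** The difference between t sg [hexN] and t [quad_dual]: x1, x2, x3 tell by how much the exponents
    of (1, 0), (0, 1), (1, -1) lie below the hexagonal one. *)
Definition xiform (x1 x2 x3 : R) (p : int * int) : R :=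
  x1 * (p.1%:~R * (p.1%:~R + p.2%:~R)) + x2 * (p.2%:~R * (p.1%:~R + p.2%:~R))
   - x3 * (p.1%:~R * p.2%:~R).

Lemma xiform_rot3 x1 x2 x3 p : xiform x1 x2 x3 (rot3 p) = xiform x2 x3 x1 p.
Proof. by rewrite /xiform /rot3 /= !(intrD, rmorphN) /=; ring. Qed.

Lemma xiform_sum x1 x2 x3 p :
  xiform x1 x2 x3 p + xiform x2 x3 x1 p + xiform x3 x1 x2 p = (x1 + x2 + x3) * (hexN p)%:~R.
Proof. by rewrite /xiform /hexN !(intrD, intrM, rmorphXn) /=; ring. Qed.

Lemma xiform1 u v w :
  ((xiform u v w (1, 0) = u) * (xiform u v w (-1, 0) = u) * (xiform u v w (0, 1) = v) *
   (xiform u v w (0, -1) = v) * (xiform u v w (1, -1) = w) * (xiform u v w (-1, 1) = w))%type.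
Proof. by rewrite /xiform /=; do !split; lra. Qed.

Lemma xiform3 u v w :
  ((xiform u v w (1, 1) = 2 * u + 2 * v - w) * (xiform u v w (-1, -1) = 2 * u + 2 * v - w) *
   (xiform u v w (1, -2) = 2 * v + 2 * w - u) * (xiform u v w (-1, 2) = 2 * v + 2 * w - u) *
   (xiform u v w (2, -1) = 2 * w + 2 * u - v) * (xiform u v w (-2, 1) = 2 * w + 2 * u - v))%type.
Proof. by rewrite /xiform /=; do !split; lra. Qed.

(* Cauchy-Schwarz: the three coefficients of [xiform] have sum of squares [N ^ 2] *)
Lemma xiform_sqr x1 x2 x3 p :
  xiform x1 x2 x3 p ^+ 2 <= (hexN p)%:~R ^+ 2 * (x1 ^+ 2 + x2 ^+ 2 + x3 ^+ 2).
Proof.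
rewrite -subr_ge0 /xiform /hexN !(intrD, intrM, rmorphXn) /=.
set m : R := _%:~R; set n : R := _%:~R.
pose a := m * (m + n); pose b := n * (m + n); pose c := - (m * n).
rewrite [X in 0 <= X](_ : _ = (x1 * b - x2 * a) ^+ 2 + (x2 * c - x3 * b) ^+ 2 + (x3 * a - x1 * c) ^+ 2).
  by rewrite !addr_ge0// sqr_ge0.
rewrite /a /b /c; ring.
Qed.

(** 5.6 = 3 * 2.8 - 4 * 0.7 is the exponent left over in the extreme case tau = 14/5, N = 4; the
    10.8 of [tail_mul] is the same balance, slightly rounded, at N = 9. *)
Lemma tail_nonmul (tau N : R) : 14 / 5 <= tau -> 4 <= N ->
  1 / (2 * tau) * N * expR (- (tau * N)) <= 7 / 10 / 10 / 10 * expR (- tau) * expR (- (7 / 10 * N)).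
Proof.
move=> ht hN; have e56 : expR (- (56 / 10)) <= 1 / 25 / 8 :> R.
  have -> : - (56 / 10) = 8%:R * - (7 / 10) :> R by lra.
  rewrite expRM_natl.
  apply: le_trans (_ : (1 / 2) ^+ 8 <= _); last by lra.
  apply: lerXn2r; rewrite ?nnegrE ?expR_ge0// div1r; apply: expR_le_inv => //.
  by apply: le_trans (expR_ge4 _); lra.
apply: le_trans (_ : 1 / (2 * tau) * (4 * expR ((N - 4) / 4)) * expR (- (tau * N)) <= _).
  rewrite ler_wpM2r ?expR_ge0// ler_wpM2l//; first by rewrite divr_ge0; lra.
  by have := expR_ge1Dx ((N - 4) / 4); lra.
have i0 : 1 / (2 * tau) <= 5 / 28 by rewrite ler_pdivrMr; lra.
apply: le_trans (_ : 5 / 28 * (4 * expR ((N - 4) / 4)) * expR (- (tau * N)) <= _).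
  by rewrite ler_wpM2r ?expR_ge0// ler_wpM2r// mulr_ge0// expR_ge0.
rewrite -[leLHS]mulrA -[4 * _ * _]mulrA -expRD -[leRHS]mulrA -expRD.
apply: le_trans (_ : 5 / 7 * (expR (- (56 / 10)) * expR (- tau + - (7 / 10 * N))) <= _).
  rewrite mulrA (_ : 5 / 28 * 4 = 5 / 7); last by lra.
  rewrite ler_pM2l; last by lra.
  rewrite -expRD ler_expR.
  have := ler_wpM2r (_ : 0 <= N - 1) ht; lra.
rewrite mulrA ler_wpM2r ?expR_ge0//; lra.
Qed.

Lemma tail_mul (tau N : R) : 14 / 5 <= tau -> 9 <= N ->
  3 * N ^+ 2 * expR (82 / 10 / 10 * N) * expR (- (tau * N)) <= 7 / 10 / 10 / 10 * expR (- tau) * expR (- (7 / 10 * (N - 3))).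
Proof.
move=> ht hN; have e108 : expR (- (27 * 4 / 10)) <= (1 / 25 / 8) ^+ 2 :> R.
  have -> : - (27 * 4 / 10) = 12%:R * - (9 / 10) :> R by lra.
  rewrite expRM_natl.
  apply: le_trans (_ : (20 / 49) ^+ 12 <= _); last by lra.
  apply: lerXn2r; [by rewrite nnegrE expR_ge0|by rewrite nnegrE; lra|].
  apply: le_trans (expR_le_inv _ (expR_ge4 _)) _; [lra|lra|].
  by rewrite invf_ple ?posrE; lra.
have N2 : N ^+ 2 <= 81 * expR (2%:R * ((N - 9) / 9)).
  rewrite expRM_natl; have := expR_ge1Dx ((N - 9) / 9); set e := expR _ => he.
  have : N <= 9 * e by lra.
  by move=> h; have := ler_pM _ _ h h; rewrite !expr2; lra.
apply: le_trans (_ : 3 * (81 * expR (2%:R * ((N - 9) / 9))) * expR (82 / 10 / 10 * N) * expR (- (tau * N)) <= _).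
  by rewrite !ler_wpM2r ?expR_ge0// ler_wpM2l.
rewrite [3 * (81 * _)]mulrA (_ : 3 * 81 = 27 * 9); last by lra.
rewrite -[leRHS]mulrA -expRD -[X in X * expR (- (tau * N))]mulrA -expRD -[leLHS]mulrA -expRD.
apply: le_trans (_ : 27 * 9 * (expR (- (27 * 4 / 10)) * expR (- tau + - (7 / 10 * (N - 3)))) <= _).
  rewrite ler_pM2l; last by lra.
  rewrite -expRD ler_expR.
  have := ler_wpM2r (_ : 0 <= N - 1) ht; lra.
rewrite mulrA ler_wpM2r ?expR_ge0//; lra.
Qed.


(** The normalisation makes S of second order, S <= 5/14 p2. Since 4/9 > 5/14, e is at least a
    positive multiple of p2; relative to h, the other terms carry the small factors h^2 and
    7/1000. *)
Lemma thirds_numeric (h e y tau p2 S G : R) : 0 < h -> h <= 6 / 10 / 10 -> 14 / 5 <= tau -> 0 < p2 ->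
  S * (2 * tau + S) = 2 * p2 -> 0 <= S -> 4 / 9 * p2 - S <= e -> y <= 9 * p2 - 3 * S -> G <= 9 ->
  - (3 * h * e) + 6 * h ^+ 3 * y + 7 / 10 / 10 / 10 * h * p2 * G < 0.
Proof.
move=> h0 h1 ht p0 hS S0 he hy hG.
have Sp : S <= 5 / 14 * p2 by nra.
have h2 : h ^+ 2 <= (6 / 10 / 10) ^+ 2 by rewrite ler_sqr ?nnegrE; lra.
have h20 := sqr_ge0 h.
have hy' : h ^+ 2 * y <= (6 / 10 / 10) ^+ 2 * (9 * p2).
  apply: le_trans (_ : h ^+ 2 * (9 * p2) <= _); first by rewrite ler_wpM2l//; lra.
  by rewrite ler_wpM2r//; lra.
have hG' : p2 * G <= p2 * 9 by rewrite ler_wpM2l// ltW.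
rewrite (_ : - _ + _ + _ = - (h * (3 * e - 6 * (h ^+ 2 * y) - 7 / 10 / 10 / 10 * (p2 * G)))); last by rewrite exprS; lra.
have h3 : 0 < 3 * e - 6 * (h ^+ 2 * y) - 7 / 10 / 10 / 10 * (p2 * G) by lra.
by rewrite oppr_lt0; exact: mulr_gt0 h0 h3.
Qed.

(** Both series are taken at the third point, and their difference is averaged over [rot3], which
    permutes x1, x2, x3. Where [chi3] is -1/2, the convexity of exp works for the claim, up to S;
    where it is 1, it works against it, but from norm 3 on only. *)
Lemma thirds_case (tau x1 x2 x3 D D0 : R) (S := - (x1 + x2 + x3)) (p2 := x1 ^+ 2 + x2 ^+ 2 + x3 ^+ 2) :
  14 / 5 <= tau -> expR (- tau) <= 6 / 10 / 10 -> S * (2 * tau + S) = 2 * p2 -> 0 <= S -> 0 < p2 ->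
  - 1 / 3 <= x1 <= 47 / 10 / 10 -> - 1 / 3 <= x2 <= 47 / 10 / 10 -> - 1 / 3 <= x3 <= 47 / 10 / 10 ->
  hasum (fun p : int * int => expR (- (tau * (hexN p)%:~R - xiform x1 x2 x3 p)) * chi3 R p) D ->
  hasum (fun p : int * int => expR (- (tau * (hexN p)%:~R)) * chi3 R p) D0 -> D < D0.
Proof.
move=> ht h06 hS S0 p20 hx1 hx2 hx3 hD hD0; set h := expR _ in h06.
have h0 : 0 < h by exact: expR_gt0.
have Sp : S <= 1 / tau * p2 by rewrite mulrC mulrA ler_pdivlMr; nra.
(* 0.82 exceeds 0.47 sqrt 3 and so bounds the Euclidean norm of (x1, x2, x3). *)
have p2le : p2 <= (82 / 10 / 10) ^+ 2 by rewrite /p2; nra.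
pose X1 p := xiform x1 x2 x3 p; pose X2 p := xiform x2 x3 x1 p; pose X3 p := xiform x3 x1 x2 p.
pose H p := expR (- (tau * (hexN p)%:~R)).
have H0 p : 0 < H p by exact: expR_gt0.
have hf := hasumB hD hD0; have := hasum_rot3 hf; set F := (fun p => _) => hF.
have FE p : F p = chi3 R p * (H p * (expR (X1 p) + expR (X2 p) + expR (X3 p) - 3)).
  rewrite /F !hexN_rot3 !chi3_rot3 !xiform_rot3 -/(H p) -/(X1 p) -/(X2 p) -/(X3 p).
  by rewrite !opprB !expRD -/(H p); ring.
have N0 p : 0 <= (hexN p)%:~R :> R by rewrite ler0z hexN_ge0.
have Xs p : X1 p + X2 p + X3 p = - (S * (hexN p)%:~R).
  by rewrite /X1 /X2 /X3 xiform_sum /S; ring.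
have Xb (u v w : R) p : u ^+ 2 + v ^+ 2 + w ^+ 2 = p2 ->
    xiform u v w p ^+ 2 <= (hexN p)%:~R ^+ 2 * p2 /\ `|xiform u v w p| <= 82 / 10 / 10 * (hexN p)%:~R.
  move=> e; have b1 := xiform_sqr u v w p; rewrite e in b1; split => //.
  rewrite -ler_sqr ?nnegrE ?mulr_ge0// real_normK ?num_real// exprMn mulrC.
  by apply: le_trans b1 _; rewrite ler_wpM2l ?sqr_ge0.
have Xb1 p : X1 p ^+ 2 <= (hexN p)%:~R ^+ 2 * p2 /\ `|X1 p| <= 82 / 10 / 10 * (hexN p)%:~R by apply: Xb.
have Xb2 p : X2 p ^+ 2 <= (hexN p)%:~R ^+ 2 * p2 /\ `|X2 p| <= 82 / 10 / 10 * (hexN p)%:~R by apply: Xb; rewrite /p2; ring.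
have Xb3 p : X3 p ^+ 2 <= (hexN p)%:~R ^+ 2 * p2 /\ `|X3 p| <= 82 / 10 / 10 * (hexN p)%:~R by apply: Xb; rewrite /p2; ring.
have [G hG G9] := hasum_decay R.
pose K := 7 / 10 / 10 / 10 * h * p2.
have K0 : 0 <= K by rewrite /K !mulr_ge0// ltW.
have off p : p \notin shell3 -> F p <= K * decay R p.
  move=> ps; have N4 := hexN_shell3 ps.
  have N4R : 4 <= (hexN p)%:~R :> R by rewrite (ler_int R 4).
  rewrite FE /chi3; case: ifPn => d3; last first.
    have n1R : `|p.1|%:~R + `|p.2|%:~R <= (hexN p)%:~R :> R by rewrite -intrD ler_int hexN_norm4.
    apply: le_trans (_ : 1 / (2 * tau) * (hexN p)%:~R * H p * p2 <= _).
      have e3 : - (S * (hexN p)%:~R) <= expR (X1 p) + expR (X2 p) + expR (X3 p) - 3.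
        rewrite -Xs; have := expR_ge1Dx (X1 p); have := expR_ge1Dx (X2 p); have := expR_ge1Dx (X3 p); clear; lra.
      have := ler_wpM2l (ltW (H0 p)) e3.
      have := ler_wpM2l (mulr_ge0 (ltW (H0 p)) (N0 p)) Sp.
      rewrite (_ : 1 / (2 * tau) = 1 / tau / 2); last by field; clear -ht; lra.
      by move: (1 / tau) => i; clear; lra.
    have := ler_wpM2r (ltW p20) (tail_nonmul ht N4R); rewrite -/(H p) -/h => tn.
    apply: le_trans tn _; rewrite /K /decay mulrAC ler_wpM2l// ler_expR; clear -n1R; lra.
  have N9 := hexN_mul3 d3 ps.
  have N9R : 9 <= (hexN p)%:~R :> R by rewrite (ler_int R 9).
  have n1R : `|p.1|%:~R + `|p.2|%:~R <= (hexN p)%:~R - 3 :> R.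
    by have := hexN_norm9 N9; rewrite -(ler_int R) intrB intrD.
  apply: le_trans (_ : 3 * (hexN p)%:~R ^+ 2 * expR (82 / 10 / 10 * (hexN p)%:~R) * H p * p2 <= _).
    rewrite mul1r [leRHS]mulrAC [leRHS]mulrC ler_pM2l//.
    have SN : 0 <= S * (hexN p)%:~R by rewrite mulr_ge0.
    have ee := expR_ge0 (82 / 10 / 10 * (hexN p)%:~R : R).
    have [a1 b1] := Xb1 p; have [a2 b2] := Xb2 p; have [a3 b3] := Xb3 p.
    have c1 := expR_le_quad b1; have c2 := expR_le_quad b2; have c3 := expR_le_quad b3.
    have d1 := ler_wpM2r ee a1; have d2 := ler_wpM2r ee a2; have d3' := ler_wpM2r ee a3.
    have := Xs p; clear -SN c1 c2 c3 d1 d2 d3'; lra.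
  have := ler_wpM2r (ltW p20) (tail_mul ht N9R); rewrite -/(H p) -/h => tn.
  apply: le_trans tn _; rewrite /K /decay mulrAC ler_wpM2l// ler_expR; clear -n1R; lra.
have := hasum_le_seq (s := shell3) isT off (fun p => mulr_ge0 K0 (decay_ge0 R p)) hF (hasumZ K hG).
pose e := expR x1 + expR x2 + expR x3 - 3.
pose y := expR (- 2 * S - 3 * x1) + expR (- 2 * S - 3 * x2) + expR (- 2 * S - 3 * x3) - 3.
have F0 : F (0, 0) = 0.
  by rewrite FE /X1 /X2 /X3 /xiform /= !mul0r !mulr0 oppr0 !addr0 expR0; ring.
have F1 p : p \in [:: (1, 0); (-1, 0); (0, 1); (0, -1); (1, -1); (-1, 1)] -> F p = - (h * e) / 2.
  move=> hp; rewrite FE.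
  have -> : H p = h.
    by move: hp; rewrite !inE => /or4P[/eqP->|/eqP->|/eqP->|/or3P[/eqP->|/eqP->|/eqP->]]; rewrite /H /h /hexN /= mulr1.
  have -> : chi3 R p = - 1 / 2.
    by move: hp; rewrite !inE => /or4P[/eqP->|/eqP->|/eqP->|/or3P[/eqP->|/eqP->|/eqP->]].
  suff -> : expR (X1 p) + expR (X2 p) + expR (X3 p) - 3 = e by clear; lra.
  rewrite /X1 /X2 /X3 /e.
  by move: hp; rewrite !inE => /or4P[/eqP->|/eqP->|/eqP->|/or3P[/eqP->|/eqP->|/eqP->]];
    rewrite !xiform1; clear; ring.
have F3 p : p \in [:: (1, 1); (-1, -1); (1, -2); (-1, 2); (2, -1); (-2, 1)] -> F p = h ^+ 3 * y.
  move=> hp; rewrite FE.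
  have -> : H p = h ^+ 3.
    rewrite -expRM_natl; move: hp; rewrite !inE.
    by move=> /or4P[/eqP->|/eqP->|/eqP->|/or3P[/eqP->|/eqP->|/eqP->]]; rewrite /H /hexN /=; congr expR; clear; lra.
  have -> : chi3 R p = 1.
    by move: hp; rewrite !inE => /or4P[/eqP->|/eqP->|/eqP->|/or3P[/eqP->|/eqP->|/eqP->]].
  rewrite mul1r; congr (_ * _).
  have E (u v w : R) : u + v + w = - S -> 2 * u + 2 * v - w = - 2 * S - 3 * w by clear; lra.
  have e1 := E x1 x2 x3 ltac:(rewrite /S; clear; ring).
  have e2 := E x2 x3 x1 ltac:(rewrite /S; clear; ring).
  have e3 := E x3 x1 x2 ltac:(rewrite /S; clear; ring).
  rewrite /y -e1 -e2 -e3 /X1 /X2 /X3.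
  by move: hp; rewrite !inE => /or4P[/eqP->|/eqP->|/eqP->|/or3P[/eqP->|/eqP->|/eqP->]];
    rewrite !xiform3; clear; ring.
rewrite !big_cons big_nil F0.
rewrite (F1 (1, 0) isT) (F1 (-1, 0) isT) (F1 (0, 1) isT) (F1 (0, -1) isT) (F1 (1, -1) isT) (F1 (-1, 1) isT).
rewrite (F3 (1, 1) isT) (F3 (-1, -1) isT) (F3 (1, -2) isT) (F3 (-1, 2) isT) (F3 (2, -1) isT) (F3 (-2, 1) isT).
have he : 4 / 9 * p2 - S <= e.
  have /andP[l1 _] := hx1; have /andP[l2 _] := hx2; have /andP[l3 _] := hx3.
  have h1 := expR_ge_sqr l1; have h2 := expR_ge_sqr l2; have h3 := expR_ge_sqr l3.
  rewrite /e /p2 /S; clear -h1 h2 h3; lra.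
have hy : y <= 9 * p2 - 3 * S.
  have le1 x : - 1 / 3 <= x <= 47 / 10 / 10 -> - 2 * S - 3 * x <= 1 by clear -S0; lra.
  have h1 := expR_le_sqr (le1 _ hx1); have h2 := expR_le_sqr (le1 _ hx2); have h3 := expR_le_sqr (le1 _ hx3).
  apply: le_trans (_ : (1 + (- 2 * S - 3 * x1) + (- 2 * S - 3 * x1) ^+ 2) +
    (1 + (- 2 * S - 3 * x2) + (- 2 * S - 3 * x2) ^+ 2) + (1 + (- 2 * S - 3 * x3) + (- 2 * S - 3 * x3) ^+ 2) - 3 <= _).
    by rewrite /y; move: h1 h2 h3; move: (expR _) (expR _) (expR _) => ? ? ? u1 u2 u3; clear -u1 u2 u3; lra.
  rewrite /p2 /S; clear; lra.
have num := thirds_numeric h0 h06 ht p20 hS S0 he hy G9.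
by move: num; rewrite -/K => num le; clear -num le; lra.
Qed.

End Thirds.

(** * A long dual vector: the half point *)

Definition halves : seq (int * int) :=
  [:: (0, 0); (1, 0); (-1, 0); (0, 1); (0, -1); (1, -1); (-1, 1); (1, 1); (-1, -1);
      (2, 0); (-2, 0); (0, 2); (0, -2); (2, -2); (-2, 2); (2, 2); (-2, -2)].

(** At the half point the indices with odd sum have cosine -1 and are dropped, apart from the four
    shortest; so the tail estimate concerns even sums. *)
Lemma even_notin_halves (m n k : int) : m + n = 2 * k -> (m, n) \notin halves ->
  10 <= m ^+ 2 + n ^+ 2.
Proof.
move=> e; apply: contraR => h.
have {}h : m ^+ 2 + n ^+ 2 <= 9 by lia.
have hm : -3 <= m <= 3 by nia.
have hn : -3 <= n <= 3 by nia.
have : m = -3 \/ m = -2 \/ m = -1 \/ m = 0 \/ m = 1 \/ m = 2 \/ m = 3 by lia.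
have : n = -3 \/ n = -2 \/ n = -1 \/ n = 0 \/ n = 1 \/ n = 2 \/ n = 3 by lia.
by move=> [|[|[|[|[|[|]]]]]] En [|[|[|[|[|[|]]]]]] Em; subst m n; first [exact: isT | exfalso; lia].
Qed.

Lemma int_parity (k : int) : exists j : int, k = 2 * j + (odd `|k|)%:Z.
Proof.
case: k => p; [exists (p./2)%:Z|exists (- (p.+2)./2%:Z)]; move: (odd_double_half p); rewrite -muln2 /=; lia.
Qed.

Section Halves.
Variable R : realType.
Implicit Types (x y : R).

Lemma cos_half (k : int) : cos (2 * pi * (k%:~R / 2)) = (if odd `|k| then - 1 else 1) :> R.
Proof.
have [j {1}->] := int_parity k; rewrite intrD intrM.
rewrite (_ : _ * _ = pi * (odd `|k|)%:R + 2 * pi * j%:~R); last by rewrite -!pmulrn; lra.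
by rewrite cosD2piZ; case: (odd _); rewrite ?mulr1 ?mulr0 ?cospi ?cos0.
Qed.

Lemma expR_pow4_le x : x <= 47 / 10 / 10 -> expR x ^+ 4 <= 7.
Proof.
move=> hx.
have ee : expR x <= 13 / 8.
  rewrite -[expR x]invrK -expRN invf_ple ?posrE ?expR_gt0//.
  apply: le_trans (_ : expR (- (47 / 10 / 10)) <= _); last by rewrite ler_expR; lra.
  by apply: le_trans (expRN_ge3 _); lra.
apply: le_trans (_ : (13 / 8) ^+ 4 <= _); last by lra.
by apply: lerXn2r; rewrite ?nnegrE ?expR_ge0//; lra.
Qed.

Lemma expR_half_le : expR (1 / 2) <= 7 / 4 :> R.
Proof.
rewrite -[expR _]invrK -expRN invf_ple ?posrE ?expR_gt0//.
by apply: le_trans (expRN_ge3 _); lra.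
Qed.

Lemma expRN1_le : expR (- 1) <= 10 / 27 :> R.
Proof.
apply: le_trans (expR_le_inv _ (expR_ge4 _)) _; [lra|lra|].
by rewrite invf_ple ?posrE; lra.
Qed.

Lemma expRN_three_halves_le : expR (- (3 / 2)) <= 23 / 10 / 10 :> R.
Proof.
apply: le_trans (expR_le_inv _ (expR_ge4 _)) _; [lra|lra|].
by rewrite invf_ple ?posrE; lra.
Qed.

(** The aim is to exceed 3/2, and 1.53 leaves room for the tail. Here b = - x3 is the excess of the
    exponent of (1, -1), and c the weight of (1, 1) relative to h: for b <= 1 it is small by its
    first bound, afterwards exp (- b) is small enough for both. *)
Lemma half_numeric (h tau x1 x2 b S : R) : 0 < h -> h <= 6 / 10 / 10 -> 14 / 5 <= tau ->
  1 / 3 <= b -> b <= tau -> x1 + x2 = b - S -> 0 <= S -> S * tau <= x1 ^+ 2 + x2 ^+ 2 + b ^+ 2 ->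
  - 4 / 5 <= x1 -> - 4 / 5 <= x2 -> 
  forall c, c <= h ^+ 2 * expR (3 * b) -> c <= expR (- b) ->
  17 * 9 / 10 / 10 <= expR x1 + expR x2 - expR (- b) - c.
Proof.
move=> h0 h1 ht b3 bt xs S0 hS hx1 hx2 c c1 c2.
have ex x : - 4 / 5 <= x -> 1 + x + 5 / 14 * x ^+ 2 <= expR x.
  by move=> hx; apply: le_trans (expR_ge3 x); have := sqr_ge0 x; nra.
have i0 : 0 < tau^-1 by rewrite invr_gt0; lra.
have i1 : tau^-1 <= 5 / 14 by rewrite invf_ple ?posrE; lra.
have Si : S <= tau^-1 * (x1 ^+ 2 + x2 ^+ 2 + b ^+ 2) by rewrite mulrC ler_pdivlMr//; lra.
have e2 : 2 + b - tau^-1 * b ^+ 2 <= expR x1 + expR x2.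
  have := ex _ hx1; have := ex _ hx2.
  have := ler_wpM2r (sqr_ge0 x1) i1; have := ler_wpM2r (sqr_ge0 x2) i1; lra.
have ib := ler_wpM2r (sqr_ge0 b) i1.
have mono a : a <= b -> expR (- b) <= expR (- a) by move=> ab; rewrite ler_expR lerN2.
case: (lerP b 1) => b1.
  have eb := @expRN_le2 R b ltac:(lra).
  have h2 : h ^+ 2 <= (6 / 10 / 10) ^+ 2 by rewrite ler_sqr ?nnegrE; lra.
  have cb a v : b <= a -> expR (3 * a) <= v -> c <= (6 / 10 / 10) ^+ 2 * v.
    move=> ba ev; apply: le_trans c1 _; apply: ler_pM => //; rewrite ?sqr_ge0 ?expR_ge0//.
    by apply: le_trans ev; rewrite ler_expR; lra.
  case: (lerP b (1 / 2)) => b2.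
    have c3 : c <= (6 / 10 / 10) ^+ 2 * 6.
      apply: cb b2 _; have -> : 3 * (1 / 2) = 3%:R * (1 / 2) :> R by [].
      rewrite expRM_natl; have e := expR_half_le.
      by apply: le_trans (_ : (7 / 4) ^+ 3 <= _); [apply: lerXn2r; rewrite ?nnegrE ?expR_ge0//; clear -e; lra|clear; lra].
    nra.
  have c3 : c <= (6 / 10 / 10) ^+ 2 * 36.
    apply: cb b1 _; have -> : 3 * 1 = 6%:R * (1 / 2) :> R by lra.
    rewrite expRM_natl; have e := expR_half_le.
    by apply: le_trans (_ : (7 / 4) ^+ 6 <= _); [apply: lerXn2r; rewrite ?nnegrE ?expR_ge0//; clear -e; lra|clear; lra].
  nra.
case: (lerP b (3 / 2)) => b2.
  have e1 := expRN1_le.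
  have := mono 1 (ltW b1); nra.
have e1 := expRN_three_halves_le.
have := mono _ (ltW b2).
have : tau^-1 * b ^+ 2 <= b.
  by rewrite mulrC ler_pdivrMr ?expr2; [rewrite ler_wpM2l//; lra|lra].
lra.
Qed.

(** D is about 1 - 2h (exp x1 + exp x2 - exp x3 - cc), the weight h cc belonging to (1, 1) and (-1,
    -1). The hypothesis on tau + 2 x3 + S says that s3 >= 0, that is, (1, 1) is at least as long as
    (1, -1); hence cc <= exp x3. *)
Lemma half_case (tau x1 x2 x3 D : R) (S := - (x1 + x2 + x3)) :
  14 / 5 <= tau -> expR (- tau) <= 6 / 10 / 10 -> 0 <= S -> S <= tau ->
  S * tau <= x1 ^+ 2 + x2 ^+ 2 + x3 ^+ 2 ->
  - 4 / 5 <= x1 <= 47 / 10 / 10 -> - 4 / 5 <= x2 <= 47 / 10 / 10 -> x3 <= - 1 / 3 -> 0 <= tau + 2 * x3 + S ->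
  (forall m n : R, (tau - 47 / 10 / 10) / 2 * (m ^+ 2 + n ^+ 2) <=
      tau * (m ^+ 2 + m * n + n ^+ 2) - (x1 * (m * (m + n)) + x2 * (n * (m + n)) - x3 * (m * n))) ->
  hasum (fun p : int * int => expR (- (tau * (hexN p)%:~R - xiform x1 x2 x3 p)) *
     cos (2 * pi * (p.1%:~R * (1 / 2) + p.2%:~R * (1 / 2)))) D ->
  D < 1 - 3 * expR (- tau).
Proof.
move=> ht h06 S0 St hS /andP[x1l x1u] /andP[x2l x2u] x3u hs3 hQ; set h := expR (- tau) in h06 *.
have h0 : 0 < h by exact: expR_gt0.
pose w (p : int * int) := expR (- (tau * (hexN p)%:~R - xiform x1 x2 x3 p)).
set f := (fun p => _) => hD.
have w0 p : 0 < w p by exact: expR_gt0.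
have fE p : f p = if odd `|(p.1 + p.2)%R| then - w p else w p.
  rewrite /f (_ : _ + _ = (p.1 + p.2)%:~R / 2); last by rewrite intrD; lra.
  by rewrite cos_half -/(w p); case: ifP; rewrite ?mulr1 ?mulrN1.
have [G hG G9] := hasum_decay R.
pose K := h ^+ 3.
have K0 : 0 <= K by rewrite /K exprn_ge0// ltW.
have off p : p \notin halves -> f p <= K * decay R p.
  move=> ps; rewrite fE; case: ifPn => [_|ev].
    by apply: le_trans (_ : 0 <= _); [rewrite oppr_le0 ltW|rewrite mulr_ge0// decay_ge0].
  have [k hk] : exists k, p.1 + p.2 = 2 * k.
    by have [k ->] := int_parity (p.1 + p.2); exists k; rewrite (negbTE ev) addr0.
  case: p ps hk {ev} => m n ps hk; have N10 := even_notin_halves hk ps.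
  have N10R : 10 <= `|m|%:~R ^+ 2 + `|n|%:~R ^+ 2 :> R.
    by rewrite !sqr_absz -!rmorphXn -intrD (ler_int R 10).
  rewrite /K /h /w /decay -expRM_natl -expRD ler_expR.
  have := hQ m%:~R n%:~R; rewrite -(sqr_absz R m) -(sqr_absz R n) !sqr_absz.
  rewrite (_ : (hexN (m, n))%:~R = m%:~R ^+ 2 + m%:~R * n%:~R + n%:~R ^+ 2); last first.
    by rewrite /hexN /= !(intrD, intrM, rmorphXn).
  rewrite /xiform /= -(sqr_absz R m) -(sqr_absz R n).
  move: N10R; set a : R := `|m|%:~R; set b : R := `|n|%:~R; set r := a ^+ 2 + b ^+ 2 => r10 q.
  have ab : (7 / 10) * (a + b) <= 157 / 10 / 10 / 10 * (r - 10) + 2 * 157 / 10 / 10.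
    have := sqr_ge0 (a - 9 / 4); have := sqr_ge0 (b - 9 / 4); rewrite /r in r10 *; nra.
  have := ler_wpM2r (_ : 0 <= r - 10) ht; lra.
have := hasum_le_seq (s := halves) isT off (fun p => mulr_ge0 K0 (decay_ge0 R p)) hD (hasumZ K hG).
have h4 : h ^+ 4 = expR (- (4 * tau)) by rewrite -expRM_natl; congr expR; clear; lra.
pose cc := expR (- (2 * tau) + (2 * x1 + 2 * x2 - x3)).
have odd1 p : p \in [:: (1, 0); (-1, 0); (0, 1); (0, -1)] -> f p = - w p.
  by move=> hp; rewrite fE; move: hp; rewrite !inE => /or4P[/eqP->|/eqP->|/eqP->|/eqP->].
have f1 : f (1, 0) = - (h * expR x1) by rewrite odd1// /w xiform1 /h -expRD /hexN /=; congr (- expR _); clear; lra.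
have f2 : f (-1, 0) = - (h * expR x1) by rewrite odd1// /w xiform1 /h -expRD /hexN /=; congr (- expR _); clear; lra.
have f3 : f (0, 1) = - (h * expR x2) by rewrite odd1// /w xiform1 /h -expRD /hexN /=; congr (- expR _); clear; lra.
have f4 : f (0, -1) = - (h * expR x2) by rewrite odd1// /w xiform1 /h -expRD /hexN /=; congr (- expR _); clear; lra.
have f5 : f (1, -1) = h * expR x3 by rewrite fE /= /w xiform1 /h -expRD /hexN /=; congr (expR _); clear; lra.
have f6 : f (-1, 1) = h * expR x3 by rewrite fE /= /w xiform1 /h -expRD /hexN /=; congr (expR _); clear; lra.
have f7 : f (1, 1) = h * cc by rewrite fE /= /w xiform3 /h -expRD /hexN /=; congr (expR _); clear; lra.
have f8 : f (-1, -1) = h * cc by rewrite fE /= /w xiform3 /h -expRD /hexN /=; congr (expR _); clear; lra.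
have f0 : f (0, 0) = 1 by rewrite fE /= /w /xiform /hexN /= !(mul0r, mulr0) !(addr0, subr0) oppr0 expR0.
have e188 (x : R) : x <= 47 / 10 / 10 -> expR (- (4 * tau) + 4 * x) <= 7 * h ^+ 4.
  move=> hx; rewrite expRD -h4 mulrC ler_wpM2r ?exprn_ge0//; first exact: ltW.
  by rewrite expRM_natl expR_pow4_le.
have g1 : f (2, 0) <= 7 * h ^+ 4.
  by apply: le_trans (e188 _ x1u); rewrite fE /= /w /xiform /hexN /= ler_expR; clear; lra.
have g2 : f (-2, 0) <= 7 * h ^+ 4.
  by apply: le_trans (e188 _ x1u); rewrite fE /= /w /xiform /hexN /= ler_expR; clear; lra.
have g3 : f (0, 2) <= 7 * h ^+ 4.
  by apply: le_trans (e188 _ x2u); rewrite fE /= /w /xiform /hexN /= ler_expR; clear; lra.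
have g4 : f (0, -2) <= 7 * h ^+ 4.
  by apply: le_trans (e188 _ x2u); rewrite fE /= /w /xiform /hexN /= ler_expR; clear; lra.
have g5 : f (2, -2) <= h ^+ 4 by rewrite h4 fE /= /w /xiform /hexN /= ler_expR; clear -x3u; lra.
have g6 : f (-2, 2) <= h ^+ 4 by rewrite h4 fE /= /w /xiform /hexN /= ler_expR; clear -x3u; lra.
have g7 : f (2, 2) <= h ^+ 4 by rewrite h4 fE /= /w /xiform /hexN /= ler_expR; move: hs3; rewrite /S; clear -x3u; lra.
have g8 : f (-2, -2) <= h ^+ 4 by rewrite h4 fE /= /w /xiform /hexN /= ler_expR; move: hs3; rewrite /S; clear -x3u; lra.
rewrite !big_cons big_nil f0 f1 f2 f3 f4 f5 f6 f7 f8 /K => le.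
have cc1 : cc <= h ^+ 2 * expR (3 * - x3).
  by rewrite /cc /h -expRM_natl -expRD ler_expR; move: S0; rewrite /S; clear; lra.
have cc2 : cc <= expR x3 by rewrite /cc ler_expR; move: hs3; rewrite /S; clear; lra.
have b3 : 1 / 3 <= - x3 by clear -x3u; lra.
have bt : - x3 <= tau by clear -hs3 St; lra.
have bS : x1 + x2 = - x3 + (x1 + x2 + x3) by clear; ring.
have := @half_numeric h tau x1 x2 (- x3) S h0 h06 ht.
rewrite !opprK sqrrN => /(_ _ _ _ S0 hS x1l x2l cc cc1 cc2) num.
have {num} := num b3 bt bS.
move: le g1 g2 g3 g4 g5 g6 g7 g8.
move: (f (2, 0)) (f (-2, 0)) (f (0, 2)) (f (0, -2)) (f (2, -2)) (f (-2, 2)) (f (2, 2)) (f (-2, -2)).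
move: (expR x1) (expR x2) (expR x3) cc {cc1 cc2 f1 f2 f3 f4 f5 f6 f7 f8 e188 h4 odd1}.
move=> e1 e2 e3 cc y1 y2 y3 y4 y5 y6 y7 y8 le g1 g2 g3 g4 g5 g6 g7 g8 num.
have h2 : h ^+ 2 <= (6 / 10 / 10) ^+ 2 by rewrite ler_sqr ?nnegrE; clear -h0 h06; lra.
have h3 : h ^+ 3 <= h * (6 / 10 / 10) ^+ 2 by rewrite exprS ler_pM2l.
have h4 : h ^+ 4 <= h ^+ 3 * (6 / 10 / 10) by rewrite [h ^+ 4]exprSr ler_wpM2l.
have hn : h * (17 * 9 / 10 / 10) <= h * (e1 + e2 - e3 - cc) by rewrite ler_pM2l.
have G3 : h ^+ 3 * G <= h ^+ 3 * 9 by rewrite ler_wpM2l.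
lra.
Qed.

End Halves.

(** * Assembling the three cases of the dual comparison *)

Section DualStrict.
Variable R : realType.
Implicit Types (x y : R).

Lemma hex_dual_ge (tau D0 : R) : 14 / 5 <= tau -> expR (- tau) <= 6 / 10 / 10 ->
  hasum (fun p : int * int => expR (- (tau * (hexN p)%:~R)) * chi3 R p) D0 ->
  1 - 3 * expR (- tau) <= D0.
Proof.
move=> ht h06; set h := expR _ in h06 *; set f := (fun p => _) => hD.
have h0 : 0 < h by exact: expR_gt0.
have [G hG G9] := hasum_decay R.
pose K := 9 * h ^+ 4.
have K0 : 0 <= K by rewrite /K mulr_ge0// exprn_ge0// ltW.
have off p : p \notin shell3 -> - (K * decay R p) <= f p.
  move=> ps; have N4 := hexN_shell3 ps; have n1 := hexN_norm4 N4.
  have N4R : 4 <= (hexN p)%:~R :> R by rewrite (ler_int R 4).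
  have n1R : `|p.1|%:~R + `|p.2|%:~R <= (hexN p)%:~R :> R by rewrite -intrD ler_int.
  have e0 := expR_ge0 (- (tau * (hexN p)%:~R)).
  apply: le_trans (_ : - (expR (- (tau * (hexN p)%:~R)) / 2) <= _); last first.
    by rewrite /f /chi3; case: ifP => _; lra.
  rewrite lerN2; apply: le_trans (_ : expR (28 / 10) / 2 * (h ^+ 4 * decay R p) <= _); last first.
    rewrite /K -[leRHS]mulrA ler_wpM2r//; last by have := expR28 R; lra.
    by rewrite mulr_ge0 ?decay_ge0// exprn_ge0// ltW.
  rewrite mulrAC ler_wpM2r// /h /decay -expRM_natl -!expRD ler_expR.
  have := ler_wpM2r (_ : 0 <= (hexN p)%:~R - 4 :> R) ht; lra.
have := hasum_ge_seq (s := shell3) isT off (fun p => mulr_ge0 K0 (decay_ge0 R p)) hD (hasumZ K hG).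
have f0 : f (0, 0) = 1 by rewrite /f /hexN /chi3 /= mulr0 oppr0 expR0 mulr1.
have f1 p : p \in [:: (1, 0); (-1, 0); (0, 1); (0, -1); (1, -1); (-1, 1)] -> f p = - h / 2.
  by rewrite !inE => /or4P[/eqP->|/eqP->|/eqP->|/or3P[/eqP->|/eqP->|/eqP->]];
    rewrite /f /hexN /chi3 /= mulr1 -/h; lra.
have f3 p : p \in [:: (1, 1); (-1, -1); (1, -2); (-1, 2); (2, -1); (-2, 1)] -> f p = h ^+ 3.
  have h3 : h ^+ 3 = expR (- (tau * 3)) by rewrite -expRM_natl; congr expR; clear; lra.
  by rewrite !inE => /or4P[/eqP->|/eqP->|/eqP->|/or3P[/eqP->|/eqP->|/eqP->]];
    rewrite /f /hexN /chi3 /= mulr1 h3.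
rewrite !big_cons big_nil f0.
rewrite (f1 (1, 0) isT) (f1 (-1, 0) isT) (f1 (0, 1) isT) (f1 (0, -1) isT) (f1 (1, -1) isT) (f1 (-1, 1) isT).
rewrite (f3 (1, 1) isT) (f3 (-1, -1) isT) (f3 (1, -2) isT) (f3 (-1, 2) isT) (f3 (2, -1) isT) (f3 (-2, 1) isT) => le.
have h4 : h ^+ 4 <= h ^+ 3 * (6 / 10 / 10) by rewrite [h ^+ 4]exprSr ler_wpM2l// exprn_ge0// ltW.
have KG : K * G <= K * 9 by rewrite ler_wpM2l.
have h30 : 0 <= h ^+ 3 by rewrite exprn_ge0// ltW.
move: KG le; rewrite /K; move: (h ^+ 3) (h ^+ 4) h4 h30 => *; lra.
Qed.

Lemma quad_dual_ge (s1 s2 s3 m n : R) : 0 <= s3 -> s3 <= s2 -> s2 <= s1 ->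
  (s2 + s3) / 4 * m ^+ 2 + s1 / 2 * n ^+ 2 <= quad_dual (s1, s2, s3) m n.
Proof.
move=> h1 h2 h3; rewrite /quad_dual /=.
have := mulr_ge0 h1 (sqr_ge0 (m + n)).
have : 0 <= (s2 - s3) * m ^+ 2 by rewrite mulr_ge0 ?sqr_ge0// subr_ge0.
lra.
Qed.

Lemma quad_dual_xi (t sg s1 s2 s3 m n : R) :
  t * quad_dual (s1, s2, s3) m n = t * sg * (m ^+ 2 + m * n + n ^+ 2) -
   (t * (sg - (s2 + s3) / 2) * (m * (m + n)) + t * (sg - (s1 + s3) / 2) * (n * (m + n))
     - t * (sg - (s1 + s2) / 2) * (m * n)).
Proof. by rewrite /quad_dual /=; lra. Qed.

Section Xi.
Variables (t sg s1 s2 s3 : R).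
Hypotheses (t0 : 0 < t) (sg0 : 0 < sg) (sgE : 3 * sg ^+ 2 = 4).
Hypotheses (s30 : 0 <= s3) (s32 : s3 <= s2) (s21 : s2 <= s1).
Hypothesis det : s1 * s2 + s2 * s3 + s3 * s1 = 4.
Let x1 := t * (sg - (s2 + s3) / 2).
Let x2 := t * (sg - (s1 + s3) / 2).
Let x3 := t * (sg - (s1 + s2) / 2).
Let S := - (x1 + x2 + x3).

(** Both normalisations, s1 s2 + s2 s3 + s3 s1 = 4 and 3 sg^2 = 4, combine to show that the sum of
    the x_i is of second order in them. *)
Lemma xi_norm : S * (2 * (t * sg) + S) = 2 * (x1 ^+ 2 + x2 ^+ 2 + x3 ^+ 2).
Proof.
have h1 := congr1 (fun z => t ^+ 2 * z) det; have h2 := congr1 (fun z => t ^+ 2 * z) sgE.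
by rewrite /S /x1 /x2 /x3; move: h1 h2 => /= h1 h2; lra.
Qed.

Lemma xi_sum_ge0 : 0 <= S.
Proof.
have d := det; have e := sgE; have t0' := t0; have g0 := sg0; have a1 := s30; have a2 := s32; have a3 := s21.
have h : 3 * sg <= s1 + s2 + s3.
  rewrite -ler_sqr ?nnegrE; [|lra|lra].
  have := sqr_ge0 (s1 - s2); have := sqr_ge0 (s2 - s3); have := sqr_ge0 (s3 - s1); lra.
have -> : S = t * (s1 + s2 + s3 - 3 * sg) by rewrite /S /x1 /x2 /x3; lra.
by apply: mulr_ge0; lra.
Qed.

(** x1 <= 0.47 and t sg >= 2.8 force s2 + s3 >= 1.66 sg; as s1 (s2 + s3) <= 3 sg^2, s1 cannot be
    large. *)
Lemma xi_bounds : 14 / 5 <= t * sg -> x1 <= 47 / 10 / 10 -> S <= t * sg /\ - 4 / 5 <= x2.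
Proof.
move=> ht; rewrite /S /x1 /x2 /x3 => hx1.
have d := det; have e := sgE; have t0' := t0; have g0 := sg0; have a1 := s30; have a2 := s32; have a3 := s21.
pose w := s2 + s3.
have w1 : 2 * 83 / 10 / 10 * sg <= w.
  by rewrite -(ler_pM2l t0) /w; lra.
have w0 : 0 < w by lra.
have s1w : s1 * w + s2 * s3 = 3 * sg ^+ 2 by rewrite /w; lra.
have s23 : 0 <= s2 * s3 by apply: mulr_ge0; lra.
have w3 : w <= 3 * sg.
  rewrite -ler_sqr ?nnegrE; [|lra|lra].
  have := ler_wpM2r (ltW w0) (_ : w / 2 <= s1); rewrite /w in w0 *; nra.
split.
  have h : s1 + w <= 4 * sg.
    rewrite -(ler_pM2r w0).
    have := mulr_ge0 (_ : 0 <= w - sg) (_ : 0 <= 3 * sg - w); lra.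
  have := ler_wpM2l (ltW t0) h; rewrite /w; lra.
have h : t * (s1 + s3 - 2 * sg) <= 8 / 5.
  rewrite -(ler_pM2r w0).
  have h1 : (s1 + s3 - 2 * sg) * w <= (2 * sg - w) * (6 * sg - w) / 4.
    have := sqr_ge0 (s2 - s3); rewrite /w in s1w *; nra.
  apply: le_trans (_ : t * ((2 * sg - w) * (6 * sg - w) / 4) <= _).
    by rewrite -[leLHS]mulrA ler_wpM2l// ltW.
  rewrite mulrA mulrA; have : t * (2 * sg - w) <= 94 / 10 / 10 by rewrite /w; lra.
  move: (t * (2 * sg - w)) => u hu; have := ler_wpM2r (_ : 0 <= 6 * sg - w) hu; lra.
lra.
Qed.

End Xi.

(** Stated as the impossibility of a lower bound D0 at all points, because the averaging of
    [thin_case] does not exhibit its point. In the first two cases D0 enters through D0 >= 1 - 3h,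
    in the last one by a direct comparison of series. *)
Lemma dual_strict (t sg s1 s2 s3 D0 : R) : 0 < t -> 0 < sg -> 3 * sg ^+ 2 = 4 ->
  selling (s1, s2, s3) -> s3 <= s2 -> s2 <= s1 ->
  14 / 5 <= t * sg -> expR (- (t * sg)) <= 6 / 10 / 10 -> (s1, s2, s3) <> (sg, sg, sg) ->
  hasum (fun p : int * int => expR (- (t * quad_dual (sg, sg, sg) p.1%:~R p.2%:~R)) * chi3 R p) D0 ->
  ~ (forall x y, exists2 D, hasum (fun p : int * int =>
     expR (- (t * quad_dual (s1, s2, s3) p.1%:~R p.2%:~R)) *
     cos (2 * pi * (p.1%:~R * x + p.2%:~R * y))) D & D0 <= D).
Proof.
move=> t0 sg0 sgE sel s32 s21 ht h06 neq hD0 H.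
have [/= s10 s20 s30 det] := sel.
have {}hD0 : hasum (fun p : int * int => expR (- (t * sg * (hexN p)%:~R)) * chi3 R p) D0.
  apply: eq_hasum hD0 => p; congr (expR _ * _).
  by rewrite /quad_dual /hexN /= !(intrD, intrM, rmorphXn) /=; lra.
have D0ge := hex_dual_ge ht h06 hD0.
pose x1 := t * (sg - (s2 + s3) / 2); pose x2 := t * (sg - (s1 + s3) / 2).
pose x3 := t * (sg - (s1 + s2) / 2).
have qE (p : int * int) : t * quad_dual (s1, s2, s3) p.1%:~R p.2%:~R = t * sg * (hexN p)%:~R - xiform x1 x2 x3 p.
  by rewrite (quad_dual_xi t sg) /xiform /hexN !(intrD, intrM, rmorphXn) /=.
have x12 : x2 <= x1 by rewrite /x1 /x2 ler_pM2l//; lra.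
have x23 : x3 <= x2 by rewrite /x2 /x3 ler_pM2l//; lra.
have hS := xi_norm t sgE det; have S0 := xi_sum_ge0 t0 sg0 sgE s30 s32 s21 det.
rewrite -/x1 -/x2 -/x3 in hS S0.
case: (lerP (t * ((s2 + s3) / 2)) (t * sg - 47 / 10 / 10)) => thin.
  by have := thin_case t0 sg0 sgE sel s32 s21 ht h06 thin H; lra.
have x1u : x1 <= 47 / 10 / 10 by rewrite /x1; lra.
have [St x2l] := xi_bounds t0 sg0 sgE s30 s32 s21 det ht x1u; rewrite -/x1 -/x2 -/x3 in St x2l.
case: (lerP x3 (- 1 / 3)) => hx3.
  have [D hD DD] := H (1 / 2) (1 / 2).
  have {}hD := eq_hasum (fun p => congr1 (fun z => expR (- z) * _) (qE p)) hD.
  have hs3 : 0 <= t * sg + 2 * x3 - (x1 + x2 + x3).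
    have -> : t * sg + 2 * x3 - (x1 + x2 + x3) = t * s3 by rewrite /x1 /x2 /x3; clear; lra.
    by rewrite mulr_ge0// ltW.
  have hSt : - (x1 + x2 + x3) * (t * sg) <= x1 ^+ 2 + x2 ^+ 2 + x3 ^+ 2.
    by have := sqr_ge0 (x1 + x2 + x3); clear -hS; lra.
  have hQ (m n : R) : (t * sg - 47 / 10 / 10) / 2 * (m ^+ 2 + n ^+ 2) <=
      t * sg * (m ^+ 2 + m * n + n ^+ 2) - (x1 * (m * (m + n)) + x2 * (n * (m + n)) - x3 * (m * n)).
    rewrite -quad_dual_xi; have := ler_wpM2l (ltW t0) (quad_dual_ge m n s30 s32 s21).
    have h1 := ler_wpM2r (sqr_ge0 m) (ltW thin).
    have s1g : t * sg <= t * s1 by rewrite ler_pM2l//; nra.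
    have := ler_wpM2r (sqr_ge0 n) s1g; have := sqr_ge0 n; clear -h1; lra.
  have b1 : - 4 / 5 <= x1 <= 47 / 10 / 10 by apply/andP; split; clear -x1u x12 x2l; lra.
  have b2 : - 4 / 5 <= x2 <= 47 / 10 / 10 by apply/andP; split; clear -x1u x12 x2l; lra.
  by have := half_case ht h06 S0 St hSt b1 b2 hx3 hs3 hQ hD; clear -D0ge DD; lra.
have [D hD DD] := H (1 / 3) (- 1 / 3).
have {}hD := eq_hasum (fun p => congr1 (fun z => expR (- z) * _) (qE p)) hD.
have {}hD := eq_hasum (fun p => congr1 (fun z => _ * z) (cos_chi3 R p)) hD.
have p20 : 0 < x1 ^+ 2 + x2 ^+ 2 + x3 ^+ 2.
  rewrite lt0r !addr_ge0 ?sqr_ge0// andbT; apply/eqP => e; apply: neq.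
  have z1 := sqr_ge0 x1; have z2 := sqr_ge0 x2; have z3 := sqr_ge0 x3.
  have y1 : x1 = 0 by apply/eqP; rewrite -sqrf_eq0 eq_le sqr_ge0 andbT; clear -e z1 z2 z3; lra.
  have y2 : x2 = 0 by apply/eqP; rewrite -sqrf_eq0 eq_le sqr_ge0 andbT; clear -e z1 z2 z3; lra.
  have y3 : x3 = 0 by apply/eqP; rewrite -sqrf_eq0 eq_le sqr_ge0 andbT; clear -e z1 z2 z3; lra.
  have cz u : t * u = 0 -> u = 0 by move/eqP; rewrite mulf_eq0 gt_eqF//= => /eqP.
  move: y1 y2 y3 => /cz y1 /cz y2 /cz y3.
  by congr (_, _, _); clear -y1 y2 y3; lra.
have b1 : - 1 / 3 <= x1 <= 47 / 10 / 10 by apply/andP; split; clear -x1u x12 x23 hx3; lra.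
have b2 : - 1 / 3 <= x2 <= 47 / 10 / 10 by apply/andP; split; clear -x1u x12 x23 hx3; lra.
have b3 : - 1 / 3 <= x3 <= 47 / 10 / 10 by apply/andP; split; clear -x1u x12 x23 hx3; lra.
by have := thirds_case ht h06 hS S0 p20 b1 b2 b3 hD hD0; clear -DD; lra.
Qed.

End DualStrict.

(** * The direct series ([c >= 4]) *)

(** Indices are integer triples of sum 1, the barycentric coordinates with respect to the triangle,
    with the third one left implicit; this is their cyclic rotation. *)
Definition tri_rot (p : int * int) : int * int := (p.2, 1 - p.1 - p.2).

(* twice the sum of the triangular numbers of the three coordinates *)
Definition tri2 (p : int * int) : int := p.1 ^+ 2 + p.2 ^+ 2 + (1 - p.1 - p.2) ^+ 2 - 1.

Definition tri_seq3 : seq (int * int) := [:: (1, 0); (0, 1); (0, 0)].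
Definition tri_seq6 : seq (int * int) := tri_seq3 ++ [:: (1, 1); (1, -1); (-1, 1)].
Definition tri_seq12 : seq (int * int) := tri_seq6 ++
  [:: (0, -1); (-1, 0); (-1, 2); (2, -1); (0, 2); (2, 0)].

Lemma tri2_norm p : 2 * (`|p.1| + `|p.2|) <= tri2 p + 3.
Proof.
case: p => i j; rewrite /tri2 /=.
have := sqr_ge0 (`|i| - 1); have := sqr_ge0 (`|j| - 1); have := sqr_ge0 (1 - i - j).
rewrite !sqrrB1 !real_normK ?num_real//; move: (`|i|) (`|j|) (i ^+ 2) (j ^+ 2) => *; lia.
Qed.

(** Values below 8 confine both coordinates to [-2, 2], where claims are decided by computation. *)
Lemma tri2_small p (P : int * int -> bool) :
  all (fun i : int => all (fun j : int => P (i, j)) [:: -2; -1; 0; 1; 2]) [:: -2; -1; 0; 1; 2] ->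
  tri2 p < 8 -> P p.
Proof.
case: p => i j /allP h t8.
have hk := sqr_ge0 (1 - i - j); have hi := sqr_ge0 i; have hj := sqr_ge0 j.
have t8' : i ^+ 2 + j ^+ 2 + (1 - i - j) ^+ 2 <= 8 by move: t8; rewrite /tri2 /=; lia.
have ui : -2 <= i <= 2 by nia.
have uj : -2 <= j <= 2 by nia.
have ii : i \in [:: -2; -1; 0; 1; 2 : int] by rewrite !inE; lia.
have jj : j \in [:: -2; -1; 0; 1; 2 : int] by rewrite !inE; lia.
exact: (allP (h _ ii) _ jj).
Qed.

Lemma tri2_ge4 p : p \notin tri_seq6 -> 4 <= tri2 p.
Proof.
case: (ltP (tri2 p) 8) => [t8|]; last by lia.
exact/implyP/(tri2_small (P := fun p => (p \notin tri_seq6) ==> (4 <= tri2 p))).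
Qed.

Lemma tri2_ge8 p : p \notin tri_seq12 -> 8 <= tri2 p.
Proof.
case: (ltP (tri2 p) 8) => [t8|]; last by lia.
by move=> ps; have := tri2_small (P := fun p => (p \in tri_seq12) || (8 <= tri2 p)) isT t8; rewrite (negbTE ps) /= leNgt t8.
Qed.

Lemma tri2_ge0 p : 0 <= tri2 p.
Proof.
case: (ltP (tri2 p) 8) => [t8|]; last by lia.
exact: (tri2_small (P := fun p => 0 <= tri2 p)).
Qed.

Section Tri.
Variable R : realType.
Implicit Types (x y c G : R).

Definition ctr x : R := x * (x - 1) / 2.

(** [quad] measured from the circumcentre, less the squared circumradius ([quad_circ]); it vanishes
    at the three vertices, the indices in [tri_seq3]. *)
Definition tri (s : R * R * R) (p : int * int) : R :=
  s.1.1 * ctr p.1%:~R + s.1.2 * ctr p.2%:~R + s.2 * ctr (1 - p.1%:~R - p.2%:~R).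

(** The squared circumradius, as the product of the squared sides over 16 area^2: the squared sides
    are (s1 + s2)/2, (s2 + s3)/2, (s3 + s1)/2 and the area is 1/2. *)
Definition circ2 (s : R * R * R) : R := (s.1.1 + s.1.2) * (s.1.2 + s.2) * (s.2 + s.1.1) / 32.

Lemma ctr_ge0 (i : int) : 0 <= ctr i%:~R.
Proof.
have : 0 <= i * (i - 1) by nia.
by rewrite -(ler_int R) intrM intrB /ctr => h; rewrite divr_ge0.
Qed.

Lemma triE a p : tri (a, a, a) p = a * ((tri2 p)%:~R / 2).
Proof. by rewrite /tri /tri2 /ctr /= !(intrD, rmorphN, rmorphXn, rmorphB) /=; lra. Qed.

Lemma hasum_tri_rot (f : int * int -> R) l : hasum f l ->
  hasum (fun p => f p + f (tri_rot p) + f (tri_rot (tri_rot p))) (3 * l).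
Proof.
have K1 : cancel tri_rot (fun p => (1 - p.1 - p.2, p.1)).
  by move=> [m n] /=; congr (_, _); ring.
have K2 : cancel (fun p => (1 - p.1 - p.2, p.1)) tri_rot.
  by move=> [m n] /=; rewrite /tri_rot /=; congr (_, _); ring.
move=> fl; have f1 := hasum_bij K1 K2 fl; have f2 := hasum_bij K1 K2 f1.
have := hasumD (hasumD fl f1) f2; rewrite (_ : l + l + l = 3 * l) //; ring.
Qed.

Lemma tri2_rot p : tri2 (tri_rot p) = tri2 p.
Proof. by case: p => i j; rewrite /tri2 /tri_rot /=; ring. Qed.

Lemma quad_circ s1 s2 s3 (k l : int) : s1 * s2 + s2 * s3 + s3 * s1 = 4 ->
  quad (s1, s2, s3) (k%:~R - s1 * (s2 + s3) / 8) (l%:~R + s2 * (s1 + s3) / 8) =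
  circ2 (s1, s2, s3) + tri (s1, s2, s3) (k, - l).
Proof.
move=> det.
have -> : s1 * (s2 + s3) / 8 = (4 - s2 * s3) / 8 by lra.
have -> : s2 * (s1 + s3) / 8 = (4 - s1 * s3) / 8 by lra.
have d1 : (s1 * s2 + s2 * s3 + s3 * s1) * (s1 + s2 + s3) = 4 * (s1 + s2 + s3) by rewrite det.
have d3 : (s1 * s2 + s2 * s3 + s3 * s1) * (s1 * s2 * s3) = 4 * (s1 * s2 * s3) by rewrite det.
rewrite /quad /tri /circ2 /ctr /= rmorphN /=.
have dk : (s1 * s2 + s2 * s3 + s3 * s1) * s3 * k%:~R = 4 * s3 * k%:~R by rewrite det.
have dl : (s1 * s2 + s2 * s3 + s3 * s1) * s3 * l%:~R = 4 * s3 * l%:~R by rewrite det.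
move: (k%:~R : R) (l%:~R : R) dk dl => u v dk dl.
have -> : u - (4 - s2 * s3) / 8 - (v + (4 - s1 * s3) / 8) = u - v - (4 + s1 * s2) / 8 by lra.
lra.
Qed.

(** 23/5 is just below 4 sg. Three terms equal 1, three are below 0.011, and the tail fits into the
    rest of 3.06, the constant on which [hex_base] and [hex_second] are built. *)
Lemma tri_hex_le G T : 23 / 5 <= G ->
  hasum (fun p => expR (- (G * ((tri2 p)%:~R / 2)))) T -> T <= 18 * 17 / 10 / 10.
Proof.
move=> hG; set f := (fun p => _) => hT.
have e1 : expR (- 1) <= 3 / 8 :> R.
  apply: le_trans (expR_le_inv _ (expR_ge3 _)) _; first by lra.
  by rewrite invf_ple ?posrE; lra.
have e23 : expR (- (23 / 5)) <= 11 / 10 / 10 / 10 :> R.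
  have -> : - (23 / 5) = 4%:R * - (23 / 20) :> R by lra.
  rewrite expRM_natl; apply: le_trans (_ : (32 / 10 / 10) ^+ 4 <= _); last by lra.
  apply: lerXn2r; [by rewrite nnegrE expR_ge0|by rewrite nnegrE; lra|].
  apply: le_trans (expR_le_inv _ (expR_ge4 _)) _; [lra|lra|].
  by rewrite invf_ple ?posrE; lra.
have [D hD D9] := hasum_decay R.
pose K := (3 / 8) ^+ 6 : R.
have K0 : 0 <= K by rewrite /K; lra.
(* 6.75 = 2 * 4.6 - 0.7 * 7/2: the exponent at [tri2 p] = 4 less the [decay] rate there. *)
have e67 : expR (- (27 * 25 / 10 / 10)) <= K.
  apply: le_trans (_ : expR (- 1) ^+ 6 <= _).
    by rewrite -expRM_natl ler_expR; lra.
  by apply: lerXn2r; [rewrite nnegrE expR_ge0|rewrite nnegrE; lra|].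
have off p : p \notin tri_seq6 -> f p <= K * decay R p.
  move=> ps; have t4 := tri2_ge4 ps; have tn := tri2_norm p.
  have t4R : 4 <= (tri2 p)%:~R :> R by rewrite (ler_int R 4).
  have tnR : 2 * (`|p.1|%:~R + `|p.2|%:~R) <= (tri2 p)%:~R + 3 :> R.
    by move: tn; rewrite -(ler_int R) !(intrD, intrM).
  apply: le_trans (_ : expR (- (27 * 25 / 10 / 10)) * decay R p <= _); last by rewrite ler_wpM2r ?decay_ge0.
  rewrite /f /decay -expRD ler_expR.
  have := ler_wpM2r (_ : 0 <= (tri2 p)%:~R - 4 :> R) hG; lra.
have := hasum_le_seq (s := tri_seq6) isT off (fun p => mulr_ge0 K0 (decay_ge0 R p)) hT (hasumZ K hD).
have f1 p : p \in tri_seq3 -> f p = 1.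
  by rewrite !inE => /or3P[] /eqP->; rewrite /f /tri2 /= mul0r mulr0 oppr0 expR0.
have f2 p : p \in [:: (1, 1); (1, -1); (-1, 1)] -> f p <= 11 / 10 / 10 / 10.
  move=> hp; apply: le_trans e23; rewrite /f ler_expR.
  have -> : (tri2 p)%:~R = 2 :> R by move: hp; rewrite !inE => /or3P[] /eqP->.
  lra.
rewrite !big_cons big_nil (f1 (1, 0) isT) (f1 (0, 1) isT) (f1 (0, 0) isT).
have := f2 (1, 1) isT; have := f2 (1, -1) isT; have := f2 (-1, 1) isT.
have KD : K * D <= K * 9 by rewrite ler_wpM2l.
move: KD; rewrite {2}/K; move: (f _) (f _) (f _) => *; lra.
Qed.

(* AM-GM over the three rotations of each index triple, except for the triples nearest to [z]. *)
Lemma hex_rotation G (h1 h2 h3 T L : R) : 0 <= G -> h1 + h2 + h3 = 0 ->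
  hasum (fun p => expR (- (G * ((tri2 p)%:~R / 2)))) T ->
  hasum (fun p : int * int => expR (- (G * ((tri2 p)%:~R / 2))) *
    expR (G * (p.1%:~R * h1 + p.2%:~R * h2 + (1 - p.1%:~R - p.2%:~R) * h3))) L ->
  T - 3 + (expR (G * h1) + expR (G * h2) + expR (G * h3)) <= L.
Proof.
move=> G0 hs hT hL; have hF := hasumB (hasum_tri_rot hL) (hasumZ 3 hT).
set F := (fun p => _) in hF.
pose X (a b c : R) (p : int * int) := G * (p.1%:~R * a + p.2%:~R * b + (1 - p.1%:~R - p.2%:~R) * c).
have FE p : F p = expR (- (G * ((tri2 p)%:~R / 2))) *
   (expR (X h1 h2 h3 p) + expR (X h3 h1 h2 p) + expR (X h2 h3 h1 p) - 3).
  have r1 : G * ((tri_rot p).1%:~R * h1 + (tri_rot p).2%:~R * h2 +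
      (1 - (tri_rot p).1%:~R - (tri_rot p).2%:~R) * h3) = X h3 h1 h2 p.
    by rewrite /X /tri_rot /= !(intrD, rmorphN) /=; ring.
  have r2 : G * ((tri_rot (tri_rot p)).1%:~R * h1 + (tri_rot (tri_rot p)).2%:~R * h2 +
      (1 - (tri_rot (tri_rot p)).1%:~R - (tri_rot (tri_rot p)).2%:~R) * h3) = X h2 h3 h1 p.
    by rewrite /X /tri_rot /= !(intrD, rmorphN) /=; ring.
  by rewrite /F r1 r2 !tri2_rot -/(X h1 h2 h3 p); ring.
have F0 p : 0 <= F p.
  rewrite FE; apply: mulr_ge0; first exact: expR_ge0.
  have : X h1 h2 h3 p + X h3 h1 h2 p + X h2 h3 h1 p = G * (h1 + h2 + h3) by rewrite /X; ring.
  rewrite hs mulr0; have := expR_ge1Dx (X h1 h2 h3 p); have := expR_ge1Dx (X h2 h3 h1 p).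
  by have := expR_ge1Dx (X h3 h1 h2 p); lra.
have := hasum_ge_seq (s := tri_seq3) isT (g := fun=> 0) _ (fun=> lexx 0) hF.
have z : hasum (fun _ : int * int => 0 : R) 0.
  by have := hasumZ 0 hT; rewrite mul0r; apply: eq_hasum => p; rewrite mul0r.
move=> /(_ 0 _ z); rewrite !big_cons big_nil subr0.
have E p : p \in tri_seq3 -> F p = expR (G * h1) + expR (G * h2) + expR (G * h3) - 3.
  rewrite FE !inE => /or3P[] /eqP->; rewrite /tri2 /X /= mul0r mulr0 oppr0 expR0 mul1r.
  - by rewrite !(mul1r, mul0r, addr0, subr0, subrr); ring.
  - by rewrite !(mul1r, mul0r, addr0, add0r, subr0, subrr); ring.
  - by rewrite !(mul1r, mul0r, addr0, add0r, subr0, subrr); ring.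
rewrite (E (1, 0) isT) (E (0, 1) isT) (E (0, 0) isT) => le.
have off i : i \notin tri_seq3 -> - 0 <= F i by move=> _; rewrite oppr0.
by have := le off; lra.
Qed.

End Tri.

(** * Elementary inequalities around the hexagonal deep hole *)

Section HexNumeric.
Variable R : realType.
Implicit Types (x y n u w g : R).

Lemma expR_le_of x y : 0 < y -> y * (1 - x + x ^+ 2 / 2 - x ^+ 3 / 6) >= 1 -> 0 <= x -> expR x <= y.
Proof.
move=> y0 h x0; rewrite -[expR x]invrK -expRN invf_ple ?posrE ?expR_gt0//.
apply: le_trans (expRN_ge3 x0); rewrite -div1r ler_pdivrMr// mulrC; exact: h.
Qed.

Lemma expR_le_small u : 0 <= u -> u <= 2 / 5 -> expR u <= 1 + u + 3 / 5 * u ^+ 2.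
Proof.
move=> u0 u1; apply: expR_le_of => //; first by have := sqr_ge0 u; lra.
rewrite -subr_ge0.
rewrite [X in 0 <= X](_ : _ = u ^+ 2 * (1 / 10 - 4 / 15 * u + 2 / 15 * u ^+ 2 - 1 / 10 * u ^+ 3)); last by field.
by apply: mulr_ge0; [exact: sqr_ge0|nra].
Qed.

Lemma expR_le_mid w : 0 <= w -> w <= 87 / 10 / 10 -> expR w <= 1 + w + 17 / 20 * w ^+ 2.
Proof.
move=> u0 u1; apply: expR_le_of => //; first by have := sqr_ge0 w; lra.
rewrite -subr_ge0.
rewrite [X in 0 <= X](_ : _ = w ^+ 2 * (7 / 20 - 31 / 60 * w + 31 / 30 / 4 * w ^+ 2 - 17 / 30 / 4 * w ^+ 3)); last by field.
by apply: mulr_ge0; [exact: sqr_ge0|nra].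
Qed.

Lemma sextic_ge0 (z : R) : 2 * 73 / 10 / 10 <= z -> 0 <= 2 * z ^+ 6 - 18 * 17 / 10 / 10 * z ^+ 5 + 6 / 10 / 10 * z ^+ 4 + 1.
Proof.
move=> hz; pose a := z - 2 * 73 / 10 / 10; have a0 : 0 <= a by rewrite /a; lra.
have -> : z = a + 2 * 73 / 10 / 10 by rewrite /a; lra.
have a2 := exprn_ge0 2 a0; have a3 := exprn_ge0 3 a0; have a4 := exprn_ge0 4 a0.
have a5 := exprn_ge0 5 a0; have a6 := exprn_ge0 6 a0.
lra.
Qed.

(** Displacement along an altitude of the triangle. Up to n = 0.765 Taylor bounds suffice; beyond
    it, u <= n / 2 and z = exp (n / 2) >= 1.46 reduce the claim to [sextic_ge0]. *)
Lemma hex_base n u : 0 <= n -> u <= n / 2 -> u <= 15 / 23 * n ^+ 2 ->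
  18 * 17 / 10 / 10 * (expR u - 1) <= expR (- (2 * n)) + 2 * expR n - 3.
Proof.
move=> n0 u1 u2; case: (lerP n (17 * 15 * 3 / 10 / 10 / 10)) => hn.
  have e1 : expR u <= expR (15 / 23 * n ^+ 2) by rewrite ler_expR.
  have nn : n ^+ 2 <= (17 * 15 * 3 / 10 / 10 / 10) ^+ 2 by rewrite ler_sqr ?nnegrE; lra.
  have n2 := sqr_ge0 n.
  have := @expR_le_small (15 / 23 * n ^+ 2) ltac:(lra) ltac:(lra).
  have e3 := expR_ge4 n0.
  have e4 : (1 - n + n ^+ 2 / 2 - n ^+ 3 / 6) ^+ 2 <= expR (- (2 * n)).
    rewrite (_ : - (2 * n) = 2%:R * - n); last by lra.
    rewrite expRM_natl; apply: lerXn2r; rewrite ?nnegrE ?expR_ge0//; last exact: expRN_ge3.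
    nra.
  have key : 0 <= n ^+ 2 * (4 * 251 / 10 / 10 / 10 - n - 12 / 10 / 10 * n ^+ 2 - 17 / 10 / 10 * n ^+ 3).
    by apply: mulr_ge0; [exact: n2|nra].
  have n6 : 0 <= n ^+ 6 by exact: exprn_ge0.
  have n5 : 0 <= n ^+ 5 by exact: exprn_ge0.
  have n4 : 0 <= n ^+ 4 by exact: exprn_ge0.
  lra.
pose z := expR (n / 2); have z0 : 0 < z by exact: expR_gt0.
have hz : 2 * 73 / 10 / 10 <= z.
  apply: le_trans (_ : expR (17 * 15 * 3 / 25 / 20 / 4) <= _); last by rewrite ler_expR; lra.
  by apply: le_trans (expR_ge3 _); lra.
have -> : expR n = z ^+ 2 by rewrite -expRM_natl; congr expR; clear; lra.
have -> : expR (- (2 * n)) = (z ^+ 4)^-1 by rewrite -expRM_natl -expRN; congr expR; clear; lra.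
have uz : expR u <= z by rewrite ler_expR.
have z4 : 0 < z ^+ 4 by exact: exprn_gt0.
have s := sextic_ge0 hz.
apply: le_trans (_ : 18 * 17 / 10 / 10 * (z - 1) <= _); first by lra.
rewrite -subr_ge0 -(pmulr_rge0 _ z4).
rewrite [X in 0 <= X](_ : _ = 2 * z ^+ 6 - 18 * 17 / 10 / 10 * z ^+ 5 + 6 / 10 / 10 * z ^+ 4 + 1)//.
by field; exact: lt0r_neq0.
Qed.

(** Displacement across the altitude. The right side is (exp x - exp (- x))^2, of order 4 x^2 near
    0. *)
Lemma hex_second x w : 0 <= x -> 0 <= w -> w <= x -> w <= 20 / 23 * x ^+ 2 ->
  18 * 17 / 10 / 10 * (expR w - 1) <= expR (2 * x) + expR (- (2 * x)) - 2.
Proof.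
move=> x0 w0 wx wx2; pose z := expR x; have z0 : 0 < z by exact: expR_gt0.
have -> : expR (2 * x) = z ^+ 2 by rewrite -expRM_natl.
have -> : expR (- (2 * x)) = expR (- x) ^+ 2 by rewrite -mulrN expRM_natl.
have zi : z * expR (- x) = 1 by rewrite -expRD subrr expR0.
have e : z ^+ 2 + expR (- x) ^+ 2 - 2 = (z - expR (- x)) ^+ 2.
  by rewrite sqrrB zi; ring.
rewrite e; case: (lerP x 1) => x1.
  have d : 2 * x + x ^+ 3 / 6 <= z - expR (- x).
    by have := expR_ge3' x0; have := expRN_le2 x0; rewrite /z; lra.
  have x2 := sqr_ge0 x.
  have x21 : x ^+ 2 <= 1 by rewrite -(expr1n R 2) ler_sqr ?nnegrE.
  have d2 : (2 * x + x ^+ 3 / 6) ^+ 2 <= (z - expR (- x)) ^+ 2.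
    have x3 := exprn_ge0 3 x0.
    by rewrite ler_sqr ?nnegrE//; lra.
  have := @expR_le_mid w w0 ltac:(lra).
  have w2 : w ^+ 2 <= (20 / 23 * x ^+ 2) ^+ 2 by rewrite ler_sqr ?nnegrE//; lra.
  have x4 : x ^+ 4 <= x ^+ 2 by rewrite -[4%N]/(2 + 2)%N exprD ler_piMl.
  have x6 := exprn_ge0 6 x0; have x40 := exprn_ge0 4 x0.
  lra.
have hz : 27 / 10 <= z.
  apply: le_trans (_ : expR 1 <= _); last by rewrite ler_expR; lra.
  by apply: le_trans (expR_ge4 _); lra.
have ewz : expR w <= z by rewrite ler_expR.
have -> : expR (- x) = z^-1 by rewrite expRN.
apply: le_trans (_ : 18 * 17 / 10 / 10 * (z - 1) <= _); first by lra.
rewrite -subr_ge0 -(pmulr_rge0 _ (exprn_gt0 2 z0)).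
rewrite [X in 0 <= X](_ : _ = (z - 1) * (z ^+ 3 - 2 * 103 / 10 / 10 * z ^+ 2 - z - 1)); last first.
  by field; exact: lt0r_neq0.
by apply: mulr_ge0; [lra|nra].
Qed.

(** With n = G N / 3 and x = G d / 3 the right side is (exp (-2n) + 2 exp n - 3) + exp n (exp (2x) +
    exp (-2x) - 2), and the exponential on the left splits as exp u exp w with u <= n. The constants
    15/23 and 20/23 are 3 / G and 4 / G at G = 23/5. *)
Lemma hex_bary_core G (N d : R) : 23 / 5 <= G -> 0 <= N -> N <= 1 / 2 -> 0 <= d -> d <= 3 / 2 * N ->
  18 * 17 / 10 / 10 * (expR (G / 2 * ((2 / 3 * N) ^+ 2 + ((N + 2 * d) / 3) ^+ 2 + ((N - 2 * d) / 3) ^+ 2)) - 1) <=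
  expR (G * (- (2 / 3 * N))) + expR (G * ((N + 2 * d) / 3)) + expR (G * ((N - 2 * d) / 3)) - 3.
Proof.
move=> hG N0 N1 d0 dN; pose g := G / 3; pose n := g * N; pose x := g * d.
have g0 : 0 <= g by rewrite /g; lra.
have n0 : 0 <= n by exact: mulr_ge0.
have x0 : 0 <= x by exact: mulr_ge0.
pose u := g * N ^+ 2; pose w := 4 / 3 * g * d ^+ 2.
have w0 : 0 <= w by rewrite /w mulr_ge0 ?sqr_ge0//; lra.
have -> : G / 2 * ((2 / 3 * N) ^+ 2 + ((N + 2 * d) / 3) ^+ 2 + ((N - 2 * d) / 3) ^+ 2) = u + w.
  by rewrite /u /w /g; lra.
have -> : G * (- (2 / 3 * N)) = - (2 * n) by rewrite /n /g; lra.
have -> : G * ((N + 2 * d) / 3) = n + 2 * x by rewrite /n /x /g; lra.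
have -> : G * ((N - 2 * d) / 3) = n + - (2 * x) by rewrite /n /x /g; lra.
have gg : 0 <= g * (g - 23 / 15) by apply: mulr_ge0 => //; rewrite /g; lra.
have u1 : u <= n / 2.
  by rewrite /u /n; have := mulr_ge0 (mulr_ge0 g0 N0) (_ : 0 <= 1 / 2 - N); lra.
have u2 : u <= 15 / 23 * n ^+ 2.
  by rewrite /u /n; have := mulr_ge0 gg (sqr_ge0 N); lra.
have w1 : w <= x.
  by rewrite /w /x; have := mulr_ge0 (mulr_ge0 g0 d0) (_ : 0 <= 3 / 4 - d); lra.
have w2 : w <= 20 / 23 * x ^+ 2.
  by rewrite /w /x; have := mulr_ge0 gg (sqr_ge0 d); lra.
have A := hex_base n0 u1 u2; have B := hex_second x0 w0 w1 w2.
have un : expR u <= expR n by rewrite ler_expR; lra.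
have ew : 0 <= expR w - 1 by have := expR_ge1Dx w; lra.
rewrite !expRD; have := ler_wpM2l (expR_ge0 n) B; have := ler_wpM2r ew un; lra.
Qed.

Lemma hex_bary G (h1 h2 h3 T : R) : 23 / 5 <= G -> h1 + h2 + h3 = 0 ->
  - 1 / 3 <= h1 -> - 1 / 3 <= h2 -> - 1 / 3 <= h3 -> T <= 18 * 17 / 10 / 10 ->
  T * expR (G / 2 * (h1 ^+ 2 + h2 ^+ 2 + h3 ^+ 2)) <=
  T - 3 + (expR (G * h1) + expR (G * h2) + expR (G * h3)).
Proof.
move=> hG.
have core (a b c : R) : a + b + c = 0 -> - 1 / 3 <= a -> a <= c -> c <= b -> T <= 18 * 17 / 10 / 10 ->
    T * expR (G / 2 * (a ^+ 2 + b ^+ 2 + c ^+ 2)) <= T - 3 + (expR (G * a) + expR (G * b) + expR (G * c)).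
  move=> s a0 ac cb T3; pose N := - (3 / 2) * a; pose d := 3 / 4 * (b - c).
  have := @hex_bary_core G N d hG ltac:(rewrite /N; lra) ltac:(rewrite /N; lra) ltac:(rewrite /d; lra) ltac:(rewrite /N /d; lra).
  have -> : (N + 2 * d) / 3 = b by rewrite /N /d; lra.
  have -> : (N - 2 * d) / 3 = c by rewrite /N /d; lra.
  have -> : - (2 / 3 * N) = a by rewrite /N; lra.
  have -> : (2 / 3 * N) ^+ 2 = a ^+ 2 by rewrite /N; lra.
  set e := expR (G / 2 * _); have e1 : 1 <= e.
    rewrite -(expR0 R) ler_expR; apply: mulr_ge0; first lra.
    by rewrite !addr_ge0 ?sqr_ge0.
  have := ler_wpM2r (_ : 0 <= e - 1) T3; lra.
move=> s a1 a2 a3 T3.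
case: (lerP h1 h2) => h12; case: (lerP h2 h3) => h23; case: (lerP h1 h3) => h13; try (exfalso; lra).
- have := core h1 h3 h2 ltac:(lra) ltac:(lra) ltac:(lra) ltac:(lra) T3;
  rewrite (_ : h1 ^+ 2 + h3 ^+ 2 + h2 ^+ 2 = h1 ^+ 2 + h2 ^+ 2 + h3 ^+ 2); [lra|ring].
- have := core h1 h2 h3 ltac:(lra) ltac:(lra) ltac:(lra) ltac:(lra) T3;
  lra.
- have := core h3 h2 h1 ltac:(lra) ltac:(lra) ltac:(lra) ltac:(lra) T3;
  rewrite (_ : h3 ^+ 2 + h2 ^+ 2 + h1 ^+ 2 = h1 ^+ 2 + h2 ^+ 2 + h3 ^+ 2); [lra|ring].
- have := core h2 h3 h1 ltac:(lra) ltac:(lra) ltac:(lra) ltac:(lra) T3;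
  rewrite (_ : h2 ^+ 2 + h3 ^+ 2 + h1 ^+ 2 = h1 ^+ 2 + h2 ^+ 2 + h3 ^+ 2); [lra|ring].
- have := core h2 h1 h3 ltac:(lra) ltac:(lra) ltac:(lra) ltac:(lra) T3;
  rewrite (_ : h2 ^+ 2 + h1 ^+ 2 + h3 ^+ 2 = h1 ^+ 2 + h2 ^+ 2 + h3 ^+ 2); [lra|ring].
- have := core h3 h1 h2 ltac:(lra) ltac:(lra) ltac:(lra) ltac:(lra) T3;
  rewrite (_ : h3 ^+ 2 + h1 ^+ 2 + h2 ^+ 2 = h1 ^+ 2 + h2 ^+ 2 + h3 ^+ 2); [lra|ring].
Qed.

End HexNumeric.

(** * The minimum of the hexagonal direct series *)

Section HexPrimal.
Variable R : realType.
Implicit Types (x y c : R).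

Let hexsum c sg x y E := hasum (fun p : int * int =>
  expR (- (c * quad (sg, sg, sg) (p.1%:~R + x) (p.2%:~R + y)))) E.

(** h1, h2, h3 are the deviations from 1/3 of the barycentric coordinates 1 - x, x - y, y. Taking
    the factor exp (- (G / 3 + Y)) out of E leaves the series of [hex_rotation], whose gain beats
    the loss exp Y by [hex_bary]. *)
Lemma hex_primal_triangle (c sg x y E T : R) : 23 / 5 <= c * sg -> 0 <= y -> y <= x -> x <= 1 ->
  hexsum c sg x y E -> hasum (fun p => expR (- (c * tri (sg, sg, sg) p))) T ->
  expR (- (c * sg / 3)) * T <= E.
Proof.
move=> hG y0 yx x1 hE hT; pose G := c * sg.
have {}hT : hasum (fun p => expR (- (G * ((tri2 p)%:~R / 2)))) T.
  by apply: eq_hasum hT => p; rewrite triE mulrA.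
pose h1 := 2 / 3 - x; pose h2 := x - y - 1 / 3; pose h3 := y - 1 / 3.
pose Y := G / 2 * (h1 ^+ 2 + h2 ^+ 2 + h3 ^+ 2).
(* This renumbering sends [tri_seq3] to (0, 0), (-1, 0), (-1, -1), the vertices of the triangle
   containing (- x, - y). *)
have K1 : cancel (fun p : int * int => (p.1 - 1, p.1 - 1 + p.2)) (fun p => (p.1 + 1, p.2 - p.1)).
  by move=> [i j] /=; congr (_, _); ring.
have K2 : cancel (fun p : int * int => (p.1 + 1, p.2 - p.1)) (fun p => (p.1 - 1, p.1 - 1 + p.2)).
  by move=> [i j] /=; congr (_, _); ring.
have hL := hasumZ (expR (G / 3 + Y)) (hasum_bij K1 K2 hE).
have {}hL : hasum (fun p : int * int => expR (- (G * ((tri2 p)%:~R / 2))) *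
    expR (G * (p.1%:~R * h1 + p.2%:~R * h2 + (1 - p.1%:~R - p.2%:~R) * h3))) (expR (G / 3 + Y) * E).
  apply: eq_hasum hL => -[i j] /=; rewrite -!expRD; congr expR.
  rewrite /Y /G /tri2 /quad /h1 /h2 /h3 /= !(intrD, rmorphN, rmorphXn, rmorphB) /=; lra.
have G0 : 0 <= G by rewrite /G; lra.
have s : h1 + h2 + h3 = 0 by rewrite /h1 /h2 /h3; lra.
have := hex_rotation G0 s hT hL.
have := hex_bary hG s _ _ _ (tri_hex_le hG hT); rewrite -/G -/Y => bary.
have {bary} := bary ltac:(rewrite /h1; lra) ltac:(rewrite /h2; lra) ltac:(rewrite /h3; lra).
move=> le1 le2; have le := le_trans le1 le2.
rewrite -/G expRN ler_pdivrMl ?expR_gt0//.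
rewrite -(ler_pM2r (expR_gt0 Y)) mulrAC -expRD//.
Qed.

(** Integer translations and the exchange of the coordinates, symmetries of the hexagonal form,
    bring every point into the triangle. *)
Lemma hex_primal_min (c sg x y E T : R) : 23 / 5 <= c * sg ->
  hexsum c sg x y E -> hasum (fun p => expR (- (c * tri (sg, sg, sg) p))) T ->
  expR (- (c * sg / 3)) * T <= E.
Proof.
move=> hG hE hT; pose a := Num.floor x; pose b := Num.floor y.
have /andP[xa xa1] := floor_itv x; have /andP[yb yb1] := floor_itv y.
rewrite -/a -/b !intrD in xa xa1 yb yb1.
have K1 : cancel (fun p : int * int => (p.1 - a, p.2 - b)) (fun p => (p.1 + a, p.2 + b)).
  by move=> [i j] /=; congr (_, _); ring.
have K2 : cancel (fun p : int * int => (p.1 + a, p.2 + b)) (fun p => (p.1 - a, p.2 - b)).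
  by move=> [i j] /=; congr (_, _); ring.
have {}hE : hexsum c sg (x - a%:~R) (y - b%:~R) E.
  apply: eq_hasum (hasum_bij K1 K2 hE) => -[i j] /=.
  by rewrite !rmorphB /= -!addrA [- _ + x]addrC [- _ + y]addrC.
case: (lerP (y - b%:~R) (x - a%:~R)) => yx.
  by apply: hex_primal_triangle hG _ yx _ hE hT; lra.
have K : cancel (fun p : int * int => (p.2, p.1)) (fun p => (p.2, p.1)) by case.
have {}hE : hexsum c sg (y - b%:~R) (x - a%:~R) E.
  apply: eq_hasum (hasum_bij K K hE) => -[i j] /=.
  by rewrite /quad /=; congr expR; clear; lra.
by apply: hex_primal_triangle hG _ (ltW yx) _ hE hT; lra.
Qed.

End HexPrimal.

(** * Direct series of nearly hexagonal lattices *)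

Section Near.
Variable R : realType.
Implicit Types (x y c : R).

(** A common upper bound m of the exponents lets the three rotated terms share one remainder
    factor. *)
Lemma expR_taylor2 (u v m : R) : u <= m -> v <= m ->
  expR u <= expR v + expR v * (u - v) + (u - v) ^+ 2 / 2 * expR m.
Proof.
move=> um vm; pose x := u - v.
have h : expR x <= 1 + x + x ^+ 2 / 2 * expR (m - v).
  case: (lerP x 0) => x0.
    have := @expRN_le2 R (- x) ltac:(lra); rewrite opprK sqrrN.
    have : 1 <= expR (m - v) by have := expR_ge1Dx (m - v); lra.
    by move=> e1; have := ler_wpM2l (sqr_ge0 x) e1; lra.
  have xm : expR x <= expR (m - v) by rewrite ler_expR /x; lra.
  suff : expR x <= 1 + x + x ^+ 2 / 2 * expR x.
    by have := ler_wpM2l (sqr_ge0 x) xm; lra.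
  have key : 1 <= (1 + x) * expR (- x) + x ^+ 2 / 2.
    case: (lerP x 2) => x2.
      have := ler_wpM2l (_ : 0 <= 1 + x) (expRN_ge3 (ltW x0)).
      have := mulr_ge0 (exprn_ge0 3 (ltW x0)) (_ : 0 <= 2 - x); lra.
    have := mulr_ge0 (_ : 0 <= 1 + x) (expR_ge0 (- x)); nra.
  have ee : expR (- x) * expR x = 1 by rewrite -expRD addNr expR0.
  have := ler_wpM2r (expR_ge0 x) key; have := congr1 (fun z => (1 + x) * z) ee => /=; lra.
have -> : expR u = expR v * expR x by rewrite -expRD /x; congr expR; clear; lra.
have -> : expR m = expR v * expR (m - v) by rewrite -expRD; congr expR; clear; lra.
rewrite -/x; have := ler_wpM2l (expR_ge0 v) h; lra.
Qed.

(** With the mean b, P = 6 (b^2 - sg^2) and s1 s2 s3 = b^3 - b P / 2 + d, where the cubic term d is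
    at most (b - 0.82) P / 3. So the squared circumradius gains at least P / 32. *)
Lemma circ2_near (s1 s2 s3 sg : R) : 0 < sg -> 3 * sg ^+ 2 = 4 ->
  s1 * s2 + s2 * s3 + s3 * s1 = 4 -> 82 / 10 / 10 <= s3 -> s3 <= s2 -> s2 <= s1 ->
  s1 ^+ 2 + s2 ^+ 2 + s3 ^+ 2 - (s1 + s2 + s3) ^+ 2 / 3 <= 32 * (circ2 (s1, s2, s3) - sg / 3).
Proof.
move=> g0 gE det s3m s32 s21.
pose b := (s1 + s2 + s3) / 3; pose d := (s1 - b) * (s2 - b) * (s3 - b).
set P := _ - _.
have PE : P = 6 * (b ^+ 2 - sg ^+ 2) by rewrite /P /b; clear -gE det; lra.
have b1 : b <= 49 / 40.
  have h1 := mulr_ge0 (_ : 0 <= s1 - 82 / 10 / 10) (_ : 0 <= s2 - 82 / 10 / 10).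
  have h2 := mulr_ge0 (_ : 0 <= s2 - 82 / 10 / 10) (_ : 0 <= s3 - 82 / 10 / 10).
  have h3 := mulr_ge0 (_ : 0 <= s3 - 82 / 10 / 10) (_ : 0 <= s1 - 82 / 10 / 10).
  have l1 : 0 <= s1 - 82 / 10 / 10 by clear -s3m s32 s21; lra.
  have l2 : 0 <= s2 - 82 / 10 / 10 by clear -s3m s32; lra.
  have l3 : 0 <= s3 - 82 / 10 / 10 by clear -s3m; lra.
  by have := h1 l1 l2; have := h2 l2 l3; have := h3 l3 l1; rewrite /b; clear -det; lra.
have gb : sg <= b.
  rewrite -ler_sqr ?nnegrE; [|lra|rewrite /b; lra].
  by have := sqr_ge0 (s1 - s2); have := sqr_ge0 (s2 - s3); have := sqr_ge0 (s3 - s1); rewrite /b; lra.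
have g1 : sg <= 7 / 6.
  rewrite -ler_sqr ?nnegrE; lra.
have P0 : 0 <= P by rewrite PE; nra.
have dP : 3 * d <= (b - 82 / 10 / 10) * P.
  have bm : 0 <= b - 82 / 10 / 10 by rewrite /b; lra.
  have s3b : s3 <= b by rewrite /b; lra.
  have s1b : b <= s1 by rewrite /b; lra.
  case: (lerP b s2) => s2b.
    have : 0 <= (s1 - b) * (s2 - b) * (b - s3) by rewrite !mulr_ge0// subr_ge0.
    by have := mulr_ge0 bm P0; rewrite /d; lra.
  pose a := b - s3; pose a' := b - s2.
  have PE2 : P = 2 * (a ^+ 2 + a * a' + a' ^+ 2) by rewrite /P /a /a' /b; lra.
  have dE : d = a * (a' * (a + a')) by rewrite /d /a /a' /b; lra.
  have a'0 : 0 <= a' by rewrite /a'; lra.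
  have aa' : a' <= a by rewrite /a /a'; lra.
  have a1 : a <= b - 82 / 10 / 10 by rewrite /a; lra.
  apply: le_trans (ler_wpM2r P0 a1); rewrite dE mulrCA ler_wpM2l; [by []|lra|].
  rewrite PE2; nra.
have -> : 32 * (circ2 (s1, s2, s3) - sg / 3) = 12 * (b - sg) + sg ^+ 3 - b ^+ 3 + b * P / 2 - d.
  have e1 : 32 * circ2 (s1, s2, s3) = 4 * (3 * b) - s1 * s2 * s3.
    rewrite /circ2 /=; have := congr1 (fun z => z * (s1 + s2 + s3)) det; rewrite /b /=; lra.
  have e2 : 32 * (sg / 3) = 12 * sg - sg ^+ 3.
    have := congr1 (fun z => z * sg) gE; rewrite /= exprS; lra.
  have e3 : s1 * s2 * s3 = b ^+ 3 - b * P / 2 + d.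
    rewrite PE /d; have := congr1 (fun z => z * b) gE; have := congr1 (fun z => z * b) det.
    rewrite /b /=; lra.
  by rewrite mulrBr e1 e2 e3; lra.
have key : 0 <= (b - sg) * (12 - sg ^+ 2 - 4 * 109 / 10 / 10 * (b + sg)) by apply: mulr_ge0; lra.
move: dP; rewrite PE; lra.
Qed.

Lemma tri_cyclic (s : R * R * R) p :
  tri s p + tri s (tri_rot p) + tri s (tri_rot (tri_rot p)) = (s.1.1 + s.1.2 + s.2) * ((tri2 p)%:~R / 2).
Proof.
case: p => m n; rewrite /tri /tri2 /tri_rot /=.
have -> : (1 - m - n)%:~R = 1 - m%:~R - n%:~R :> R by rewrite !rmorphB.
have -> : (1 - n - (1 - m - n)) = m by ring.
rewrite !intrD !rmorphN !rmorphXn !rmorphB /= /ctr.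
by move: (m%:~R) (n%:~R) => a b; field.
Qed.

(** The three values are cyclic correlations of (s1, s2, s3) with the triangular numbers C1, C2, C3,
    which are nonnegative and have sum M; P is the sum of squared deviations of the s_i. *)
Lemma tri_variance (s1 s2 s3 : R) p (M := (tri2 p)%:~R / 2) (b := (s1 + s2 + s3) / 3)
    (P := s1 ^+ 2 + s2 ^+ 2 + s3 ^+ 2 - (s1 + s2 + s3) ^+ 2 / 3) :
  (tri (s1, s2, s3) p - b * M) ^+ 2 + (tri (s1, s2, s3) (tri_rot p) - b * M) ^+ 2 +
  (tri (s1, s2, s3) (tri_rot (tri_rot p)) - b * M) ^+ 2 <= P * M ^+ 2.
Proof.
have P0 : 0 <= P.
  rewrite /P; have := sqr_ge0 (s1 - s2); have := sqr_ge0 (s2 - s3); have := sqr_ge0 (s3 - s1); lra.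
pose C1 := ctr (p.1%:~R : R); pose C2 := ctr (p.2%:~R : R); pose C3 := ctr (1 - p.1 - p.2)%:~R : R.
have C10 : 0 <= C1 := ctr_ge0 _ _; have C20 : 0 <= C2 := ctr_ge0 _ _.
have C30 : 0 <= C3 := ctr_ge0 _ _.
have MC : M = C1 + C2 + C3.
  by rewrite /M /C1 /C2 /C3 /ctr /tri2 !(intrD, rmorphN, rmorphXn, rmorphB) /=; field.
have t1 : tri (s1, s2, s3) p = s1 * C1 + s2 * C2 + s3 * C3.
  by rewrite /tri /C1 /C2 /C3 !(intrD, rmorphN) /=.
have t2 : tri (s1, s2, s3) (tri_rot p) = s1 * C2 + s2 * C3 + s3 * C1.
  by rewrite /tri /C1 /C2 /C3 /ctr /tri_rot /= !(intrD, rmorphN) /=; lra.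
have t3 : tri (s1, s2, s3) (tri_rot (tri_rot p)) = s1 * C3 + s2 * C1 + s3 * C2.
  by rewrite /tri /C1 /C2 /C3 /ctr /tri_rot /= !(intrD, rmorphN) /=; lra.
rewrite t1 t2 t3 MC.
have := mulr_ge0 P0 (mulr_ge0 C10 C20); have := mulr_ge0 P0 (mulr_ge0 C20 C30).
have := mulr_ge0 P0 (mulr_ge0 C30 C10); rewrite /P /b; lra.
Qed.

End Near.

Section PrimalNear.
Variable R : realType.
Implicit Types (x y c : R).

Lemma expRN328 : expR (- (8 * 41 / 10 / 10)) <= 29 * 13 / 10 / 10 / 10 / 10 :> R.
Proof.
rewrite (_ : - (8 * 41 / 10 / 10) = 4%:R * - (82 / 10 / 10)); last by lra.
rewrite expRM_natl; apply: le_trans (_ : (10 / 227 * 10) ^+ 4 <= _); last by lra.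
apply: lerXn2r; [by rewrite nnegrE expR_ge0|by rewrite nnegrE; lra|].
apply: le_trans (expR_le_inv _ (expR_ge5 _)) _; [lra|lra|].
by rewrite invf_ple ?posrE; lra.
Qed.

(** 5.99 = 3 * 3.28 - 0.7 * 11/2 is the balance of exponents in [tail_near] at a = 3.28 = 4 * 0.82
    and M = 4. *)
Lemma expRN599 : 16 * expR (- (599 / 10 / 10)) <= 41 / 10 / 10 / 10 :> R.
Proof.
rewrite (_ : - (599 / 10 / 10) = 10%:R * - (599 / 10 / 10 / 10)); last by lra.
rewrite expRM_natl; apply: le_trans (_ : 16 * (25 * 22 * 10 / 10 / 10 / 10 / 10) ^+ 10 <= _); last by lra.
rewrite ler_pM2l; last by lra.
apply: lerXn2r; [by rewrite nnegrE expR_ge0|by rewrite nnegrE; lra|].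
apply: le_trans (expR_le_inv _ (expR_ge4 _)) _; [lra|lra|].
by rewrite invf_ple ?posrE; lra.
Qed.

Lemma tail_near (a M : R) : 8 * 41 / 10 / 10 <= a -> 4 <= M ->
  M ^+ 2 * expR (- (a * M)) <= 41 / 10 / 10 / 10 * expR (- a) * expR (- (7 / 10 * (M + 3 / 2))).
Proof.
move=> ha hM.
have M2 : M ^+ 2 <= 16 * expR (2%:R * ((M - 4) / 4)).
  rewrite expRM_natl; have := expR_ge1Dx ((M - 4) / 4); set e := expR _ => he.
  have : M <= 4 * e by lra.
  by move=> h; have := ler_pM _ _ h h; rewrite !expr2; lra.
apply: le_trans (_ : 16 * expR (2%:R * ((M - 4) / 4)) * expR (- (a * M)) <= _).
  by rewrite ler_wpM2r ?expR_ge0.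
rewrite -mulrA -expRD.
apply: le_trans (_ : 16 * (expR (- (599 / 10 / 10)) * (expR (- a) * expR (- (7 / 10 * (M + 3 / 2))))) <= _).
  rewrite ler_pM2l; last by lra.
  rewrite -!expRD ler_expR; have := ler_wpM2r (_ : 0 <= M - 1) ha; lra.
by rewrite mulrA -[leRHS]mulrA ler_wpM2r ?mulr_ge0 ?expR_ge0// expRN599.
Qed.

Lemma tri_ge3 c (s : R * R * R) T : hasum (fun p => expR (- (c * tri s p))) T -> 3 <= T.
Proof.
move=> hT; have zz : hasum (fun _ : int * int => 0 : R) 0.
  by have := hasumZ 0 hT; rewrite mul0r; apply: eq_hasum => p; rewrite mul0r.
have off (p : int * int) : p \notin tri_seq3 -> - 0 <= expR (- (c * tri s p)) by rewrite oppr0 expR_ge0.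
have := hasum_ge_seq (s := tri_seq3) isT off (fun=> lexx 0) hT zz.
have f1 p : p \in tri_seq3 -> expR (- (c * tri s p)) = 1.
  move=> hp; have -> : tri s p = 0 by move: hp; rewrite !inE => /or3P[] /eqP->; rewrite /tri /ctr /=; lra.
  by rewrite mulr0 oppr0 expR0.
rewrite !big_cons big_nil (f1 (1, 0) isT) (f1 (0, 1) isT) (f1 (0, 0) isT); lra.
Qed.

(** The factor c^2 of the error is tamed by c z <= 4 * 0.0377; against it stands the gain T0 c rho
    >= 3 c P / 32. *)
Lemma near_numeric (c z P rho T0 Ts : R) : 4 <= c -> 0 < P -> P <= 32 * rho -> 3 <= T0 -> 0 < z ->
  z <= 29 * 13 / 10 / 10 / 10 / 10 -> c * z <= 4 * (29 * 13 / 10 / 10 / 10 / 10) ->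
  3 * (Ts - T0) <= c ^+ 2 / 2 * P * (3 * z + 6 * z ^+ 2 + 41 / 10 / 10 / 10 * z * 9) ->
  Ts < T0 * (1 + c * rho).
Proof.
move=> hc P0 hP hT z0 hz hcz hle.
have cP : 0 < c * P by apply: mulr_gt0 => //; lra.
have z2 : z ^+ 2 <= z * (29 * 13 / 10 / 10 / 10 / 10) by rewrite expr2 ler_pM2l.
have h : c * (3 * z + 6 * z ^+ 2 + 41 / 10 / 10 / 10 * z * 9) <= 5 * 109 / 10 / 10 / 10.
  have c0 : 0 <= c by lra.
  have := ler_wpM2l c0 z2; lra.
have := ler_wpM2l (ltW cP) h.
have : c * P <= c * (32 * rho) by rewrite ler_pM2l//; lra.
have cr : 0 <= c * rho by nra.
have := ler_wpM2r cr hT; lra.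
Qed.

(** On this shell two of the triangular numbers are 1 and the third is 0; this improves the bound 4
    P of [tri_variance] to P. *)
Lemma tri_variance2 (s1 s2 s3 : R) p (b := (s1 + s2 + s3) / 3) :
  p \in [:: (0, -1); (-1, 0); (-1, 2); (2, -1); (0, 2); (2, 0)] ->
  (tri (s1, s2, s3) p - b * ((tri2 p)%:~R / 2)) ^+ 2 +
  (tri (s1, s2, s3) (tri_rot p) - b * ((tri2 p)%:~R / 2)) ^+ 2 +
  (tri (s1, s2, s3) (tri_rot (tri_rot p)) - b * ((tri2 p)%:~R / 2)) ^+ 2 <=
    s1 ^+ 2 + s2 ^+ 2 + s3 ^+ 2 - (s1 + s2 + s3) ^+ 2 / 3.
Proof.
by rewrite !inE => /or4P[/eqP->|/eqP->|/eqP->|/or3P[/eqP->|/eqP->|/eqP->]];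
  rewrite /b /tri /ctr /tri2 /tri_rot /=; lra.
Qed.

Lemma primal_near (c s1 s2 s3 sg Ts T0 : R) : 4 <= c -> 0 < sg -> 3 * sg ^+ 2 = 4 ->
  s1 * s2 + s2 * s3 + s3 * s1 = 4 -> 82 / 10 / 10 <= s3 -> s3 <= s2 -> s2 <= s1 ->
  (s1, s2, s3) <> (sg, sg, sg) ->
  hasum (fun p => expR (- (c * tri (s1, s2, s3) p))) Ts ->
  hasum (fun p => expR (- (c * tri (sg, sg, sg) p))) T0 ->
  expR (- (c * circ2 (s1, s2, s3))) * Ts < expR (- (c * sg / 3)) * T0.
Proof.
move=> hc g0 gE det s3m s32 s21 neq hTs hT0.
have c0 : 0 <= c by lra.
pose P := s1 ^+ 2 + s2 ^+ 2 + s3 ^+ 2 - (s1 + s2 + s3) ^+ 2 / 3.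
pose b := (s1 + s2 + s3) / 3; pose s := (s1, s2, s3).
have rho := circ2_near g0 gE det s3m s32 s21; rewrite -/P -/s in rho.
have P2 : P = ((s1 - s2) ^+ 2 + (s2 - s3) ^+ 2 + (s1 - s3) ^+ 2) / 3 by rewrite /P; field.
have P0 : 0 < P.
  rewrite lt0r; apply/andP; split; last by rewrite P2 divr_ge0// !addr_ge0 ?sqr_ge0.
  apply/eqP => Pz; apply: neq.
  have z1 := sqr_ge0 (s1 - s2); have z2 := sqr_ge0 (s2 - s3); have z3 := sqr_ge0 (s1 - s3).
  have y1 : s1 - s2 = 0 by apply/eqP; rewrite -sqrf_eq0 eq_le sqr_ge0 andbT; lra.
  have y2 : s2 - s3 = 0 by apply/eqP; rewrite -sqrf_eq0 eq_le sqr_ge0 andbT; lra.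
  have e1 : s1 = s3 by lra.
  have e2 : s2 = s3 by lra.
  have eg : sg = s3.
    apply/eqP; rewrite -(@eqrXn2 R 2)//; [|exact: ltW|lra].
    by apply/eqP; move: det; rewrite e1 e2; lra.
  by rewrite e1 e2 eg.
have gb : sg <= b.
  rewrite -ler_sqr ?nnegrE; [|lra|rewrite /b; lra].
  by have := ltW P0; rewrite /P /b; lra.
pose mu := 82 / 10 / 10 : R; pose z := expR (- (c * mu)).
have zE : c * mu = mu * c by rewrite mulrC.
have hz : z <= 29 * 13 / 10 / 10 / 10 / 10.
  by apply: le_trans expRN328; rewrite ler_expR /mu; lra.
have hcz : c * z <= 4 * (29 * 13 / 10 / 10 / 10 / 10).
  apply: le_trans (_ : 4 * expR ((c - 4) / 4) * z <= _).
    by rewrite ler_pM2r ?expR_gt0//; have := expR_ge1Dx ((c - 4) / 4); lra.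
  rewrite -mulrA ler_pM2l; last by lra.
  by apply: le_trans expRN328; rewrite -expRD ler_expR /mu; lra.
have hF := hasumB (hasum_tri_rot hTs) (hasumZ 3 hT0).
set F := (fun p => _) in hF.
pose M p : R := (tri2 p)%:~R / 2.
have M0 p : 0 <= M p by rewrite /M divr_ge0// ler0z tri2_ge0.
have mug p : mu * M p <= tri s p.
  have -> : mu * M p = tri (mu, mu, mu) p by rewrite triE.
  rewrite /tri /s /=.
  have h3 : 0 <= ctr (1 - p.1 - p.2)%:~R :> R by exact: ctr_ge0.
  rewrite !(intrD, rmorphN) /= in h3.
  have h1 := ler_wpM2r (ctr_ge0 R p.1) (_ : mu <= s1).
  have h2 := ler_wpM2r (ctr_ge0 R p.2) (_ : mu <= s2).
  have h4 := ler_wpM2r h3 (_ : mu <= s3).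
  by rewrite !lerD ?h1 ?h2 ?h4// /mu; clear -s3m s32 s21; lra.
have FV p W : (tri s p - b * M p) ^+ 2 + (tri s (tri_rot p) - b * M p) ^+ 2 +
    (tri s (tri_rot (tri_rot p)) - b * M p) ^+ 2 <= W -> F p <= c ^+ 2 / 2 * W * expR (- (c * mu * M p)).
  move=> var.
  have one q : M q = M p -> expR (- (c * tri s q)) <= expR (- (c * (b * M p))) +
      expR (- (c * (b * M p))) * (- (c * (tri s q - b * M p))) +
      c ^+ 2 * (tri s q - b * M p) ^+ 2 / 2 * expR (- (c * mu * M p)).
    move=> qp; have := @expR_taylor2 R (- (c * tri s q)) (- (c * (b * M p))) (- (c * mu * M p)).
    rewrite (_ : - (c * tri s q) - - (c * (b * M p)) = - (c * (tri s q - b * M p))); last by ring.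
    rewrite sqrrN exprMn; apply; rewrite lerN2 -mulrA; apply: ler_wpM2l => //.
      by rewrite -qp; exact: mug.
    by apply: ler_wpM2r => //; rewrite /mu /b; lra.
  have o1 := one p erefl.
  have o2 := one (tri_rot p) (congr1 (fun z : int => z%:~R / 2) (tri2_rot p)).
  have o3 := one (tri_rot (tri_rot p)) (congr1 (fun z : int => z%:~R / 2) (etrans (tri2_rot (tri_rot p)) (tri2_rot p))).
  have cyc : tri s p - b * M p + (tri s (tri_rot p) - b * M p) + (tri s (tri_rot (tri_rot p)) - b * M p) = 0.
    by have := tri_cyclic s p; rewrite -/(M p) /b /=; clear; lra.
  (* As b >= sg, the term at the mean exponent is at most the hexagonal term. *)
  have hb : expR (- (c * (b * M p))) <= expR (- (c * tri (sg, sg, sg) p)).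
    by rewrite triE -/(M p) ler_expR lerN2; apply: ler_wpM2l => //; apply: ler_wpM2r.
  rewrite /F; move: o1 o2 o3 cyc var hb.
  move: (tri s p - _) (tri s (tri_rot p) - _) (tri s (tri_rot (tri_rot p)) - _) => d1 d2 d3.
  move: (expR (- (c * tri s p))) (expR (- (c * tri s (tri_rot p)))) (expR (- (c * tri s (tri_rot (tri_rot p))))) => x1 x2 x3.
  move: (expR (- (c * tri _ p))) (expR (- (c * (b * M p)))) => e0 eb.
  have := expR_ge0 (- (c * mu * M p)); move: (expR (- (c * mu * M p))) => em em0 o1 o2 o3 cyc var hb.
  have k : 0 <= c ^+ 2 / 2 * em by rewrite mulr_ge0// divr_ge0 ?sqr_ge0.
  have := ler_wpM2l k var; have := congr1 (fun u => eb * c * u) cyc => /=; clear -hb o1 o2 o3; lra.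
have FE p : F p <= c ^+ 2 / 2 * P * (M p ^+ 2 * expR (- (c * mu * M p))).
  by have := FV p _ (tri_variance s1 s2 s3 p); rewrite -/P -/(M p) !mulrA.
have [G hG G9] := hasum_decay R.
pose K := c ^+ 2 / 2 * P * (41 / 10 / 10 / 10 * z).
have cP0 : 0 <= c ^+ 2 / 2 * P by rewrite mulr_ge0 ?(ltW P0)// divr_ge0 ?sqr_ge0.
have z0 : 0 < z by exact: expR_gt0.
have K41 : 0 <= 41 / 10 / 10 / 10 * z by move: z0; clear; move=> *; lra.
have K0 : 0 <= K by exact: mulr_ge0 cP0 K41.
have off p : p \notin tri_seq12 -> F p <= K * decay R p.
  move=> ps; have t8 := tri2_ge8 ps; have tn := tri2_norm p.
  have t8R : 8 <= (tri2 p)%:~R :> R by rewrite (ler_int R 8).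
  have M4 : 4 <= M p by rewrite /M; clear -t8R; lra.
  have tnR' : 2 * (`|p.1|%:~R + `|p.2|%:~R) <= (tri2 p)%:~R + 3 :> R.
    by move: tn; rewrite -(ler_int R) !(intrD, intrM).
  have tnR : `|p.1|%:~R + `|p.2|%:~R <= M p + 3 / 2 :> R by rewrite /M; clear -tnR'; lra.
  apply: le_trans (FE p) _; rewrite /K -[leRHS]mulrA; apply: (ler_wpM2l cP0).
  have ha : 8 * 41 / 10 / 10 <= c * mu by rewrite /mu; lra.
  apply: le_trans (tail_near ha M4) _; rewrite -/z /decay; apply: ler_wpM2l; first exact: K41.
  by rewrite ler_expR; clear -tnR; lra.
have := hasum_le_seq (s := tri_seq12) isT off (fun p => mulr_ge0 K0 (decay_ge0 R p)) hF (hasumZ K hG).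
have f0 p : p \in tri_seq3 -> F p <= 0.
  move=> hp; apply: le_trans (FE p) _.
  have -> : M p = 0 by move: hp; rewrite !inE => /or3P[] /eqP->; rewrite /M /tri2 /= mul0r.
  by rewrite expr0n /= mul0r mulr0.
have f1 p : p \in [:: (1, 1); (1, -1); (-1, 1)] -> F p <= c ^+ 2 / 2 * P * z.
  move=> hp; apply: le_trans (FE p) _.
  have t2 : tri2 p = 2 by move: hp; rewrite !inE => /or3P[] /eqP->.
  have -> : M p = 1 by rewrite /M t2 -[2%:~R]/(2 : R); clear; lra.
  by rewrite expr1n mul1r mulr1.
have f2 p : p \in [:: (0, -1); (-1, 0); (-1, 2); (2, -1); (0, 2); (2, 0)] -> F p <= c ^+ 2 / 2 * P * z ^+ 2.
  move=> hp; have t2 : tri2 p = 4.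
    by move: hp; rewrite !inE => /or4P[/eqP->|/eqP->|/eqP->|/or3P[/eqP->|/eqP->|/eqP->]].
  have M2 : M p = 2.
    by rewrite /M t2 -[4%:~R]/(4 : R); clear; lra.
  have := FV p _ (tri_variance2 s1 s2 s3 hp); rewrite M2 -/P.
  by rewrite (_ : z ^+ 2 = expR (- (c * mu * 2)))// /z -expRM_natl; congr expR; clear; lra.
rewrite !big_cons big_nil.
have g1 := f0 (1, 0) isT; have g2 := f0 (0, 1) isT; have g3 := f0 (0, 0) isT.
have g4 := f1 (1, 1) isT; have g5 := f1 (1, -1) isT; have g6 := f1 (-1, 1) isT.
have k1 := f2 (0, -1) isT; have k2 := f2 (-1, 0) isT; have k3 := f2 (-1, 2) isT.
have k4 := f2 (2, -1) isT; have k5 := f2 (0, 2) isT; have k6 := f2 (2, 0) isT => le.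
have KG : K * G <= K * 9 by rewrite ler_wpM2l.
have tot : 3 * (Ts - T0) <= c ^+ 2 / 2 * P * (3 * z + 6 * z ^+ 2 + 41 / 10 / 10 / 10 * z * 9).
  move: le KG g1 g2 g3 g4 g5 g6 k1 k2 k3 k4 k5 k6; rewrite /K; clear.
  move: (c ^+ 2 / 2 * P) (z ^+ 2) => u v; move: (F _) (F _) (F _) (F _) (F _) (F _) (F _) (F _) (F _) (F _) (F _) (F _).
  by move=> *; lra.
have T03 := tri_ge3 hT0.
have fin := near_numeric hc P0 rho T03 z0 hz hcz tot.
have -> : expR (- (c * sg / 3)) = expR (- (c * circ2 s)) * expR (c * (circ2 s - sg / 3)).
  by rewrite -expRD; congr expR; clear; lra.
rewrite -mulrA ltr_pM2l ?expR_gt0//; apply: lt_le_trans fin _.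
by rewrite mulrC ler_wpM2r ?expR_ge1Dx//; clear -T03; lra.
Qed.

End PrimalNear.

(** * Direct series far from the hexagonal lattice *)

Section Far.
Variable R : realType.
Implicit Types (x y c m k v w : R).

Lemma hasum_ge_sub (I : choiceType) (f : I -> R) l (s : seq I) : uniq s ->
  (forall i, 0 <= f i) -> hasum f l -> \sum_(i <- s) f i <= l.
Proof.
move=> us f0 fl; have zz : hasum (fun _ : I => 0 : R) 0.
  by have := hasumZ 0 fl; rewrite mul0r; apply: eq_hasum => p; rewrite mul0r.
have off i : i \notin s -> - 0 <= f i by rewrite oppr0.
by have := hasum_ge_seq us off (fun=> lexx 0) fl zz; rewrite subr0.
Qed.

Lemma ctr_nat (n : nat) : ctr (- n%:R) = n%:R * (n%:R + 1) / 2 :> R /\ ctr (n%:R + 1) = n%:R * (n%:R + 1) / 2 :> R.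
Proof. by rewrite /ctr; split; field. Qed.

(** Twice the series of y^(n (n + 1)/2). In the first bound the terms up to n = 3 are exact and the
    exponent is lowered to n from n = 4 on; in the second it is lowered throughout. *)
Lemma hasum_ctr (s : R) : 0 < s -> exists2 A, hasum (fun i : int => expR (- (s * ctr i%:~R))) A &
  let y := expR (- s) in A <= 2 * (1 + y + y ^+ 3 + y ^+ 6 + y ^+ 4 / (1 - y)) /\ A <= 2 / (1 - y).
Proof.
move=> s0; pose y := expR (- s); have y0 : 0 < y by exact: expR_gt0.
have y1 : y < 1 by rewrite -(expR0 R) ltr_expR; lra.
pose a (n : nat) := expR (- (s * (n%:R * (n%:R + 1) / 2))).
have aX (n j : nat) : (n * n.+1 = j * 2)%N -> a n = y ^+ j.
  move=> h; rewrite /a /y -expRM_natl; congr expR.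
  have : n%:R * (n%:R + 1) = j%:R * 2 :> R by rewrite natr1 -!natrM h.
  by move=> ->; field.
have ay n : a n <= y ^+ n.
  rewrite /a /y -expRM_natl ler_expR mulrN lerN2 mulrC ler_pM2l//.
  case: n => [|n]; first by rewrite !mul0r.
  by rewrite -(natr1 n); have := ler0n R n; nra.
have a0 n : 0 <= a n by exact: expR_ge0.
have geo := @hasum_geo_nat R y (ltW y0) y1.
have [A0 hA0] : exists A0, hasum a A0.
  by apply: hasum_dominated geo => n; rewrite ger0_norm.
have yn n : 0 <= y ^+ n - a n by rewrite subr_ge0.
have d1 := hasum_ge_sub (s := [:: 2; 3]%N) isT yn (hasumB geo hA0).
have d0 := hasum_ge_sub (s := [::] : seq nat) isT yn (hasumB geo hA0).
rewrite big_nil in d0; rewrite !big_cons big_nil (aX 2%N 3%N erefl) (aX 3%N 6%N erefl) in d1.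
exists (A0 + A0).
  have K1 : cancel (fun i : int => i + 1) (fun i => i - 1) by move=> i /=; rewrite addrK.
  have K2 : cancel (fun i : int => i - 1) (fun i => i + 1) by move=> i /=; rewrite subrK.
  suff h : hasum (fun i : int => expR (- (s * ctr (i + 1)%:~R))) (A0 + A0).
    by apply: eq_hasum (hasum_bij K2 K1 h) => i /=; rewrite subrK.
  apply: hasum_int; apply: eq_hasum hA0 => n; rewrite /a.
    by rewrite intrD -pmulrn (ctr_nat n).2.
  by rewrite NegzE (_ : - n.+1%:Z + 1 = - n%:Z) ?rmorphN /= -?pmulrn ?(ctr_nat n).1//; lia.
have g : (1 - y)^-1 = 1 + y + y ^+ 2 + y ^+ 3 + y ^+ 4 / (1 - y) by field; lra.
rewrite /= -/y; move: d0 d1 g; move: ((1 - y)^-1) => i d0 d1 g; split; lra.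
Qed.

(* [tri] is bounded below by its first two coordinates, with corrections at the seven indices
   where the third coordinate matters most. *)
Lemma tri_far (c s1 s2 s3 T : R) (y1 := expR (- (4 * s1))) (y2 := expR (- (4 * s2))) (y3 := expR (- (4 * s3))) :
  4 <= c -> 0 < s1 -> 0 < s2 -> 0 <= s3 ->
  hasum (fun p => expR (- (c * tri (s1, s2, s3) p))) T ->
  T <= 2 * (1 + y1 + y1 ^+ 3 + y1 ^+ 6 + y1 ^+ 4 / (1 - y1)) * (2 * (1 + y2 + y2 ^+ 3 + y2 ^+ 6 + y2 ^+ 4 / (1 - y2)))
     - (1 - y3) - (y1 + y2) * (3 - 2 * y3 - y3 ^+ 3) /\
  T <= 2 / (1 - y1) * (2 / (1 - y2)).
Proof.
move=> c4 s10 s20 s30 hT.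
have [A1 hA1 [b1 c1]] := @hasum_ctr (4 * s1) ltac:(lra).
have [A2 hA2 [b2 c2]] := @hasum_ctr (4 * s2) ltac:(lra).
rewrite -/y1 in b1 c1; rewrite -/y2 in b2 c2.
have y10 : 0 < y1 by exact: expR_gt0.
have y20 : 0 < y2 by exact: expR_gt0.
have y30 : 0 < y3 by exact: expR_gt0.
have y31 : y3 <= 1 by rewrite -(expR0 R) ler_expR; lra.
pose g (p : int * int) := expR (- (4 * s1 * ctr p.1%:~R)) * expR (- (4 * s2 * ctr p.2%:~R)) : R.
have hg := hasumM (fun _ => expR_ge0 _) (fun _ => expR_ge0 _) hA1 hA2.
rewrite -/g in hg.
pose f p := expR (- (c * tri (s1, s2, s3) p)).
have fg p : f p <= g p * expR (- (4 * s3 * ctr (1 - p.1%:~R - p.2%:~R))).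
  rewrite /f /g -!expRD ler_expR.
  have t0 : 0 <= tri (s1, s2, s3) p.
    have k : 0 <= ctr (1 - p.1 - p.2)%:~R :> R by exact: ctr_ge0.
    rewrite !(intrD, rmorphN) /= in k.
    by rewrite /tri /= !addr_ge0// mulr_ge0 ?ctr_ge0// ltW.
  have := ler_wpM2r t0 c4; rewrite /tri /=; lra.
have ctr3 p : 0 <= ctr (1 - p.1%:~R - p.2%:~R) :> R.
  have k : 0 <= ctr (1 - p.1 - p.2)%:~R :> R by exact: ctr_ge0.
  by rewrite !(intrD, rmorphN) /= in k.
have fg0 p : 0 <= g p - f p.
  rewrite subr_ge0; apply: le_trans (fg p) _; rewrite ger_pMr ?mulr_gt0 ?expR_gt0//.
  rewrite -[leRHS](expR0 R) ler_expR oppr_le0; exact: mulr_ge0 (mulr_ge0 (ler0n R 4) s30) (ctr3 p).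
have h := hasumB hg hT.
have d0 := hasum_ge_sub (s := [::] : seq (int * int)) isT fg0 h.
pose sq : seq (int * int) := [:: (1, 1); (0, -1); (0, 2); (1, 2); (-1, 0); (2, 0); (2, 1)].
have d1 := hasum_ge_sub (s := sq) isT fg0 h.
rewrite big_nil in d0; rewrite /sq !big_cons big_nil in d1.
have E (i j : int) (a b d : nat) : ctr i%:~R = a%:R :> R -> ctr j%:~R = b%:R :> R ->
    ctr (1 - i%:~R - j%:~R) = d%:R :> R -> y1 ^+ a * y2 ^+ b * (1 - y3 ^+ d) <= g (i, j) - f (i, j).
  move=> ei ej ek; have := fg (i, j); rewrite /g /= ei ej ek.
  have X (s : R) (n : nat) : expR (- (4 * s * n%:R)) = expR (- (4 * s)) ^+ n.
    by rewrite -expRM_natl; congr expR; ring.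
  by rewrite !X -/y1 -/y2 -/y3; clear; lra.
have z1 : 1 - y3 <= g (1, 1) - f (1, 1).
  by have := @E 1 1 0%N 0%N 1%N; rewrite !expr0 !mul1r expr1; apply; rewrite /ctr /=; clear; lra.
have z2 : y2 * (1 - y3) <= g (0, -1) - f (0, -1).
  by have := @E 0 (-1) 0%N 1%N 1%N; rewrite !expr0 !mul1r !expr1; apply; rewrite /ctr /=; clear; lra.
have z3 : y2 * (1 - y3) <= g (0, 2) - f (0, 2).
  by have := @E 0 2 0%N 1%N 1%N; rewrite !expr0 !mul1r !expr1; apply; rewrite /ctr /=; clear; lra.
have z4 : y2 * (1 - y3 ^+ 3) <= g (1, 2) - f (1, 2).
  by have := @E 1 2 0%N 1%N 3%N; rewrite !expr0 !mul1r !expr1; apply; rewrite /ctr /=; clear; lra.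
have z5 : y1 * (1 - y3) <= g (-1, 0) - f (-1, 0).
  by have := @E (-1) 0 1%N 0%N 1%N; rewrite !expr0 !mulr1 !expr1; apply; rewrite /ctr /=; clear; lra.
have z6 : y1 * (1 - y3) <= g (2, 0) - f (2, 0).
  by have := @E 2 0 1%N 0%N 1%N; rewrite !expr0 !mulr1 !expr1; apply; rewrite /ctr /=; clear; lra.
have z7 : y1 * (1 - y3 ^+ 3) <= g (2, 1) - f (2, 1).
  by have := @E 2 1 1%N 0%N 3%N; rewrite !expr0 !mulr1 !expr1; apply; rewrite /ctr /=; clear; lra.
have A10 : 0 <= A1 by apply: le_trans (hasum_ge_sub (s := [::]) isT (fun _ => expR_ge0 _) hA1); rewrite big_nil.
have A20 : 0 <= A2 by apply: le_trans (hasum_ge_sub (s := [::]) isT (fun _ => expR_ge0 _) hA2); rewrite big_nil.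
have m1 := ler_pM A10 A20 b1 b2; have m2 := ler_pM A10 A20 c1 c2.
move: m1 m2; set B := 2 * _ * _; set C := 2 / _ * _ => m1 m2.
split; last by clear -m2 d0; lra.
apply: le_trans (_ : A1 * A2 - (1 - y3) - (y1 + y2) * (3 - 2 * y3 - y3 ^+ 3) <= _); last by rewrite !lerD2r.
move: d1 z1 z2 z3 z4 z5 z6 z7; rewrite -/f.
move: (g (1, 1) - _) (g (0, -1) - _) (g (0, 2) - _) (g (1, 2) - _) (g (-1, 0) - _) (g (2, 0) - _) (g (2, 1) - _).
by move: (A1 * A2) => AA *; lra.
Qed.

End Far.

Section FarNumeric.
Variable R : realType.
Implicit Types (x y c m k v w r : R).

Lemma exp03 : expR (3 / 10) <= 50 / 37 :> R.
Proof. by apply: expR_le_of; lra. Qed.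

Lemma exp03X (n : nat) x : x <= n%:R * (3 / 10) -> expR x <= (50 / 37) ^+ n.
Proof.
move=> h; apply: le_trans (_ : expR (n%:R * (3 / 10)) <= _); first by rewrite ler_expR.
rewrite expRM_natl; apply: lerXn2r; [by rewrite nnegrE expR_ge0|by rewrite nnegrE; lra|exact: exp03].
Qed.

(** Shows that the quartic of [far_gap] bounds exp (- 4 m) from above, by testing it against the
    quintic Taylor polynomial of exp (4 m). *)
Lemma far_poly m : 0 <= m -> m <= 82 / 10 / 10 ->
  1 <= (27 * 5 / 10 / 10 - 3 * m + 9 / 4 * m ^+ 2 - 3 / 4 * m ^+ 3 + 13 / 10 / 10 * m ^+ 4) *
   (1 + 4 * m + (4 * m) ^+ 2 / 2 + (4 * m) ^+ 3 / 6 + (4 * m) ^+ 4 / 24 + (4 * m) ^+ 5 / 30 / 4).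
Proof.
move=> m0 m1; case: (lerP m (1 / 2)) => m2.
  have q (n : nat) : m ^+ n.+1 <= m * (1 / 2) ^+ n.
    by rewrite exprS ler_wpM2l//; apply: lerXn2r; rewrite ?nnegrE; lra.
  have p (n : nat) : 0 <= m ^+ n by exact: exprn_ge0.
  have q3 := q 2%N; have q4 := q 3%N; have q5 := q 4%N; have q6 := q 5%N; have q8 := q 7%N.
  have p2 := p 2%N; have p7 := p 7%N; have p9 := p 9%N.
  rewrite !exprMn; lra.
pose u := 82 / 10 / 10 - m; have u0 : 0 <= u by rewrite /u; lra.
have u1 : u <= 32 / 10 / 10 by rewrite /u; lra.
have -> : m = 82 / 10 / 10 - u by rewrite /u; lra.
have q (n : nat) : u ^+ n.+1 <= u * (32 / 10 / 10) ^+ n.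
  by rewrite exprS ler_wpM2l//; apply: lerXn2r; rewrite ?nnegrE; lra.
have p (n : nat) : 0 <= u ^+ n by exact: exprn_ge0.
have q2 := q 1%N; have q3 := q 2%N; have q5 := q 4%N; have q7 := q 6%N; have q9 := q 8%N.
have p4 := p 4%N; have p6 := p 6%N; have p8 := p 8%N.
clear q p; lra.
Qed.

(** With m = s3 and k = sqrt (4 + m^2), 3/4 k^2 (k - m) is 12 times the squared circumradius in the
    isosceles case s1 = s2. The term exp (- 4 m) is the largest correction of the other series. *)
Lemma far_gap m k sg : 0 <= m -> m <= 82 / 10 / 10 -> 0 <= k -> k ^+ 2 = 4 + m ^+ 2 ->
  0 < sg -> 3 * sg ^+ 2 = 4 ->
  31 / 10 / 10 / 10 <= 3 / 4 * (4 + m ^+ 2) * (k - m) - 4 * sg - expR (- (4 * m)).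
Proof.
move=> m0 m1 k0 k2 sg0 sgE.
have sg1 : 4 * sg <= 31 * 149 / 10 / 10 / 10.
  have : sg <= 31 * 149 / 4 / 10 / 10 / 10 by rewrite -ler_sqr ?nnegrE; lra.
  lra.
have kl : 2 + m ^+ 2 / 4 - m ^+ 4 / 64 <= k.
  have m2 : m ^+ 2 <= 1 by rewrite -(expr1n R 2) ler_sqr ?nnegrE; lra.
  have m20 := sqr_ge0 m.
  have m4 : m ^+ 4 = m ^+ 2 * m ^+ 2 by rewrite -exprD.
  rewrite -ler_sqr ?nnegrE//; last by rewrite m4; nra.
  rewrite k2 m4; move: (m ^+ 2) m2 m20 => z z1 z0.
  have : 0 <= z ^+ 3 * (32 - z) by apply: mulr_ge0; [exact: exprn_ge0|lra].
  lra.
have e : expR (- (4 * m)) <= 27 * 5 / 10 / 10 - 3 * m + 9 / 4 * m ^+ 2 - 3 / 4 * m ^+ 3 + 13 / 10 / 10 * m ^+ 4.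
  have m40 : 0 <= 4 * m by lra.
  have q := expR_ge5 m40; have := far_poly m0 m1.
  set Q := 1 + _ + _ + _ + _ + _; set P := _ + 13 / 10 / 10 * _ => h.
  have Q0 : 0 < Q.
    by rewrite /Q; do 5 (apply: ltr_pwDl; last by rewrite ?divr_ge0 ?exprn_ge0).
  apply: le_trans (expR_le_inv Q0 q) _.
  by rewrite -div1r ler_pdivrMr.
have z0 : 0 <= 3 / 4 * (4 + m ^+ 2) by have := sqr_ge0 m; lra.
have km : 2 + m ^+ 2 / 4 - m ^+ 4 / 64 - m <= k - m by rewrite lerD2r.
have := ler_wpM2l z0 km.
have m40 : 0 <= m ^+ 4 by exact: exprn_ge0.
have m6 : m ^+ 6 <= m ^+ 4 * (82 / 10 / 10) ^+ 2.
  have m2 : m ^+ 2 <= (82 / 10 / 10) ^+ 2 by rewrite ler_sqr ?nnegrE; lra.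
  have -> : m ^+ 6 = m ^+ 4 * m ^+ 2 by rewrite -exprD.
  exact: ler_wpM2l.
lra.
Qed.

Lemma far_theta m k : 0 <= m -> m <= 82 / 10 / 10 -> 2 <= k -> k ^+ 2 = 4 + m ^+ 2 ->
  expR (- (4 * (k - m))) <= 47 / 10 / 10 / 10 / 10 /\
  expR (- (4 * (k - m))) * expR (- (4 * m)) <= 36 / 10 / 10 / 10 / 10 / 10.
Proof.
move=> m0 m1 k0 k2; split.
  have km : 9 * 149 / 10 / 10 / 10 + m <= k by rewrite -ler_sqr ?nnegrE; [rewrite k2; nra|lra|lra].
  apply: le_trans (_ : expR (12%:R * - (3 * 149 / 10 / 10 / 10)) <= _); first by rewrite ler_expR; lra.
  rewrite expRM_natl; apply: le_trans (_ : (71 / 3 / 37) ^+ 12 <= _); last by lra.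
  apply: lerXn2r; [by rewrite nnegrE expR_ge0|by rewrite nnegrE; lra|].
  apply: le_trans (expR_le_inv _ (expR_ge4 _)) _; [lra|lra|].
  by rewrite invf_ple ?posrE; lra.
rewrite -expRD; apply: le_trans (_ : expR (8%:R * - 1) <= _); first by rewrite ler_expR; lra.
rewrite expRM_natl; apply: le_trans (_ : (10 / 27) ^+ 8 <= _); last by lra.
apply: lerXn2r; [by rewrite nnegrE expR_ge0|by rewrite nnegrE; lra|].
apply: le_trans (expR_le_inv _ (expR_ge4 _)) _; [lra|lra|].
by rewrite invf_ple ?posrE; lra.
Qed.

(** v = k - w measures the deviation from s1 = s2. The circumradius gains quadratically in v, while
    exp (- 4 s2) grows like exp (4 v); the two are compared on successive intervals of v, with exp
    (4 v) bounded by powers of 50/37 > exp (3/10). *)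
Lemma far_profile k v w : 2 <= k -> k <= 5 * 433 / 10 / 10 / 10 -> 0 <= v -> w = k - v -> 9 / 10 <= w ->
  66 / 10 / 10 / 10 / 10 * (1 + expR (4 * v)) < 31 / 10 / 10 / 10 + 3 / 8 * k ^+ 2 * v ^+ 2 / w.
Proof.
move=> k1 k3 v0 wE w9; have w0 : 0 < w by lra.
have v2 := sqr_ge0 v.
have E : 3 / 8 * k ^+ 2 * v ^+ 2 / w = 3 / 8 * (k ^+ 2 / w) * v ^+ 2 by field; lra.
have kw : 2 <= k ^+ 2 / w by rewrite ler_pdivlMr//; nra.
rewrite E; case: (lerP v (9 / 10)) => v9.
  have h : 3 / 4 * v ^+ 2 <= 3 / 8 * (k ^+ 2 / w) * v ^+ 2 by rewrite ler_wpM2r//; clear -kw; lra.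
  have cases (n : nat) (a : R) : 0 <= a -> a <= v -> v <= n%:R * (3 / 40) ->
      66 / 10 / 10 / 10 / 10 * (1 + (50 / 37) ^+ n) < 31 / 10 / 10 / 10 + 3 / 4 * a ^+ 2 ->
      66 / 10 / 10 / 10 / 10 * (1 + expR (4 * v)) < 31 / 10 / 10 / 10 + 3 / 8 * (k ^+ 2 / w) * v ^+ 2.
    move=> a0 av vn num; have v4 : 4 * v <= n%:R * (3 / 10) by clear -vn; lra.
    have := exp03X v4; have : a ^+ 2 <= v ^+ 2 by rewrite ler_sqr ?nnegrE.
    by move: num; clear -h; move=> num av2 e4; lra.
  case: (lerP v (3 / 10)) => v3; first by apply: (cases 4%N 0); clear -v0 v3; lra.
  case: (lerP v (6 / 10)) => v6; first by apply: (cases 8%N (3 / 10)); clear -v3 v6; lra.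
  by apply: (cases 12%N (6 / 10)); clear -v6 v9; lra.
have kw2 : 3 <= k ^+ 2 / w by rewrite ler_pdivlMr//; nra.
have h : 9 / 8 * v ^+ 2 <= 3 / 8 * (k ^+ 2 / w) * v ^+ 2 by rewrite ler_wpM2r//; clear -kw2; lra.
have cases (n : nat) (a : R) : 0 <= a -> a <= v -> v <= n%:R * (3 / 40) ->
    66 / 10 / 10 / 10 / 10 * (1 + (50 / 37) ^+ n) < 31 / 10 / 10 / 10 + 9 / 8 * a ^+ 2 ->
    66 / 10 / 10 / 10 / 10 * (1 + expR (4 * v)) < 31 / 10 / 10 / 10 + 3 / 8 * (k ^+ 2 / w) * v ^+ 2.
  move=> a0 av vn num; have v4 : 4 * v <= n%:R * (3 / 10) by clear -vn; lra.
  have := exp03X v4; have : a ^+ 2 <= v ^+ 2 by rewrite ler_sqr ?nnegrE.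
  by move: num; clear -h; move=> num av2 e4; lra.
case: (lerP v (25 * 15 * 3 / 10 / 10 / 10)) => v1; first by apply: (cases 15%N (9 / 10)); clear -v9 v1; lra.
by apply: (cases 17%N (25 * 15 * 3 / 10 / 10 / 10)); rewrite ?ltW//; clear -k3 wE w9 v1; lra.
Qed.

Lemma far_rest (y1 y2 y3 T : R) : 0 < y1 -> y1 <= 47 / 10 / 10 / 10 / 10 -> 0 < y2 -> y2 <= 2 * 83 / 10 / 10 / 10 ->
  0 <= y3 -> y3 <= 1 ->
  T <= 2 * (1 + y1 + y1 ^+ 3 + y1 ^+ 6 + y1 ^+ 4 / (1 - y1)) * (2 * (1 + y2 + y2 ^+ 3 + y2 ^+ 6 + y2 ^+ 4 / (1 - y2)))
     - (1 - y3) - (y1 + y2) * (3 - 2 * y3 - y3 ^+ 3) ->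
  T - 3 <= y3 + (y1 + y2) * (29 * 4 / 10 / 10 + 3 * y3).
Proof.
move=> y10 y11 y20 y21 y30 y31 hT.
have tail (y a b : R) : 0 < y -> y <= a -> a <= 1 / 2 ->
      (a ^+ 2 + a ^+ 5) * (1 - a) + a ^+ 3 <= b * (1 - a) ->
    y ^+ 3 + y ^+ 6 + y ^+ 4 / (1 - y) <= b * y.
  move=> y0 ya a1 hb'; have hb : a ^+ 2 + a ^+ 5 + a ^+ 3 / (1 - a) <= b.
    by rewrite -(@ler_pM2r _ (1 - a)) ?mulrDl ?divfK -?mulrDl//; lra.
  have py (n : nat) : y ^+ n <= a ^+ n by apply: lerXn2r; rewrite ?nnegrE; lra.
  rewrite (_ : _ + _ = (y ^+ 2 + y ^+ 5 + y ^+ 3 / (1 - y)) * y); last by field; lra.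
  rewrite ler_pM2r//; apply: le_trans hb; apply: lerD; first by apply: lerD; exact: py.
  apply: ler_pM; [by rewrite exprn_ge0// ltW|by rewrite invr_ge0; lra|exact: py|].
  by rewrite lef_pV2 ?posrE; lra.
have z1 : y1 ^+ 3 + y1 ^+ 6 + y1 ^+ 4 / (1 - y1) <= 1 / 10 / 10 / 10 * y1.
  by apply: (@tail _ (1 / 10 / 10)); lra.
have z2 : y2 ^+ 3 + y2 ^+ 6 + y2 ^+ 4 / (1 - y2) <= 9 * 37 / 10 / 10 / 10 / 10 * y2.
  by apply: (@tail _ (2 * 83 / 10 / 10 / 10)); lra.
have z10 : 0 <= y1 ^+ 3 + y1 ^+ 6 + y1 ^+ 4 / (1 - y1).
  by rewrite !addr_ge0 ?exprn_ge0 ?divr_ge0 ?exprn_ge0//; lra.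
have z20 : 0 <= y2 ^+ 3 + y2 ^+ 6 + y2 ^+ 4 / (1 - y2).
  by rewrite !addr_ge0 ?exprn_ge0 ?divr_ge0 ?exprn_ge0//; lra.
move: hT; rewrite -!addrA !addrA.
set Z1 := y1 ^+ 3 + _ + _ in z1 z10; set Z2 := y2 ^+ 3 + _ + _ in z2 z20.
rewrite (_ : 1 + y1 + _ + _ + _ = 1 + y1 + Z1); last by rewrite /Z1; ring.
rewrite (_ : 1 + y2 + _ + _ + _ = 1 + y2 + Z2); last by rewrite /Z2; ring.
move=> hT.
have m : (y1 + Z1) * (y2 + Z2) <= 3 * 157 / 10 / 10 / 10 / 10 / 10 * (22 * 47 / 10 / 10 / 10 * y2).
  by apply: ler_pM; lra.
have y33 : y3 ^+ 3 <= y3 by rewrite -[leRHS]expr1 ler_wiXn2l.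
have := ler_wpM2l (ltW (addr_gt0 y10 y20)) y33.
lra.
Qed.

(** r stands for 1 / w; 4.005 exceeds 4 / 0.999, where 0.999 is a lower bound of 1 - exp (- 4 s1),
    and 1.54 bounds 4 sg / 3. *)
Lemma thin_far r : 3 * 37 / 10 / 10 <= r ->
  15 * 3 * 89 / 10 / 10 / 10 * (1 + r ^+ 2 / (2 * (1 + r))) < 3 * expR (2 * r - 22 * 7 / 10 / 10).
Proof.
move=> hr; apply: lt_le_trans (_ : 3 * (1 + (2 * r - 22 * 7 / 10 / 10) + (2 * r - 22 * 7 / 10 / 10) ^+ 2 / 2) <= _); last first.
  by rewrite ler_pM2l//; apply: expR_ge2; lra.
have : r ^+ 2 / (2 * (1 + r)) <= r / 2 - 26 / 10 / 10 by rewrite ler_pdivrMr; [nra|lra].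
nra.
Qed.

End FarNumeric.

Section PrimalFar.
Variable R : realType.
Implicit Types (c m k v w r sg : R).

Lemma circ2_w (s1 s2 s3 : R) (w := s2 + s3) : 0 < w -> s1 * s2 + s2 * s3 + s3 * s1 = 4 ->
  circ2 (s1, s2, s3) = (4 + s3 ^+ 2) * (4 + s2 ^+ 2) / (32 * w).
Proof.
move=> w0 det; have wn : w != 0 by exact: lt0r_neq0.
have -> : circ2 (s1, s2, s3) = ((s1 + s3) * w) * ((s1 + s2) * w) / (32 * w).
  by rewrite /circ2 /= /w; field; exact: wn.
have -> : (s1 + s3) * w = 4 + s3 ^+ 2 by rewrite /w; lra.
by have -> : (s1 + s2) * w = 4 + s2 ^+ 2 by rewrite /w; lra.
Qed.

(** As w decreases, the product bound for the series grows like 1 / w only, whereas the squared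
    circumradius is at least 1 / (2 w) and stands in an exponent. *)
Lemma far_small (c s1 s2 s3 sg T : R) (w := s2 + s3) : 4 <= c -> 0 < sg -> 3 * sg ^+ 2 = 4 ->
  s1 * s2 + s2 * s3 + s3 * s1 = 4 -> 0 <= s3 -> s3 <= s2 -> s2 <= s1 -> 0 < w -> w <= 9 / 10 ->
  hasum (fun p => expR (- (c * tri (s1, s2, s3) p))) T ->
  T < 3 * expR (4 * (circ2 (s1, s2, s3) - sg / 3)).
Proof.
move=> c4 g0 gE det s30 s32 s21 w0 w9 hT.
have s20 : 0 < s2 by move: w0; rewrite /w; lra.
have s10 : 0 < s1 by lra.
have [_ hTT] := tri_far c4 s10 s20 s30 hT.
have g1 : sg <= 21 * 11 * 5 / 10 / 10 / 10 by rewrite -ler_sqr ?nnegrE; lra.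
pose r := w^-1; have r0 : 0 < r by rewrite invr_gt0.
have wr : w * r = 1 by rewrite divff// lt0r_neq0.
have r1 : 3 * 37 / 10 / 10 <= r by rewrite -(ler_pM2l w0) wr; lra.
have s12 : 2 <= s1.
  rewrite leNgt; apply/negP => s12.
  have : s1 * w < 2 * w by rewrite ltr_pM2r.
  have : s2 * s3 <= 9 / 10 * (9 / 10).
    by apply: ler_pM => //; move: w9; rewrite /w; lra.
  by move: det w9; rewrite /w; lra.
have y1 : expR (- (4 * s1)) <= 1 / 10 / 10 / 10.
  have [_] := @far_theta R 0 2 (lexx 0) ltac:(lra) (lexx 2) ltac:(lra).
  rewrite mulr0 oppr0 expR0 mulr1 addr0 => h.
  by apply: le_trans (_ : expR (- (4 * 2)) <= _); [rewrite ler_expR; lra|lra].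
have y2 : expR (- (4 * s2)) <= (1 + 2 * w + (2 * w) ^+ 2 / 2)^-1.
  apply: le_trans (_ : expR (- (2 * w)) <= _); first by rewrite ler_expR /w; lra.
  by apply: expR_le_inv; [have := sqr_ge0 (2 * w); lra|apply: expR_ge2; lra].
have i1 : (1 - expR (- (4 * s1)))^-1 <= 10 * 10 * 10 / 27 / 37 by rewrite invf_ple ?posrE; clear -y1; lra.
have q0 : 0 < 1 + 2 * w + (2 * w) ^+ 2 / 2 by have := sqr_ge0 (2 * w); lra.
have i2 : (1 - expR (- (4 * s2)))^-1 <= 1 + r ^+ 2 / (2 * (1 + r)).
  apply: le_trans (_ : (1 - (1 + 2 * w + (2 * w) ^+ 2 / 2)^-1)^-1 <= _).
    have q1 : (1 + 2 * w + (2 * w) ^+ 2 / 2)^-1 < 1.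
      by rewrite invf_lt1//; have := sqr_ge0 (2 * w); lra.
    by rewrite lef_pV2 ?posrE; clear -y2 q1; lra.
  have q10 : 0 < 2 * w + 2 * w ^+ 2 by have := sqr_ge0 w; lra.
  have w1 : 0 < w + 1 by lra.
  rewrite le_eqVlt; apply/orP; left; apply/eqP; rewrite /r.
  have n1 := lt0r_neq0 w0; have n2 := lt0r_neq0 w1; have n3 := lt0r_neq0 q0; have n4 := lt0r_neq0 q10.
  transitivity ((1 + 2 * w + 2 * w ^+ 2) / (2 * w + 2 * w ^+ 2)).
    rewrite (_ : 1 + 2 * w + (2 * w) ^+ 2 / 2 = 1 + 2 * w + 2 * w ^+ 2) in n3 *; last by clear; lra.
    rewrite -invf_div; congr (_^-1); apply: (mulIf n3); rewrite mulrBl mul1r mulVf// divfK//; ring.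
  by field; rewrite n1 n2 n4.
apply: le_lt_trans hTT _.
apply: lt_trans (_ : 15 * 3 * 89 / 10 / 10 / 10 * (1 + r ^+ 2 / (2 * (1 + r))) < _).
  have p2 : 0 < (1 - expR (- (4 * s2)))^-1.
    rewrite invr_gt0 subr_gt0; apply: le_lt_trans y2 _.
    by rewrite invf_lt1//; have := sqr_ge0 (2 * w); lra.
  have := ler_wpM2r (ltW p2) i1.
  move: i2 p2; move: ((1 - expR (- (4 * s1)))^-1) ((1 - expR (- (4 * s2)))^-1) (r ^+ 2 / _) => *; lra.
apply: lt_le_trans (thin_far r1) _.
rewrite ler_pM2l// ler_expR.
have : 16 * r <= 32 * circ2 (s1, s2, s3).
  rewrite circ2_w// -/w.
  have -> : 32 * ((4 + s3 ^+ 2) * (4 + s2 ^+ 2) / (32 * w)) = (4 + s3 ^+ 2) * (4 + s2 ^+ 2) * r.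
    by rewrite /r; field; exact: lt0r_neq0.
  rewrite ler_wpM2r//; first exact: ltW.
  by have := sqr_ge0 s2; have := sqr_ge0 s3; nra.
lra.
Qed.

Lemma expR_9_5_le : expR (2%:R * - (9 / 10)) <= 2 * 83 / 10 / 10 / 10 :> R.
Proof.
rewrite expRM_natl; apply: le_trans (_ : (11 * 37 / 10 / 10 / 10) ^+ 2 <= _); last by lra.
apply: lerXn2r; [by rewrite nnegrE expR_ge0|by rewrite nnegrE; lra|].
apply: le_trans (expR_le_inv _ (expR_ge5 _)) _; [lra|lra|].
by rewrite invf_ple ?posrE; lra.
Qed.

(** After exp y >= 1 + y it suffices that T - 3 < 12 circ2 - 4 sg. For fixed s3 the right side is
    the isosceles value of [far_gap] plus a multiple of v^2 / w, and exp (- 4 s2) = th exp (4 v) is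
    matched against it. *)
Lemma far_large (c s1 s2 s3 sg T : R) (w := s2 + s3) : 4 <= c -> 0 < sg -> 3 * sg ^+ 2 = 4 ->
  s1 * s2 + s2 * s3 + s3 * s1 = 4 -> 0 <= s3 -> s3 <= 82 / 10 / 10 -> s3 <= s2 -> s2 <= s1 -> 9 / 10 <= w ->
  hasum (fun p => expR (- (c * tri (s1, s2, s3) p))) T ->
  T < 3 * expR (4 * (circ2 (s1, s2, s3) - sg / 3)).
Proof.
move=> c4 g0 gE det s30 s3m s32 s21 w9 hT.
have w0 : 0 < w by lra.
have s20 : 0 < s2 by move: w0; rewrite /w; lra.
have s10 : 0 < s1 by lra.
have [hTT _] := tri_far c4 s10 s20 s30 hT.
pose K := 4 + s3 ^+ 2; pose k := Num.sqrt K; pose v := k - w.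
have K0 : 0 <= K by rewrite /K; have := sqr_ge0 s3; lra.
have k2 : k ^+ 2 = K by exact: sqr_sqrtr.
have k0 : 0 <= k by exact: sqrtr_ge0.
have k2l : 2 <= k by rewrite -ler_sqr ?nnegrE// k2 /K; have := sqr_ge0 s3; lra.
have k2u : k <= 5 * 433 / 10 / 10 / 10.
  rewrite -ler_sqr ?nnegrE ?k2 /K; [|lra|lra].
  have : s3 ^+ 2 <= (82 / 10 / 10) ^+ 2 by rewrite ler_sqr ?nnegrE; lra.
  lra.
have v0 : 0 <= v.
  rewrite /v subr_ge0 -ler_sqr ?nnegrE ?k2 /K; [|lra|lra].
  have := ler_wpM2r (ltW s20) s21; have := ler_wpM2l s30 s21; rewrite /w; lra.
pose th := expR (- (4 * (k - s3))); have th0 : 0 < th by exact: expR_gt0.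
have [th1 th2] := far_theta s30 s3m k2l k2; rewrite -/th in th1 th2.
have gap := far_gap s30 s3m k0 k2 g0 gE.
have prof := far_profile k2l k2u v0 (_ : w = k - v) w9.
have {}prof := prof ltac:(rewrite /v; clear; ring).
set y1 := expR (- (4 * s1)) in hTT; set y2 := expR (- (4 * s2)) in hTT; set y3 := expR (- (4 * s3)) in hTT th2 gap.
have y10 : 0 < y1 by exact: expR_gt0.
have y20 : 0 < y2 by exact: expR_gt0.
have y30 : 0 < y3 by exact: expR_gt0.
have y31 : y3 <= 1 by rewrite -[leRHS](expR0 R) ler_expR; clear -s30; lra.
have y1t : y1 <= th.
  rewrite ler_expR; suff : k <= s1 + s3 by clear; lra.
  rewrite -(ler_pM2r w0).
  have : (s1 + s3) * w = k ^+ 2 by rewrite k2 /K /w; clear -det; lra.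
  by move=> ->; rewrite expr2 ler_wpM2l//; move: v0; rewrite /v; clear; lra.
have y2t : y2 = th * expR (4 * v) by rewrite -expRD; congr expR; rewrite /v /w; clear; lra.
have y2u : y2 <= 2 * 83 / 10 / 10 / 10.
  apply: le_trans (_ : expR (2%:R * - (9 / 10)) <= _).
    by rewrite ler_expR; move: w9; rewrite /w; clear -s32 s21 s30; lra.
  exact: expR_9_5_le.
have rest := far_rest y10 (le_trans y1t th1) y20 y2u (ltW y30) y31 hTT.
apply: lt_le_trans (_ : 3 * (1 + 4 * (circ2 (s1, s2, s3) - sg / 3)) <= _); last first.
  by rewrite ler_pM2l//; exact: expR_ge1Dx.
have cE : 12 * circ2 (s1, s2, s3) = 3 / 4 * (4 + s3 ^+ 2) * (k - s3) + 3 / 8 * k ^+ 2 * v ^+ 2 / w.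
  rewrite circ2_w// -/w -/K -k2 (_ : 4 + s2 ^+ 2 = k ^+ 2 + w ^+ 2 - 2 * w * s3); last by rewrite k2 /K /w; ring.
  by rewrite /v; field; exact: lt0r_neq0.
have ev := expR_ge0 (4 * v).
have fin : (y1 + y2) * (29 * 4 / 10 / 10 + 3 * y3) <= 66 / 10 / 10 / 10 / 10 * (1 + expR (4 * v)).
  apply: le_trans (_ : (th + th * expR (4 * v)) * (29 * 4 / 10 / 10 + 3 * y3) <= _).
    by rewrite ler_wpM2r ?y2t ?lerD2r//; clear -y30; lra.
  rewrite (_ : (th + th * expR (4 * v)) * (29 * 4 / 10 / 10 + 3 * y3) =
    (29 * 4 / 10 / 10 * th + 3 * (th * y3)) * (1 + expR (4 * v))); last by ring.
  by rewrite ler_wpM2r//; lra.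
move: rest fin prof gap cE; clear; move=> rest fin prof gap cE; lra.
Qed.

Lemma primal_strict (c s1 s2 s3 sg Ts T0 : R) : 4 <= c -> 0 < sg -> 3 * sg ^+ 2 = 4 ->
  selling (s1, s2, s3) -> s3 <= s2 -> s2 <= s1 -> (s1, s2, s3) <> (sg, sg, sg) ->
  hasum (fun p => expR (- (c * tri (s1, s2, s3) p))) Ts ->
  hasum (fun p => expR (- (c * tri (sg, sg, sg) p))) T0 ->
  expR (- (c * circ2 (s1, s2, s3))) * Ts < expR (- (c * sg / 3)) * T0.
Proof.
move=> c4 g0 gE [/= _ _ s30 det] s32 s21 neq hTs hT0.
case: (lerP (82 / 10 / 10) s3) => s3m; first exact: (primal_near c4 g0 gE det s3m s32 s21 neq hTs hT0).
have w0 : 0 < s2 + s3 by nra.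
have lt : Ts < 3 * expR (4 * (circ2 (s1, s2, s3) - sg / 3)).
  case: (lerP (s2 + s3) (9 / 10)) => w9; first exact: (far_small c4 g0 gE det s30 s32 s21 w0 w9 hTs).
  exact: (far_large c4 g0 gE det s30 (ltW s3m) s32 s21 (ltW w9) hTs).
set rho := circ2 _ - _ in lt.
(* From 3 <= Ts < 3 exp (4 rho); hence c = 4 is the worst case of c >= 4. *)
have rho0 : 0 <= rho.
  rewrite leNgt; apply/negP => r0; have := tri_ge3 hTs.
  have : expR (4 * rho) < 1 by rewrite -[ltRHS](expR0 R) ltr_expR; lra.
  lra.
have -> : expR (- (c * sg / 3)) = expR (- (c * circ2 (s1, s2, s3))) * expR (c * rho).
  by rewrite -expRD; congr expR; rewrite /rho; lra.
rewrite -mulrA ltr_pM2l ?expR_gt0//; apply: lt_le_trans lt _.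
rewrite mulrC; apply: ler_pM; rewrite ?expR_ge0//; last exact: tri_ge3 hT0.
by rewrite ler_expR ler_wpM2r.
Qed.

End PrimalFar.

(** * Lattices *)

Section Energy.
Variable R : realType.
Implicit Types (c x y sg : R).

Definition energy c (s : R * R * R) x y (E : R) : Prop :=
  hasum (fun p : int * int => expR (- (c * quad s (p.1%:~R + x) (p.2%:~R + y)))) E.

Lemma selling_hex sg : 0 < sg -> 3 * sg ^+ 2 = 4 -> selling (sg, sg, sg).
Proof. by move=> g0 gE; split=> /=; try exact: ltW; lra. Qed.

Lemma energy_exists c s x y : 0 < c -> selling s -> exists E, energy c s x y E.
Proof.
move=> c0 hs; have [U U0 hU] := central_ratio_cvg R.
by have [D hD _] := poisson_plane U0 hU x y c0 hs; exists (U / c * D).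
Qed.

Lemma energy_tri c s1 s2 s3 E : s1 * s2 + s2 * s3 + s3 * s1 = 4 ->
  energy c (s1, s2, s3) (- (s1 * (s2 + s3) / 8)) (s2 * (s1 + s3) / 8) E ->
  hasum (fun p => expR (- (c * tri (s1, s2, s3) p))) (expR (c * circ2 (s1, s2, s3)) * E).
Proof.
move=> det hE.
have K : cancel (fun p : int * int => (p.1, - p.2)) (fun p => (p.1, - p.2)).
  by move=> [i j] /=; rewrite opprK.
apply: eq_hasum (hasumZ (expR (c * circ2 (s1, s2, s3))) (hasum_bij K K hE)) => -[i j] /=.
by rewrite quad_circ// opprK -expRD; congr expR; ring.
Qed.

(** pi^2 >= 9.79 and sg >= 15/13 give t sg >= 2.824. The second claim is separate since exp (-2.8)
    slightly exceeds 0.06. *)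
Lemma dual_parameter c sg : 0 < c -> c < 4 -> 0 < sg -> 3 * sg ^+ 2 = 4 ->
  14 / 5 <= pi ^+ 2 / c * sg /\ expR (- (pi ^+ 2 / c * sg)) <= 6 / 10 / 10.
Proof.
move=> c0 c4 g0 gE.
have g1 : 15 / 13 <= sg by rewrite -ler_sqr ?nnegrE; lra.
have p2 : 11 * 89 / 10 / 10 <= (pi : R) ^+ 2.
  have h := pi_ge313 R; have h0 : 0 <= 313 / 10 / 10 :> R by lra.
  by have := ler_pM h0 h0 h h; rewrite expr2; apply: le_trans; lra.
have t2 : 11 * 89 / 10 / 10 / 4 <= pi ^+ 2 / c.
  rewrite (ler_pdivlMr _ _ c0); apply: le_trans p2; lra.
have t3 : 353 / 25 / 5 <= pi ^+ 2 / c * sg.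
  apply: le_trans (_ : 11 * 89 / 10 / 10 / 4 * (15 / 13) <= _); first lra.
  by apply: ler_pM; lra.
move: t3; move: (_ / c * sg) => z t3.
split; first by lra.
apply: le_trans (_ : expR (4%:R * - (353 / 25 / 20)) <= _); first by rewrite ler_expR; lra.
rewrite expRM_natl; apply: le_trans (_ : (42 / 85) ^+ 4 <= _); last by lra.
apply: lerXn2r; [by rewrite nnegrE expR_ge0|by rewrite nnegrE; lra|].
apply: le_trans (expR_le_inv _ (expR_ge4 _)) _; [lra|lra|].
by rewrite invf_ple ?posrE; lra.
Qed.

Lemma energy_strict c sg s1 s2 s3 : 0 < c -> 0 < sg -> 3 * sg ^+ 2 = 4 ->
  selling (s1, s2, s3) -> s3 <= s2 -> s2 <= s1 -> (s1, s2, s3) <> (sg, sg, sg) ->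
  exists x y E B, [/\ energy c (s1, s2, s3) x y E, E < B &
    forall x y E, energy c (sg, sg, sg) x y E -> B <= E].
Proof.
move=> c0 g0 gE sel s32 s21 neq; have hsel := selling_hex g0 gE.
have [/= _ _ _ det] := sel; have [/= _ _ _ hdet] := hsel.
have [U U0 hU] := central_ratio_cvg R.
case: (lerP 4 c) => c4.
  have G : 23 / 5 <= c * sg.
    have g1 : 15 / 13 <= sg by rewrite -ler_sqr ?nnegrE; lra.
    by have := ler_pM _ _ c4 g1; lra.
  have [E hE] := energy_exists (- (s1 * (s2 + s3) / 8)) (s2 * (s1 + s3) / 8) c0 sel.
  have [E0 hE0] := energy_exists (- (sg * (sg + sg) / 8)) (sg * (sg + sg) / 8) c0 hsel.
  have hT := energy_tri det hE; have hT0 := energy_tri hdet hE0.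
  have lt := primal_strict c4 g0 gE sel s32 s21 neq hT hT0.
  exists (- (s1 * (s2 + s3) / 8)), (s2 * (s1 + s3) / 8), E, (expR (- (c * sg / 3)) * (expR (c * circ2 (sg, sg, sg)) * E0)).
  split => //; first by move: lt; rewrite mulrA -expRD addNr expR0 mul1r.
  by move=> x y E' hE'; exact: hex_primal_min G hE' hT0.
have [ht h06] := dual_parameter c0 c4 g0 gE; set t := pi ^+ 2 / c in ht h06.
have t0 : 0 < t by rewrite divr_gt0// exprn_gt0// pi_gt0.
have Uc : 0 < U / c by rewrite divr_gt0.
have [D0 _ hD0] := poisson_plane U0 hU (1 / 3) (- 1 / 3) c0 hsel.
have {}hD0 := eq_hasum (fun p => congr1 (fun z => _ * z) (cos_chi3 R p)) hD0.
have nD := @dual_strict R t sg s1 s2 s3 D0 t0 g0 gE sel s32 s21 ht h06 neq hD0.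
have [x [y nxy]] : exists x y, forall D, hasum (fun p : int * int =>
    expR (- (t * quad_dual (s1, s2, s3) p.1%:~R p.2%:~R)) *
    cos (2 * pi * (p.1%:~R * x + p.2%:~R * y))) D -> D < D0.
  apply/not_existsP => h; apply: nD => x y.
  have [D _ hD] := poisson_plane U0 hU x y c0 sel; exists D => //.
  rewrite leNgt; apply/negP => lt; apply: (h x); exists y => D' hD'.
  by rewrite (hasum_unique hD' hD).
have [D hE hD] := poisson_plane U0 hU x y c0 sel.
exists x, y, (U / c * D), (U / c * D0); split => //; first by rewrite ltr_pM2l// nxy.
move=> x' y' E' hE'; have [D' hE'' hD'] := poisson_plane U0 hU x' y' c0 hsel.
rewrite (hasum_unique hE' hE'') ler_pM2l//.
exact: hex_dual_min g0 h06 hD' hD0.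
Qed.

End Energy.

(** * Bases, covolumes and Gram data *)

Section Lattices.
Variable R : realType.
Implicit Types (M H : 'M[R]_2) (U : 'M[int]_2) (V x y : R).

Lemma det2 (K : comNzRingType) (M : 'M[K]_2) : \det M = M 0 0 * M 1 1 - M 0 1 * M 1 0.
Proof.
rewrite (expand_det_row _ 0) !big_ord_recl big_ord0 /cofactor !det_mx11 !mxE /= addr0.
rewrite expr0 expr1 mul1r mulN1r mulrN.
by congr (M _ _ * M _ _ - M _ _ * M _ _); apply: val_inj.
Qed.

Definition bas M U : 'M[R]_2 := M *m map_mx intr U.

(** The arguments run by columns: (p, q) and (r, t) are the coordinates of the new basis vectors. *)
Definition int_mx (p q r t : int) : 'M[int]_2 :=
  \matrix_(i < 2, j < 2) if i == 0 then (if j == 0 then p else r) else (if j == 0 then q else t).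

Lemma ord2E (P : 'I_2 -> Prop) : P 0 -> P 1 -> forall i, P i.
Proof.
move=> p0 p1 i; have [e|e] : i = 0 \/ i = 1.
  by case: i => -[|[|//]] hi; [left|right]; apply: val_inj.
  by rewrite e.
by rewrite e.
Qed.

Lemma basE M U i j : bas M U i j = M i 0 * (U 0 j)%:~R + M i 1 * (U 1 j)%:~R.
Proof.
rewrite /bas mxE !big_ord_recl big_ord0 addr0 !mxE.
by congr (M _ _ * (U _ _)%:~R + M _ _ * (U _ _)%:~R); apply: val_inj.
Qed.

Lemma basM M U U' : bas M (U *m U') = bas (bas M U) U'.
Proof. by rewrite /bas map_mxM mulmxA. Qed.

Lemma bas1 M : bas M 1%:M = M.
Proof. by rewrite /bas map_mx1 mulmx1. Qed.

Lemma det_bas M U : \det (bas M U) = \det M * (\det U)%:~R.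
Proof. by rewrite /bas det_mulmx det_map_mx. Qed.

Lemma lattice_bas_sub M U : lattice (bas M U) `<=` lattice M.
Proof.
move=> p [k [l ->]]; exists (U 0 0 * k + U 0 1 * l), (U 1 0 * k + U 1 1 * l).
by rewrite /lat_pt !basE !(intrD, intrM); congr (_, _); ring.
Qed.

Definition unimodular U := \det U = 1 \/ \det U = -1.

(** The inverse of U is \det U times its adjugate, again an integer matrix. *)
Lemma lattice_bas M U : unimodular U -> lattice (bas M U) = lattice M.
Proof.
move=> uU; apply/seteqP; split; first exact: lattice_bas_sub.
have -> : lattice M = lattice (bas (bas M U) (\det U *: \adj U)).
  rewrite -basM -scalemxAr mul_mx_adj scale_scalar_mx.
  have -> : \det U * \det U = 1 by case: uU => ->; rewrite ?mulr1 ?mulrNN ?mulr1.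
  by rewrite bas1.
exact: lattice_bas_sub.
Qed.

Lemma bas_abs_det M U : unimodular U -> `|\det (bas M U)| = `|\det M|.
Proof. by move=> [h|h]; rewrite det_bas h ?mulr1// rmorphN mulrN1 normrN. Qed.

Lemma lattice_sub_bas M H : lattice M `<=` lattice H -> exists U, M = bas H U.
Proof.
move=> sub.
have [p [q e1]] : lattice H (lat_pt M 1 0) by apply: sub; exists 1, 0.
have [r [t e2]] : lattice H (lat_pt M 0 1) by apply: sub; exists 0, 1.
exists (int_mx p q r t); apply/matrixP.
move: e1 e2; rewrite /lat_pt !mulr1 !mulr0 !addr0 !add0r => -[e1 e2] [e3 e4].
by apply: ord2E; apply: ord2E; rewrite basE !mxE /=.
Qed.

(** Each basis is an integer combination of the other, and the two integer determinants have product
    1. *)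
Lemma lattice_eq_det M H : lattice M = lattice H -> \det M != 0 -> `|\det M| = `|\det H|.
Proof.
move=> e dM.
have [U hU] : exists U, M = bas H U by apply: lattice_sub_bas; rewrite e.
have [W hW] : exists W, H = bas M W by apply: lattice_sub_bas; rewrite e.
have dd : \det M = \det M * (\det (W *m U))%:~R by rewrite -det_bas basM -hW -hU.
have : (\det (W *m U))%:~R = 1 :> R by apply: (mulfI dM); rewrite -dd mulr1.
move/eqP; rewrite -[1]/(1%:~R) eqr_int det_mulmx => /eqP d1.
have uU : unimodular U.
  have /eqP := congr1 absz d1; rewrite abszM muln_eq1 => /andP[_ /eqP].
  by rewrite /unimodular; move: (\det U); clear; lia.
by rewrite hU bas_abs_det.
Qed.

Definition gramA M := M 0 0 ^+ 2 + M 1 0 ^+ 2.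
Definition gramB M := M 0 0 * M 0 1 + M 1 0 * M 1 1.
Definition gramC M := M 0 1 ^+ 2 + M 1 1 ^+ 2.

(* Selling parameters: minus the normalised scalar products of the superbase [e1, e2, - e1 - e2] *)
Definition sell V M : R * R * R :=
  (2 * (gramA M + gramB M) / V, 2 * (gramC M + gramB M) / V, - (2 * gramB M) / V).

Lemma gram_det M : gramA M * gramC M - gramB M ^+ 2 = (\det M) ^+ 2.
Proof. by rewrite det2 /gramA /gramB /gramC; ring. Qed.

(** [quad] with the Selling parameters is the squared length divided by V, whence the parameter pi
    alpha V. *)
Lemma theta_energy alpha V M x y E : \det M != 0 -> `|\det M| = V ->
  energy (pi * alpha * V) (sell V M) x y E ->
  theta_E (lattice M) (M 0 0 * x + M 0 1 * y, M 1 0 * x + M 1 1 * y) alpha = E%:E.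
Proof.
move=> dM dV hE; have V0 : V != 0 by rewrite -dV normr_eq0.
pose e (p : int * int) := lat_pt M p.1 p.2.
have bij : set_bij [set: int * int] (lattice M) e.
  split.
  - by move=> p _; exists p.1, p.2.
  - move=> [k l] [k' l'] _ _; rewrite /e /lat_pt /= => -[h1 h2].
    have z1 : \det M * (k%:~R - k'%:~R) = 0.
      transitivity (M 1 1 * ((M 0 0 * k%:~R + M 0 1 * l%:~R) - (M 0 0 * k'%:~R + M 0 1 * l'%:~R)) -
         M 0 1 * ((M 1 0 * k%:~R + M 1 1 * l%:~R) - (M 1 0 * k'%:~R + M 1 1 * l'%:~R))).
        by rewrite det2; ring.
      by rewrite h1 h2 !subrr !mulr0 subrr.
    have z2 : \det M * (l%:~R - l'%:~R) = 0.
      transitivity (M 0 0 * ((M 1 0 * k%:~R + M 1 1 * l%:~R) - (M 1 0 * k'%:~R + M 1 1 * l'%:~R)) -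
         M 1 0 * ((M 0 0 * k%:~R + M 0 1 * l%:~R) - (M 0 0 * k'%:~R + M 0 1 * l'%:~R))).
        by rewrite det2; ring.
      by rewrite h1 h2 !subrr !mulr0 subrr.
    move/eqP: z1; move/eqP: z2; rewrite !mulf_eq0 (negbTE dM) /= !subr_eq0 !eqr_int.
    by move=> /eqP-> /eqP->.
  - by move=> p [k [l ->]]; exists (k, l).
rewrite /theta_E (reindex_esum _ _ _ _ bij); apply: esum_hasum => [p|]; first exact: expR_ge0.
apply: eq_hasum hE => -[k l]; congr expR.
rewrite /quad /sell /sqnorm /padd /e /lat_pt /gramA /gramB /gramC /=.
by field; exact: V0.
Qed.


Lemma lattice_coord M z : \det M != 0 ->
  exists x y, z = (M 0 0 * x + M 0 1 * y, M 1 0 * x + M 1 1 * y).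
Proof.
move=> dM; exists ((M 1 1 * z.1 - M 0 1 * z.2) / \det M), ((M 0 0 * z.2 - M 1 0 * z.1) / \det M).
by case: z => z1 z2 /=; move: dM; rewrite det2 => dM; congr (_, _); field; exact: dM.
Qed.

Lemma minE_le alpha M x y E V : \det M != 0 -> `|\det M| = V ->
  energy (pi * alpha * V) (sell V M) x y E -> (minE (lattice M) alpha <= E%:E)%E.
Proof.
move=> dM dV hE; apply: ereal_inf_lbound; exists (M 0 0 * x + M 0 1 * y, M 1 0 * x + M 1 1 * y) => //.
exact: theta_energy dM dV hE.
Qed.

Lemma minE_ge alpha V M (B : \bar R) : 0 < alpha -> \det M != 0 -> `|\det M| = V -> selling (sell V M) ->
  (forall x y E, energy (pi * alpha * V) (sell V M) x y E -> (B <= E%:E)%E) ->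
  (B <= minE (lattice M) alpha)%E.
Proof.
move=> a0 dM dV sel h; apply: le_ereal_inf_tmp => _ [z _ <-].
have [x [y ->]] := lattice_coord z dM.
have V0 : 0 < V by rewrite -dV normr_gt0.
have c0 : 0 < pi * alpha * V by rewrite !mulr_gt0// pi_gt0.
have [E hE] := energy_exists x y c0 sel.
by rewrite (theta_energy dM dV hE); exact: h hE.
Qed.

Lemma int_mx_det p q r t : \det (int_mx p q r t) = p * t - r * q.
Proof. by rewrite det2 !mxE. Qed.

(** Half the sum of the squared lengths of the superbase, the quantity that Selling's algorithm
    decreases. *)
Definition gram_sum M := gramA M + gramB M + gramC M.

Lemma gramA_bas M U : gramA (bas M U) =
  gramA M * (U 0 0)%:~R ^+ 2 + 2 * gramB M * ((U 0 0)%:~R * (U 1 0)%:~R) + gramC M * (U 1 0)%:~R ^+ 2.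
Proof. by rewrite /gramA /gramB /gramC !basE; ring. Qed.

Lemma gramC_bas M U : gramC (bas M U) =
  gramA M * (U 0 1)%:~R ^+ 2 + 2 * gramB M * ((U 0 1)%:~R * (U 1 1)%:~R) + gramC M * (U 1 1)%:~R ^+ 2.
Proof. by rewrite /gramA /gramB /gramC !basE; ring. Qed.

Lemma gramB_bas M U : gramB (bas M U) =
  gramA M * ((U 0 0)%:~R * (U 0 1)%:~R) + gramB M * ((U 0 0)%:~R * (U 1 1)%:~R + (U 1 0)%:~R * (U 0 1)%:~R)
   + gramC M * ((U 1 0)%:~R * (U 1 1)%:~R).
Proof. by rewrite /gramA /gramB /gramC !basE; ring. Qed.

(** The Gram form is positive definite, and completing the square bounds the entries of U by the
    lengths of the new basis; so only finitely many bases compete. *)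
Lemma gram_sum_coercive M : \det M != 0 -> exists b : nat, forall U,
  gram_sum (bas M U) <= gram_sum M -> forall i j, (`|U i j| <= b)%N.
Proof.
move=> dM.
have A0 : 0 <= gramA M by rewrite addr_ge0 ?sqr_ge0.
have C0 : 0 <= gramC M by rewrite addr_ge0 ?sqr_ge0.
have d2 : 0 < (\det M) ^+ 2 by rewrite lt0r sqrf_eq0 dM sqr_ge0.
pose X := 2 * gram_sum M * (gramA M + gramC M) / (\det M) ^+ 2.
exists (Num.bound X) => U le.
have lAC : gramA (bas M U) + gramC (bas M U) <= 2 * gram_sum M.
  have : 0 <= gramA (bas M U) + gramC (bas M U) + 2 * gramB (bas M U).
    rewrite (_ : _ + _ + _ = (bas M U 0 0 + bas M U 0 1) ^+ 2 + (bas M U 1 0 + bas M U 1 1) ^+ 2).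
      by rewrite addr_ge0 ?sqr_ge0.
    by rewrite /gramA /gramB /gramC; ring.
  by move: le; rewrite /gram_sum; lra.
have g0 (N : 'M[R]_2) : 0 <= gramA N /\ 0 <= gramC N by rewrite !addr_ge0 ?sqr_ge0.
have [a0 c0] := g0 (bas M U).
have small (u v q : R) : q = gramA M * u ^+ 2 + 2 * gramB M * (u * v) + gramC M * v ^+ 2 ->
    q <= 2 * gram_sum M -> u ^+ 2 <= X /\ v ^+ 2 <= X.
  move=> qE qle; have gd := gram_det M.
  have cu : (\det M) ^+ 2 * u ^+ 2 <= gramC M * q.
    by rewrite -gd qE; have := sqr_ge0 (gramC M * v + gramB M * u); lra.
  have cv : (\det M) ^+ 2 * v ^+ 2 <= gramA M * q.
    by rewrite -gd qE; have := sqr_ge0 (gramA M * u + gramB M * v); lra.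
  have q0 : 0 <= q.
    have : 0 <= (gramA M + gramC M) * q.
      have := sqr_ge0 u; have := sqr_ge0 v => v0 u0.
      have := mulr_ge0 (ltW d2) u0; have := mulr_ge0 (ltW d2) v0; lra.
    case: (ltrP 0 (gramA M + gramC M)) => [s0|s0]; first by rewrite pmulr_rge0.
    have a : gramA M = 0 by lra.
    have c : gramC M = 0 by lra.
    by move: d2; rewrite -gd a c mul0r sub0r; have := sqr_ge0 (gramB M); lra.
  have := ler_wpM2l C0 qle; have := ler_wpM2l A0 qle.
  have := mulr_ge0 C0 q0; have := mulr_ge0 A0 q0.
  by move=> *; split; rewrite /X ler_pdivlMr//; lra.
have [s00 s10] := small _ _ _ (gramA_bas M U) ltac:(lra).
have [s01 s11] := small _ _ _ (gramC_bas M U) ltac:(lra).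
have fin (k : int) : k%:~R ^+ 2 <= X -> (`|k| <= Num.bound X)%N.
  move=> hk; have X0 : 0 <= X by apply: le_trans hk; exact: sqr_ge0.
  rewrite -(ler_nat R); apply/ltW/(le_lt_trans _ (archi_boundP X0))/(le_trans _ hk).
  rewrite pmulrn abszE -rmorphXn ler_int /= -(real_normK (num_real k)).
  by move: (`|k|) (normr_ge0 k) => n; clear; nia.
by apply: ord2E; apply: ord2E; apply: fin.
Qed.

Lemma gram_sum_min M : \det M != 0 -> exists U, unimodular U /\
  forall U', unimodular U' -> gram_sum (bas M U) <= gram_sum (bas M U').
Proof.
move=> dM; have [b hb] := gram_sum_coercive dM.
(* Matrices with entries in [-b, b] are coded over a finite type, where a minimum exists; the
   ordinal i stands for i - b. *)
pose dec (X : 'M['I_(b + b).+1]_2) : 'M[int]_2 := map_mx (fun i : 'I_(b + b).+1 => i%:Z - b%:Z) X.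
have decP U : (forall i j, (`|U i j| <= b)%N) -> exists X, dec X = U.
  move=> hU; exists (map_mx (fun z : int => inord `|z + b%:Z|) U).
  apply/matrixP => i j; rewrite !mxE inordK; have := hU i j; move: (U i j) => z; clear; lia.
have [X1 hX1] : exists X, dec X = 1%:M.
  apply: decP; have b1 := hb 1%:M; rewrite bas1 lexx in b1; exact: b1.
pose P X := `|\det (dec X)| == 1.
have uP U : unimodular U <-> `|\det U| = 1.
  by rewrite /unimodular; move: (\det U) => z; split; lia.
have P1 : P X1 by rewrite /P hX1 det1.
have [X PX hX] := arg_minP (fun X => gram_sum (bas M (dec X))) P1.
exists (dec X); split; first by apply/uP/eqP.
move=> U' uU'; case: (lerP (gram_sum (bas M U')) (gram_sum M)) => le.
  have [X' hX'] := decP _ (hb _ le); rewrite -hX'; apply: hX.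
  by rewrite /P hX'; apply/eqP/uP.
by apply: le_trans (ltW le); have := hX X1 P1; rewrite hX1 bas1.
Qed.

End Lattices.

(** * Selling reduction and recognition of the hexagonal lattice *)

Section Reduction.
Variable R : realType.
Implicit Types (M H : 'M[R]_2) (U : 'M[int]_2) (V x y c sg : R).

Lemma unimodularM U U' : unimodular U -> unimodular U' -> unimodular (U *m U').
Proof. by rewrite /unimodular det_mulmx => -[->|->] [->|->]; [left|right|right|left]. Qed.

Lemma int_mx_unimodular p q r t : p * t - r * q = 1 \/ p * t - r * q = -1 -> unimodular (int_mx p q r t).
Proof. by rewrite /unimodular int_mx_det. Qed.

Lemma sell_det V M : V != 0 -> V ^+ 2 = (\det M) ^+ 2 -> let s := sell V M in
  s.1.1 * s.1.2 + s.1.2 * s.2 + s.2 * s.1.1 = 4.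
Proof.
move=> V0 VE; rewrite /sell /=.
rewrite [LHS](_ : _ = 4 * (gramA M * gramC M - gramB M ^+ 2) / V ^+ 2); last by field.
by rewrite gram_det -VE mulfK// expf_neq0.
Qed.

(** Comparison with the bases (e1, - e2), (e1, e1 + e2) and (e1 + e2, e2) gives one sign each. *)
Lemma selling_min V M : 0 < V -> V ^+ 2 = (\det M) ^+ 2 ->
  (forall U, unimodular U -> gram_sum M <= gram_sum (bas M U)) -> selling (sell V M).
Proof.
move=> V0 VE hmin.
have m p q r t (h : p * t - r * q = 1 \/ p * t - r * q = -1) := hmin _ (int_mx_unimodular h).
have m1 := m 1 0 0 (-1) (or_intror erefl).
have m2 := m 1 0 1 1 (or_introl erefl).
have m3 := m 1 1 0 1 (or_introl erefl).
move: m1 m2 m3; rewrite /gram_sum !gramA_bas !gramB_bas !gramC_bas !mxE /= => m1 m2 m3.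
split; last by apply: sell_det => //; exact: lt0r_neq0.
- by rewrite /sell /= divr_ge0 ?(ltW V0)//; lra.
- by rewrite /sell /= divr_ge0 ?(ltW V0)//; lra.
- by rewrite /sell /= divr_ge0 ?(ltW V0)//; lra.
Qed.

(** Here and in the next two lemmas, exchanging two vectors of the superbase exchanges two of the
    parameters. *)
Lemma sell_swap12 V M : let s := sell V M in sell V (bas M (int_mx 0 1 1 0)) = (s.1.2, s.1.1, s.2).
Proof.
by rewrite /sell !gramA_bas !gramB_bas !gramC_bas !mxE /=; congr (_ / _, _ / _, _ / _); ring.
Qed.

Lemma sell_swap13 V M : let s := sell V M in sell V (bas M (int_mx 1 0 (-1) (-1))) = (s.2, s.1.2, s.1.1).
Proof.
by rewrite /sell !gramA_bas !gramB_bas !gramC_bas !mxE /=; congr (_ / _, _ / _, _ / _); ring.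
Qed.

Lemma sell_swap23 V M : let s := sell V M in sell V (bas M (int_mx (-1) (-1) 0 1)) = (s.1.1, s.2, s.1.2).
Proof.
by rewrite /sell !gramA_bas !gramB_bas !gramC_bas !mxE /=; congr (_ / _, _ / _, _ / _); ring.
Qed.

Lemma reduced_basis V M : \det M != 0 -> `|\det M| = V -> exists U s1 s2 s3,
  [/\ unimodular U, sell V (bas M U) = (s1, s2, s3), selling (s1, s2, s3), s3 <= s2 & s2 <= s1].
Proof.
move=> dM dV; have V0 : 0 < V by rewrite -dV normr_gt0.
pose red s := exists U, [/\ unimodular U, sell V (bas M U) = s & selling s].
have [U [uU hU]] := gram_sum_min dM.
have VE : V ^+ 2 = (\det (bas M U)) ^+ 2.
  by rewrite -dV -(bas_abs_det M uU) real_normK ?num_real.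
have r0 : red (sell V (bas M U)).
  exists U; split=> //; apply: selling_min => // U' uU'; rewrite -basM; apply: hU; exact: unimodularM.
have r12 s1 s2 s3 : red (s1, s2, s3) -> red (s2, s1, s3).
  move=> [W [uW e [/= h1 h2 h3 h4]]]; exists (W *m int_mx 0 1 1 0); split; last by split=> //=; lra.
    by apply: unimodularM => //; apply: int_mx_unimodular; right.
  by rewrite basM sell_swap12 e.
have r13 s1 s2 s3 : red (s1, s2, s3) -> red (s3, s2, s1).
  move=> [W [uW e [/= h1 h2 h3 h4]]]; exists (W *m int_mx 1 0 (-1) (-1)); split; last by split=> //=; lra.
    by apply: unimodularM => //; apply: int_mx_unimodular; right.
  by rewrite basM sell_swap13 e.
have r23 s1 s2 s3 : red (s1, s2, s3) -> red (s1, s3, s2).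
  move=> [W [uW e [/= h1 h2 h3 h4]]]; exists (W *m int_mx (-1) (-1) 0 1); split; last by split=> //=; lra.
    by apply: unimodularM => //; apply: int_mx_unimodular; right.
  by rewrite basM sell_swap23 e.
have [s1 [s2 [s3 [[W [uW e sel]] h32 h21]]]] : exists s1 s2 s3, [/\ red (s1, s2, s3), s3 <= s2 & s2 <= s1].
  move: r0; case: (sell _ _) => [[s1 s2] s3] r.
  case: (lerP s2 s1) => h12; case: (lerP s3 s2) => h23; case: (lerP s3 s1) => h13; try (exfalso; lra).
  - by exists s1, s2, s3.
  - by exists s1, s3, s2; split; [exact: r23|lra|lra].
  - by exists s3, s1, s2; split; [exact: r12 (r13 _ _ _ r) || exact: r23 (r13 _ _ _ r)|lra|lra].
  - by exists s2, s1, s3; split; [exact: r12|lra|lra].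
  - by exists s2, s3, s1; split; [exact: r13 _ _ _ (r12 _ _ _ (r13 _ _ _ (r23 _ _ _ (r12 _ _ _ r)))) || exact: r23 _ _ _ (r12 _ _ _ r)|lra|lra].
  - by exists s3, s2, s1; split; [exact: r13|lra|lra].
by exists W, s1, s2, s3.
Qed.

Lemma hexmx_gram c theta (H := hexmx c theta) :
  [/\ gramA H = c ^+ 2, gramB H = c ^+ 2 / 2, gramC H = c ^+ 2 & \det H = c ^+ 2 * (Num.sqrt 3 / 2)].
Proof.
have e3 : Num.sqrt 3 ^+ 2 = 3 :> R by rewrite sqr_sqrtr.
have cs := cos2Dsin2 theta.
rewrite /gramA /gramB /gramC det2 !mxE /=; set q := Num.sqrt 3 in e3 *.
set u := cos theta in cs *; set v := sin theta in cs *.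
have k : c ^+ 2 * (u ^+ 2 + v ^+ 2) = c ^+ 2 by rewrite cs mulr1.
have k3 : c ^+ 2 * (u ^+ 2 + v ^+ 2) * q ^+ 2 = c ^+ 2 * 3 by rewrite cs mulr1 e3.
have kq : c ^+ 2 * (u ^+ 2 + v ^+ 2) * q = c ^+ 2 * q by rewrite cs mulr1.
by split; lra.
Qed.

(** The basis [hexmx] encloses 60 degrees; changing the sign of its second vector gives the 120
    degrees of a superbase. *)
Lemma hexmx_obtuse c theta sg V (H := bas (hexmx c theta) (int_mx 1 0 0 (-1))) :
  V != 0 -> c ^+ 2 = V * sg -> sell V H = (sg, sg, sg).
Proof.
move=> V0 cV; have [gA gB gC _] := hexmx_gram c theta.
rewrite /sell /H !gramA_bas !gramB_bas !gramC_bas gA gB gC cV !mxE /=.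
by congr (_, _, _); field.
Qed.

Lemma polar (a b c : R) : 0 < c -> a ^+ 2 + b ^+ 2 = c ^+ 2 ->
  exists theta, a = c * cos theta /\ b = c * sin theta.
Proof.
move=> c0 h; pose u := a / c; pose v := b / c.
have cn := lt0r_neq0 c0.
have uv : u ^+ 2 + v ^+ 2 = 1 by rewrite /u /v !expr_div_n -mulrDl h divff// expf_neq0.
have u1 : -1 <= u <= 1 by
  rewrite -ler_norml -ler_sqr ?nnegrE// real_normK ?num_real// expr1n; have := sqr_ge0 v; lra.
have sv : Num.sqrt (1 - u ^+ 2) = `|v| by rewrite (_ : 1 - u ^+ 2 = v ^+ 2) ?sqrtr_sqr//; lra.
have ca : cos (acos u) = u by apply: acosK.
have sa : sin (acos u) = `|v| by rewrite sin_acos.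
have ae : a = c * u by rewrite /u; field.
have be : b = c * v by rewrite /v; field.
case: (lerP 0 v) => v0.
  by exists (acos u); rewrite ca sa ger0_norm.
by exists (- acos u); rewrite cosN sinN ca sa ltr0_norm// opprK.
Qed.

(** The first column yields c and the angle. The Gram data then leave two choices for the second
    column, at 120 or -120 degrees from the first, told apart by the sign of \det M; both span the
    same lattice. *)
Lemma sell_hexagonal M V sg : \det M != 0 -> `|\det M| = V -> 0 < sg -> 3 * sg ^+ 2 = 4 ->
  sell V M = (sg, sg, sg) -> is_hexagonal (lattice M).
Proof.
move=> dM dV g0 gE [s1 s2 s3].
have V0 : 0 < V by rewrite -dV normr_gt0.
have Vn := lt0r_neq0 V0.
have B : gramB M = - (V * sg) / 2 by rewrite -s3; field.
have A : gramA M = V * sg.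
  have -> : gramA M = V * sg / 2 - gramB M by rewrite -s1; field.
  by rewrite B; lra.
pose c := Num.sqrt (V * sg); have c0 : 0 < c by rewrite sqrtr_gt0 mulr_gt0.
have c2 : c ^+ 2 = V * sg by rewrite sqr_sqrtr// mulr_ge0// ltW.
have [th [e1 e2]] := @polar (M 0 0) (M 1 0) c c0 ltac:(by rewrite c2 -A).
pose q : R := Num.sqrt 3; have q2 : q ^+ 2 = 3 by rewrite sqr_sqrtr.
have q0 : 0 <= q by exact: sqrtr_ge0.
have Vq : V = q / 2 * c ^+ 2.
  have qs : q * sg = 2 by apply/eqP; rewrite -(@eqrXn2 R 2)// ?mulr_ge0 ?(ltW g0)// exprMn q2 gE; apply/eqP; lra.
  by rewrite c2; transitivity (V * (q * sg) / 2); [rewrite qs mulfK|field].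
exists c, th; split => //.
have H00 : hexmx c th 0 0 = M 0 0 by rewrite mxE /= e1.
have H10 : hexmx c th 1 0 = M 1 0 by rewrite mxE /= e2.
have H01 : hexmx c th 0 1 = M 0 0 / 2 - M 1 0 * (q / 2) by rewrite mxE /= e1 e2 /q; ring.
have H11 : hexmx c th 1 1 = M 1 0 / 2 + M 0 0 * (q / 2) by rewrite mxE /= e1 e2 /q; ring.
have cn : c ^+ 2 != 0 by rewrite expf_neq0// lt0r_neq0.
have f1 : c ^+ 2 * M 0 1 = M 0 0 * gramB M - M 1 0 * \det M.
  by rewrite c2 -A det2 /gramA /gramB; ring.
have f2 : c ^+ 2 * M 1 1 = M 1 0 * gramB M + M 0 0 * \det M.
  by rewrite c2 -A det2 /gramA /gramB; ring.
rewrite B -c2 in f1 f2.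
have [dp|dn] : \det M = q / 2 * c ^+ 2 \/ \det M = - (q / 2 * c ^+ 2).
  by rewrite -Vq -dV; case: (lerP 0 (\det M)) => h; [left; rewrite ger0_norm|right; rewrite ltr0_norm ?opprK].
  have -> : M = bas (hexmx c th) (int_mx 1 0 (-1) 1).
    apply/matrixP; apply: ord2E; apply: ord2E; rewrite basE ?H00 ?H10 ?H01 ?H11 !mxE /=.
    - lra.
    - by apply: (mulfI cn); rewrite f1 dp; lra.
    - lra.
    - by apply: (mulfI cn); rewrite f2 dp; lra.
  by rewrite lattice_bas//; apply: int_mx_unimodular; left.
have -> : M = bas (hexmx c th) (int_mx 1 0 0 (-1)).
  apply/matrixP; apply: ord2E; apply: ord2E; rewrite basE ?H00 ?H10 ?H01 ?H11 !mxE /=.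
  - lra.
  - by apply: (mulfI cn); rewrite f1 dn; lra.
  - lra.
  - by apply: (mulfI cn); rewrite f2 dn; lra.
by rewrite lattice_bas//; apply: int_mx_unimodular; right.
Qed.

(** Equal Selling parameters give equal energies. Otherwise the number B of [energy_strict] lies
    strictly above one value of the energy of M and below all those of H, so strictness survives the
    infimum. *)
Lemma minE_hex alpha V sg M H : 0 < alpha -> 0 < sg -> 3 * sg ^+ 2 = 4 ->
  \det M != 0 -> `|\det M| = V -> \det H != 0 -> `|\det H| = V -> sell V H = (sg, sg, sg) ->
  (minE (lattice M) alpha <= minE (lattice H) alpha)%E /\
  (is_hexagonal (lattice M) \/ (minE (lattice M) alpha < minE (lattice H) alpha)%E).
Proof.
move=> a0 g0 gE dM dV dH dVH sH.
have V0 : 0 < V by rewrite -dV normr_gt0.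
have c0 : 0 < pi * alpha * V by rewrite !mulr_gt0// pi_gt0.
have hsel := selling_hex g0 gE.
have [U [s1 [s2 [s3 [uU sU sel s32 s21]]]]] := reduced_basis dM dV.
have dN : \det (bas M U) != 0 by rewrite -normr_eq0 bas_abs_det// normr_eq0.
have dNV : `|\det (bas M U)| = V by rewrite bas_abs_det.
rewrite -(lattice_bas M uU).
have selH : selling (sell V H) by rewrite sH.
have [e|ne] := pselect ((s1, s2, s3) = (sg, sg, sg)).
  split; last by left; apply: sell_hexagonal dN dNV g0 gE _; rewrite sU.
  apply: (minE_ge a0 dH dVH selH) => x y E hE; apply: (@minE_le _ _ _ x y _ V) => //.
  by rewrite sU e -sH.
have [x [y [E [B [hE EB hB]]]]] := energy_strict c0 g0 gE sel s32 s21 ne.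
suff lt : (minE (lattice (bas M U)) alpha < minE (lattice H) alpha)%E by split; [exact: ltW|right].
apply: (@le_lt_trans _ _ E%:E); first by apply: minE_le dN dNV _; rewrite sU; exact: hE.
apply: (@lt_le_trans _ _ B%:E); first by rewrite lte_fin.
apply: (minE_ge a0 dH dVH selH) => x' y' E'; rewrite sH lee_fin; exact: hB.
Qed.

End Reduction.

Theorem theorem2p1 (R : realType) (alpha V : R) (halpha : 0 < alpha) (hV : 0 < V)
  (M : 'M[R]_2) (hM : \det M != 0) (hMV : `|\det M| = V) :
  (forall M' : 'M[R]_2, \det M' != 0 -> `|\det M'| = V ->
     (minE (lattice M') alpha <= minE (lattice M) alpha)%E)
  <-> is_hexagonal (lattice M).
Proof.
pose q : R := Num.sqrt 3; pose sg := 2 / q.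
have q0 : 0 < q by rewrite sqrtr_gt0.
have q2 : q ^+ 2 = 3 by rewrite sqr_sqrtr.
have g0 : 0 < sg by rewrite divr_gt0.
have gE : 3 * sg ^+ 2 = 4 by rewrite /sg expr_div_n q2; field.
have Vn := lt0r_neq0 hV.
have u1 : unimodular (int_mx 1 0 0 (-1)) by apply: int_mx_unimodular; right.
have dhex c theta : \det (hexmx c theta) = c ^+ 2 / sg.
  by have [_ _ _ ->] := hexmx_gram c theta; rewrite /sg -/q; field; exact: lt0r_neq0.
split=> [hmax|[c [theta [c0 e]]] M' dM' dV'].
  (* The hexagonal competitor: its covolume is c^2 / sg, so c^2 = V sg. *)
  pose c := Num.sqrt (V * sg); have c2 : c ^+ 2 = V * sg by rewrite sqr_sqrtr// mulr_ge0// ltW.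
  have dH : \det (hexmx c 0) = V by rewrite dhex c2 mulfK// lt0r_neq0.
  have dH0 : \det (bas (hexmx c 0) (int_mx 1 0 0 (-1))) != 0.
    by rewrite -normr_eq0 bas_abs_det// normr_eq0 dH.
  have dHV : `|\det (bas (hexmx c 0) (int_mx 1 0 0 (-1)))| = V by rewrite bas_abs_det// dH gtr0_norm.
  have [_ [//|lt]] := minE_hex halpha g0 gE hM hMV dH0 dHV (hexmx_obtuse 0 Vn c2).
  by have := hmax _ dH0 dHV; rewrite leNgt lt.
have dHV : `|\det (bas (hexmx c theta) (int_mx 1 0 0 (-1)))| = V.
  by rewrite bas_abs_det// -hMV; apply/esym/lattice_eq_det.
have dH0 : \det (bas (hexmx c theta) (int_mx 1 0 0 (-1))) != 0 by rewrite -normr_eq0 dHV.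
have c2 : c ^+ 2 = V * sg.
  move: dHV; rewrite bas_abs_det// dhex ger0_norm; last by rewrite divr_ge0 ?sqr_ge0 ?(ltW g0).
  by move=> <-; rewrite divfK// lt0r_neq0.
have [le _] := minE_hex halpha g0 gE dM' dV' dH0 dHV (hexmx_obtuse theta Vn c2).
by move: le; rewrite (lattice_bas _ u1) -e.
Qed.
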